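(* Let $d\ge1$, let $\mu\in M_+(\overline{B}_d)$, and let $b:B_d\to\mathbb{D}$ be a $\mu$-admissible non-inner holomorphic function. Assume that $\mu$ is a reverse Carleson measure for the space $\mathcal{H}(b)$. Then the Radon–Nikodym derivative $$\frac{d\mu|_{\partial B_d}}{d\sigma}$$ (of the absolutely continuous part of $\mu|_{\partial B_d}$ with respect to $\sigma$) is not the zero element of $L^1(\partial B_d,\sigma)$, and $$\int_{\{\zeta\in\partial B_d:\ |b(\zeta)|<1\}}\frac{1}{1-|b|}\,d\sigma<\infty.$$
   Context: $B_d$ is the open unit ball of $\mathbb{C}^d$, $\overline{B}_d$ its closure, $\partial B_d$ the unit sphere, $\sigma=\sigma_d$ the normalized Lebesgue measure on $\partial B_d$, and $\mathbb{D}=B_1$ the open unit disk. $M_+(\overline{B}_d)$ is the set of all finite positive Borel measures on $\overline{B}_d$. $\langle\cdot,\cdot\rangle$ is the standard Hermitian inner product on $\mathbb{C}^d$, linear in the first variable. For a holomorphic function $b:B_d\to\mathbb{D}$, the de Branges–Rovnyak space $\mathcal{H}(b)$ is the reproducing kernel Hilbert space of holomorphic functions on $B_d$ (contained in the Hardy space $H^2(B_d)$) with reproducing kernel $$\mathcal{K}^b(z,w)=\frac{1-b(z)\overline{b(w)}}{(1-\langle z,w\rangle)^d},\quad z,w\in B_d.$$ For $\zeta\in\partial B_d$, $b(\zeta)=\lim_{r\to1-}b(r\zeta)$ denotes the radial limit, which exists $\sigma$-almost everywhere. The function $b$ is called inner if $|b(\zeta)|=1$ for $\sigma$-almost all $\zeta\in\partial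 B_d$; it is non-inner otherwise. A holomorphic function $f$ on $B_d$ is called $\mu$-admissible if $f$ has radial limits $\mu$-almost everywhere on $\partial B_d$ (i.e. $\mu|_{\partial B_d}$-almost everywhere). $\mathcal{H}_\mu(b)$ denotes the set of all $\mu$-admissible functions in $\mathcal{H}(b)$. For $f\in\mathcal{H}_\mu(b)$, $f$ is defined $\mu|_{\partial B_d}$-almost everywhere on $\partial B_d$ by its radial limits, so that $\|f\|_{L^2(\overline{B}_d,\mu)}\in[0,+\infty]$ makes sense. The measure $\mu$ is called a reverse Carleson measure for $\mathcal{H}(b)$ if there is a constant $C>0$ with $\|f\|_{\mathcal{H}(b)}\le C\|f\|_{L^2(\overline{B}_d,\mu)}$ for all $f\in\mathcal{H}_\mu(b)$. *)

(* Defs.v *)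
From HB Require Import structures.
From mathcomp Require Import all_boot all_order all_algebra.
From mathcomp Require Import complex.
From mathcomp Require Import all_classical all_reals all_analysis.
From mathcomp Require Import measurable_realfun lra.

Set Implicit Arguments.
Unset Strict Implicit.
Unset Printing Implicit Defensive.

Import Order.TTheory GRing.Theory Num.Theory.
Import numFieldNormedType.Exports.

Local Open Scope classical_set_scope.
Local Open Scope ring_scope.

Local Notation Re := complex.Re.
Local Notation Im := complex.Im.
Local Notation normc := Normc.normc.

(* [R[i]] is a normed module over itself (with its usual topology), and
   ['rV[R[i]]_d] carries the Borel sigma-algebra of its (product) topology. *)
HB.instance Definition _ (R : realType) := NormedModule.copy R[i] R[i]^o.

HB.instance Definition _ (R : realType) (d : nat) :=
  Measurable.copy 'rV[R[i]]_d (g_sigma_algebraType (@open 'rV[R[i]]_d)).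

Section image_measure.
Context d1 d2 (T1 : measurableType d1) (T2 : measurableType d2) (R : realType).
Variables (m : {measure set T1 -> \bar R}) (f : T1 -> T2).
Variable mf : measurable_fun [set: T1] f.

(* The pushforward, carrying the measurability proof so that the measure
   structure can be inferred. *)
Definition mimage of measurable_fun [set: T1] f : set T2 -> \bar R :=
  pushforward m f.
Local Notation im := (mimage mf).

Let mimage0 : im set0 = 0%E.
Proof. by rewrite /mimage /pushforward preimage_set0 measure0. Qed.

Let mimage_ge0 A : (0 <= im A)%E. Proof. exact: measure_ge0. Qed.

Let mimage_sigma_additive : semi_sigma_additive im.
Proof.
move=> F mF tF mUF; rewrite /mimage /pushforward preimage_bigcup.
apply: measure_semi_sigma_additive.
- by move=> n; rewrite -[X in measurable X]setTI; exact: mf.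
- apply/trivIsetP => /= i j _ _ ij; rewrite -preimage_setI.
  by move/trivIsetP : tF => /(_ _ _ _ _ ij) ->//; rewrite preimage_set0.
- by rewrite -preimage_bigcup -[X in measurable X]setTI; exact: mf.
Qed.

HB.instance Definition _ := isMeasure.Build _ _ _ im
  mimage0 mimage_ge0 mimage_sigma_additive.

End image_measure.

(* The library's canonical sigma-finite structure on [m1 \x m2] is only inferred
   for subprobabilities. *)
Lemma sigma_finite_prod d1 d2 (T1 : measurableType d1) (T2 : measurableType d2)
    (R : realType) (m1 : {sigma_finite_measure set T1 -> \bar R})
    (m2 : {sigma_finite_measure set T2 -> \bar R}) :
  sigma_finite setT (m1 \x m2)%E.
Proof.
have /sigma_finiteP[F [TF ndF Foo]] := sigma_finiteT m1.
have /sigma_finiteP[G [TG ndG Goo]] := sigma_finiteT m2.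
exists (fun n => F n `*` G n).
  rewrite -setXTT TF TG predeqE => -[x y]; split.
    move=> [/= [i _ Fnx] [k _ Gky]]; exists (maxn i k) => //; split.
    - by move: x Fnx; exact/subsetPset/ndF/leq_maxl.
    - by move: y Gky; exact/subsetPset/ndG/leq_maxr.
  by move=> [k _ []/= ? ?]; split; exists k.
move=> k; have [? ?] := Foo k; have [? ?] := Goo k.
split; first exact: measurableX.
by rewrite product_measure1E// lte_mul_pinfty// ge0_fin_numE.
Qed.

Section tuple_measure.
Context dT (T : measurableType dT) (R : realType).
Variable m : {sigma_finite_measure set T -> \bar R}.

Definition pair_cons n (p : T * n.-tuple T) : n.+1.-tuple T :=
  [tuple of p.1 :: p.2].

Lemma measurable_pair_cons n :
  measurable_fun [set: T * n.-tuple T] (@pair_cons n).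
Proof. exact: measurable_cons. Qed.

Section cons_measure.
Variables (n : nat) (P : {sigma_finite_measure set (n.-tuple T) -> \bar R}).

Definition cons_measure := mimage (m \x P)%E (@measurable_pair_cons n).

HB.instance Definition _ := Measure.on cons_measure.

Let cons_measure_sigma_finite : sigma_finite setT cons_measure.
Proof.
have [F FT Foo] := sigma_finite_prod m P.
pose g (t : n.+1.-tuple T) := (thead t, [tuple of behead t] : n.-tuple T).
have gK : cancel (@pair_cons n) g.
  by move=> [x t]; rewrite /g /pair_cons theadE; congr pair; exact/val_inj.
have mg : measurable_fun [set: n.+1.-tuple T] g.
  apply: measurable_fun_pair; first exact: measurable_tnth.
  exact: measurable_behead.
exists (fun k => g @^-1` F k).
  by rewrite -preimage_bigcup -FT preimage_setT.
move=> k; have [mF Fk] := Foo k; split.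
  by rewrite -[X in measurable X]setTI; exact: mg.
rewrite /cons_measure /mimage /pushforward -comp_preimage.
by rewrite (_ : g \o _ = id) ?preimage_id//; apply/funext => x; exact: gK.
Qed.

HB.instance Definition _ := Measure_isSigmaFinite.Build _ _ _ cons_measure
  cons_measure_sigma_finite.

End cons_measure.

Fixpoint tuple_measure n : {sigma_finite_measure set (n.-tuple T) -> \bar R} :=
  match n with
  | 0 => \d_([tuple] : 0.-tuple T)
  | k.+1 => cons_measure (tuple_measure k)
  end.

End tuple_measure.

Section complex_borel.
Context (R : realType).

Lemma normc_leD (x : R[i]) : normc x <= `|Re x| + `|Im x|.
Proof.
case: x => a b /=; rewrite -[leRHS]ger0_norm ?addr_ge0// -sqrtr_sqr.
rewrite ler_wsqrtr// sqrrD !real_normK ?num_real// lerD2r lerDl.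
by rewrite mulrn_wge0// mulr_ge0.
Qed.

Lemma normr_normc (x : R[i]) : `|x| = (normc x)%:C%C.
Proof. by case: x. Qed.

Lemma Re_le_normc (x : R[i]) : `|Re x| <= normc x.
Proof. by case: x => a b /=; rewrite -sqrtr_sqr ler_wsqrtr// lerDl sqr_ge0. Qed.

Lemma Im_le_normc (x : R[i]) : `|Im x| <= normc x.
Proof. by case: x => a b /=; rewrite -sqrtr_sqr ler_wsqrtr// lerDr sqr_ge0. Qed.

Lemma ReB (x y : R[i]) : Re (x - y) = Re x - Re y.
Proof. by case: x; case: y. Qed.

Lemma ImB (x y : R[i]) : Im (x - y) = Im x - Im y.
Proof. by case: x; case: y. Qed.

Lemma Re_continuous : continuous (@complex.Re R).
Proof.
move=> x; apply/(@cvgrPdist_lt _ _ R[i] (nbhs x) (nbhs_filter x)) => e e0.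
apply/nbhs_ballP.
exists (e%:C)%C => /=; first by rewrite ltcR.
move=> y; rewrite -ball_normE /ball_ /= normr_normc ltcR => xy.
by rewrite -ReB (le_lt_trans (Re_le_normc _)).
Qed.

Lemma Im_continuous : continuous (@complex.Im R).
Proof.
move=> x; apply/(@cvgrPdist_lt _ _ R[i] (nbhs x) (nbhs_filter x)) => e e0.
apply/nbhs_ballP.
exists (e%:C)%C => /=; first by rewrite ltcR.
move=> y; rewrite -ball_normE /ball_ /= normr_normc ltcR => xy.
by rewrite -ImB (le_lt_trans (Im_le_normc _)).
Qed.

End complex_borel.

Section euclidean.
Context (R : realType) (d : nat).
Local Notation Cd := 'rV[R[i]]_d.
Local Notation RT := (measurableTypeR R).
Implicit Types z w : Cd.

Definition hdot z w : R[i] := \sum_i z ord0 i * (w ord0 i)^*%C.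

Definition enorm z : R := Num.sqrt (\sum_i normc (z ord0 i) ^+ 2).

Definition unit_ball : set Cd := [set z | enorm z < 1].
Definition closed_unit_ball : set Cd := [set z | enorm z <= 1].
Definition unit_sphere : set Cd := [set z | enorm z = 1].

Lemma measurable_coord (h : R[i] -> R) i : continuous h ->
  measurable_fun [set: Cd] (fun z => h (z ord0 i)).
Proof.
move=> ch; apply: (measurability _ (RGenOpens.measurableE R)).
move=> _ [_ [a [b ->]] <-]; rewrite setTI; apply: sub_sigma_algebra.
apply: (@open_comp _ _ (fun z : Cd => h (z ord0 i))); last exact: interval_open.
move=> z _; apply: (continuous_comp (f := fun z : Cd => z ord0 i)).
  exact: coord_continuous.
exact: ch.
Qed.

Lemma measurable_enorm : measurable_fun [set: Cd] enorm.
Proof.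
apply: (measurableT_comp (f := @Num.sqrt R)).
  apply: continuous_measurable_fun; exact: sqrt_continuous.
apply: measurable_sum => i.
rewrite (_ : (fun _ => _) =
  fun z : Cd => complex.Re (z ord0 i) ^+ 2 + complex.Im (z ord0 i) ^+ 2).
  apply: measurable_funD; apply: measurable_funX; apply: measurable_coord.
    exact: Re_continuous.
  exact: Im_continuous.
apply/funext => z; case: (z ord0 i) => x y /=.
by rewrite sqr_sqrtr// addr_ge0// sqr_ge0.
Qed.

Lemma measurable_unit_ball : measurable unit_ball.
Proof.
rewrite -[X in measurable X]setTI (_ : unit_ball = enorm @^-1` `]-oo, 1[).
  exact: measurable_enorm.
by apply/seteqP; split => z /=; rewrite in_itv.
Qed.

Lemma measurable_unit_sphere : measurable unit_sphere.
Proof.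
rewrite -[X in measurable X]setTI (_ : unit_sphere = enorm @^-1` [set 1]) //.
by apply: measurable_enorm => //; exact: measurable_set1.
Qed.

Definition box (q : {ffun 'I_d -> rat * rat} * nat) : set Cd :=
  [set z | forall i, `|complex.Re (z ord0 i) - ratr (q.1 i).1| < q.2.+1%:R^-1
                  /\ `|complex.Im (z ord0 i) - ratr (q.1 i).2| < q.2.+1%:R^-1].

Lemma open_bigcup_box (U : set Cd) : open U ->
  U = \bigcup_q (if `[< box q `<=` U >] then box q else set0).
Proof.
move=> oU; apply/seteqP; split => [z Uz|z [q _]]; last first.
  by case: asboolP => // + qz; exact.
have /nbhs_ballP[e /= e0 eU] : nbhs z U by exact: open_nbhs_nbhs.
have eE : e = (complex.Re e)%:C%C by rewrite RRe_real// gtr0_real.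
move: e0; rewrite eE ltcR => e0.
have [n ne] : exists n, n.+1%:R^-1 < complex.Re e / 4%:R.
  have e4 : 0 < complex.Re e / 4%:R by rewrite divr_gt0.
  by have [n _ /(_ n (leqnn n))] := near_infty_natSinv_lt (PosNum e4); exists n.
have rat_near (x : R) : exists q : rat, `|x - ratr q| < n.+1%:R^-1.
  have /rat_in_itvoo[q] : x - n.+1%:R^-1 < x + n.+1%:R^-1.
    by rewrite ltrD2l gtrN// invr_gt0.
  by rewrite in_itv/= => qx; exists q; rewrite distrC ltr_distl.
have /choice[p hp] (i : 'I_d) : exists q : rat * rat,
    `|complex.Re (z ord0 i) - ratr q.1| < n.+1%:R^-1
 /\ `|complex.Im (z ord0 i) - ratr q.2| < n.+1%:R^-1.
  have [q1 ?] := rat_near (complex.Re (z ord0 i)).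
  have [q2 ?] := rat_near (complex.Im (z ord0 i)).
  by exists (q1, q2).
exists ([ffun i => p i], n) => //; rewrite asboolT => [|w ww].
  by move=> i /=; rewrite ffunE.
apply: eU; rewrite eE; split; first by rewrite ltcR.
move=> j i; rewrite ord1 -ball_normE /ball_ /= normr_normc ltcR.
apply: le_lt_trans (normc_leD _) _; rewrite ReB ImB.
have lt2 (a a' q : R) : `|a - q| < n.+1%:R^-1 -> `|a' - q| < n.+1%:R^-1 ->
    `|a - a'| < complex.Re e / 2.
  move=> aq a'q; apply: le_lt_trans (ler_distD q _ _) _.
  rewrite [X in _ + X]distrC; move: aq a'q ne.
  by move: (n.+1%:R^-1) `|_| `|_| => r x y; lra.
have [Rz Iz] := hp i; have := ww i; rewrite /= ffunE => -[Rw Iw].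
by have := lt2 _ _ _ Rz Rw; have := lt2 _ _ _ Iz Iw; lra.
Qed.

Lemma measurable_fun_rowC dT (T : measurableType dT) (f : T -> Cd) :
  (forall i, measurable_fun [set: T] (fun t => complex.Re (f t ord0 i))) ->
  (forall i, measurable_fun [set: T] (fun t => complex.Im (f t ord0 i))) ->
  measurable_fun [set: T] f.
Proof.
move=> mRe mIm; apply: (measurability _ (erefl (@measurable _ Cd))) => // _ [U oU <-].
rewrite setTI (open_bigcup_box oU) preimage_bigcup.
apply: countable_bigcupT_measurable => // q.
case: asboolP => _; last by rewrite preimage_set0.
rewrite (_ : _ @^-1` _ = \big[setI/setT]_(i : 'I_d)
   ((fun t => complex.Re (f t ord0 i)) @^-1`
      ball (ratr (q.1 i).1 : R) q.2.+1%:R^-1 `&`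
    (fun t => complex.Im (f t ord0 i)) @^-1`
      ball (ratr (q.1 i).2 : R) q.2.+1%:R^-1)).
  apply: bigsetI_measurable => i _; apply: measurableI.
    by rewrite -[X in measurable X]setTI; apply: mRe => //; exact: measurable_ball.
  by rewrite -[X in measurable X]setTI; apply: mIm => //; exact: measurable_ball.
rewrite -bigcap_seq; apply/seteqP; split => t /=.
  move=> qt i _; have [? ?] := qt i.
  by split; rewrite /= -ball_normE /ball_ /= distrC.
move=> qt i; have [] := qt i (mem_index_enum i).
by rewrite /= -ball_normE /ball_ /= distrC => ? ; rewrite distrC.
Qed.

Definition row_of_pairs (t : d.-tuple (RT * RT)) : Cd :=
  \row_i ((tnth t i).1 +i* (tnth t i).2)%C.

Lemma measurable_row_of_pairs :
  measurable_fun [set: d.-tuple (RT * RT)] row_of_pairs.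
Proof.
apply: measurable_fun_rowC => i.
  rewrite (_ : (fun _ => _) = fst \o (fun t : d.-tuple (RT * RT) => tnth t i)).
    exact: (measurableT_comp measurable_fst (measurable_tnth i)).
  by apply/funext => t; rewrite /= mxE.
rewrite (_ : (fun _ => _) = snd \o (fun t : d.-tuple (RT * RT) => tnth t i)).
  exact: (measurableT_comp measurable_snd (measurable_tnth i)).
by apply/funext => t; rewrite /= mxE.
Qed.

Definition radial_proj z : Cd := ((enorm z)^-1)%:C%C *: z.

Lemma measurable_radial_proj : measurable_fun [set: Cd] radial_proj.
Proof.
have minv : measurable_fun [set: Cd] (fun z => (enorm z)^-1).
  rewrite (_ : (fun _ => _) = (fun r : R => r `^ (-1)) \o enorm).
    by apply: measurableT_comp; [exact: measurable_powR|exact: measurable_enorm].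
  by apply/funext => z /=; rewrite powR_inv1// sqrtr_ge0.
apply: measurable_fun_rowC => i.
  rewrite (_ : (fun _ => _) = fun z : Cd => (enorm z)^-1 * complex.Re (z ord0 i)).
    by apply: measurable_funM => //; apply: measurable_coord; exact: Re_continuous.
  apply/funext => z; rewrite /radial_proj mxE; case: (z ord0 i) => a c.
  by rewrite /= mul0r subr0.
rewrite (_ : (fun _ => _) = fun z : Cd => (enorm z)^-1 * complex.Im (z ord0 i)).
  by apply: measurable_funM => //; apply: measurable_coord; exact: Im_continuous.
apply/funext => z; rewrite /radial_proj mxE; case: (z ord0 i) => a c.
by rewrite /= mul0r addr0.
Qed.

End euclidean.

Section sphere_measure.
Context (R : realType) (d : nat).
Local Notation Cd := 'rV[R[i]]_d.
Local Notation RT := (measurableTypeR R).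

Definition lebesgue_pair : set (RT * RT) -> \bar R :=
  (@lebesgue_measure R \x @lebesgue_measure R)%E.

HB.instance Definition _ := Measure.on lebesgue_pair.
HB.instance Definition _ := Measure_isSigmaFinite.Build _ _ _ lebesgue_pair
  (sigma_finite_prod (@lebesgue_measure R) (@lebesgue_measure R)).

(* Lebesgue measure on C^d = R^(2d). *)
Definition lebesgueC : set Cd -> \bar R :=
  mimage (tuple_measure lebesgue_pair d)
    (@measurable_row_of_pairs R d).

HB.instance Definition _ := Measure.on lebesgueC.

(* Normalized surface measure by polar coordinates, as a Borel measure on C^d
   concentrated on the sphere:
     sigma(A) = vol {z in B_d | z / |z| in A} / vol B_d.
   The argument [point] of [mnormalize] would only be used if the ball had
   measure 0 or +oo. *)
Definition sphere_measure : set Cd -> \bar R :=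
  mnormalize (mimage (mrestr lebesgueC (@measurable_unit_ball R d))
                     (@measurable_radial_proj R d)) point.

HB.instance Definition _ := Probability.on sphere_measure.
End sphere_measure.

Section reproducing_kernel.
Context (T : Type) (R : realType) (D : set T).
Implicit Types f g : T -> R[i].

(* A Hilbert space of functions on [D] with reproducing kernel [K].  A function
   on [D] is represented by its extension by 0 to the whole of [T]; the inner
   product is only meaningful on [rkhs_mem]. *)
Record rkhs (K : T -> T -> R[i]) := Rkhs {
  rkhs_mem : set (T -> R[i]);
  rkhs_dot : (T -> R[i]) -> (T -> R[i]) -> R[i];
  rkhs_norm := fun f => Num.sqrt (complex.Re (rkhs_dot f f));
  rkhs_supp : forall f, rkhs_mem f -> forall z, ~ D z -> f z = 0;
  rkhs_mem0 : rkhs_mem (fun=> 0);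
  rkhs_memP : forall (a : R[i]) f g, rkhs_mem f -> rkhs_mem g ->
    rkhs_mem (fun z => a * f z + g z);
  rkhs_dotP : forall (a : R[i]) f g h,
    rkhs_mem f -> rkhs_mem g -> rkhs_mem h ->
    rkhs_dot (fun z => a * f z + g z) h = a * rkhs_dot f h + rkhs_dot g h;
  rkhs_dotC : forall f g, rkhs_mem f -> rkhs_mem g ->
    rkhs_dot g f = (rkhs_dot f g)^*%C;
  rkhs_dot_ge0 : forall f, rkhs_mem f -> 0 <= rkhs_dot f f;
  rkhs_dot_eq0 : forall f, rkhs_mem f -> rkhs_dot f f = 0 -> f = (fun=> 0);
  rkhs_complete : forall u : nat -> T -> R[i], (forall n, rkhs_mem (u n)) ->
    (forall e : R, 0 < e -> exists N, forall m n, (N <= m)%N -> (N <= n)%N ->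
      rkhs_norm (fun z => u m z - u n z) < e) ->
    exists2 f, rkhs_mem f &
      (fun n => rkhs_norm (fun z => u n z - f z)) @ \oo --> (0 : R);
  rkhs_kernel := fun w z => if `[< D z >] then K z w else 0;
  rkhs_kernel_mem : forall w, D w -> rkhs_mem (rkhs_kernel w);
  rkhs_reproducing : forall f w, rkhs_mem f -> D w ->
    f w = rkhs_dot f (rkhs_kernel w)
}.

End reproducing_kernel.

Section lebesgue_decomposition.
Context dT (T : measurableType dT) (R : realType).
Implicit Types mu nu : {measure set T -> \bar R}.

Definition mutually_singular mu nu :=
  exists N, [/\ measurable N, mu N = 0%E & nu (~` N) = 0%E].

Definition is_ac_density nu mu (h : T -> R) :=
  [/\ measurable_fun [set: T] h, forall x, 0 <= h x,
      mu.-integrable [set: T] (EFin \o h) &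
      exists2 nus : {measure set T -> \bar R}, mutually_singular mu nus &
        forall A, measurable A ->
          nu A = (\int[mu]_(x in A) (h x)%:E + nus A)%E].

(* A representative of the density with respect to [mu] of the absolutely
   continuous part of [nu]; it is unique [mu]-almost everywhere.  The default
   value 0 is never used when [nu] is finite and [mu] is sigma-finite. *)
Definition ac_density nu mu : T -> R :=
  match pselect (exists h, is_ac_density nu mu h) with
  | left ex => sval (cid ex)
  | right _ => cst 0
  end.

End lebesgue_decomposition.

Section de_branges_rovnyak.
Context (R : realType) (d : nat).
Local Notation Cd := 'rV[R[i]]_d.
Implicit Types (f b : Cd -> R[i]) (z w : Cd).
Local Notation B := (@unit_ball R d).
Local Notation S := (@unit_sphere R d).

Definition holomorphic_on (U : set Cd) f := forall z, U z -> differentiable f z.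

Definition radial_cvg f z := cvg (f (r%:C%C *: z) @[r --> (1 : R)^'-]).

(* [f] on the open ball, extended to the sphere by its radial limits.  Where the
   limit does not exist (an almost everywhere empty set in all uses below), [lim]
   is an unspecified value.  Outside the closed ball the value is irrelevant. *)
Definition radial_ext f z : R[i] :=
  if enorm z < 1 then f z else lim (f (r%:C%C *: z) @[r --> (1 : R)^'-]).

Definition admissible (mu : {measure set Cd -> \bar R}) f :=
  {ae mu, forall z, S z -> radial_cvg f z}.

Definition inner_function b :=
  {ae @sphere_measure R d, forall z, S z -> normc (radial_ext b z) = 1}.

Definition dbr_kernel b z w : R[i] :=
  (1 - b z * (b w)^*%C) / (1 - hdot z w) ^+ d.

Record dbr_space b := DbrSpace {
  dbr_rkhs :> rkhs B (dbr_kernel b);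
  dbr_holomorphic : forall f, rkhs_mem dbr_rkhs f -> holomorphic_on B f
}.

Definition reverse_carleson b (mu : {measure set Cd -> \bar R})
    (H : dbr_space b) :=
  exists2 C : R, 0 < C & forall f, rkhs_mem H f -> admissible mu f ->
    ((rkhs_norm H f)%:E <=
     C%:E * 'N[mu]_2%:E[(fun z => (normc (radial_ext f z))%:E)])%E.

End de_branges_rovnyak.

(* Main.v *)
Require Import Defs.
From HB Require Import structures.
From mathcomp Require Import all_boot all_order all_algebra.
From mathcomp Require Import complex.
From mathcomp Require Import all_classical all_reals all_analysis.
From mathcomp Require Import measurable_realfun ring lra.
From mathcomp Require Import cyclic separable cyclotomic.

Set Implicit Arguments.
Unset Strict Implicit.
Unset Printing Implicit Defensive.

Import Order.TTheory GRing.Theory Num.Theory.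
Import numFieldNormedType.Exports.

Local Open Scope classical_set_scope.
Local Open Scope ring_scope.

Local Notation Re := complex.Re.
Local Notation Im := complex.Im.
Local Notation normc := Normc.normc.
(* FILE A1 *)

Section lebesgue_affine.
Context (R : realType).
Local Notation RT := (measurableTypeR R).

Lemma lebesgue_measure_affine (a c : R) (A : set RT) : 0 < a -> measurable A ->
  lebesgue_measure ((fun x : RT => a * x + c) @^-1` A) =
  ((a^-1)%:E * @lebesgue_measure R A)%E.
Proof.
move=> a0 mA.
pose f : RT -> RT := fun x => a * x + c.
have mf : measurable_fun [set: RT] f by exact: measurable_funD.
have a0' : 0 <= a by exact: ltW.
pose m := mscale (NngNum a0') (mimage (@lebesgue_measure R) mf).
rewrite (@lebesgue_measure_unique R m _ A mA); last first.
  move=> X [[u v] _ <-]; rewrite /m /=.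
  change (lebesgue_measure `]u, v] = (a%:E * lebesgue_measure (f @^-1` `]u, v]%classic))%E).
  have -> : f @^-1` `]u, v] = `](u - c) / a, (v - c) / a]%classic.
    apply/seteqP; split => x; rewrite /f /= !in_itv /=.
      by rewrite ltr_pdivrMr// ler_pdivlMr// ltrBlDr lerBrDr mulrC.
    by rewrite ltr_pdivrMr// ler_pdivlMr// ltrBlDr lerBrDr mulrC.
  rewrite !lebesgue_measure_itv/= !lte_fin ltr_pM2r ?invr_gt0// ltrD2r.
  case: ifPn => uv; last by rewrite mule0.
  by rewrite -!EFinB -EFinM; congr (_%:E); field; rewrite gt_eqF.
change (lebesgue_measure (f @^-1` A) =
  ((a^-1)%:E * (a%:E * lebesgue_measure (f @^-1` A)))%E).
by rewrite muleA -EFinM mulVf ?gt_eqF// mul1e.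
Qed.

Lemma lebesgue_measure_translate (c : R) (A : set RT) : measurable A ->
  lebesgue_measure ((fun x : RT => x + c) @^-1` A) = @lebesgue_measure R A.
Proof.
move=> mA; have := lebesgue_measure_affine c ltr01 mA.
by rewrite invr1 mul1e => <-; under [in RHS]eq_fun do rewrite mul1r.
Qed.

Lemma lebesgue_pairE (A : set (RT * RT)) : measurable A ->
  lebesgue_pair A = (\int[@lebesgue_measure R]_y lebesgue_measure (ysection A y))%E.
Proof.
move=> mA; rewrite /lebesgue_pair.
rewrite (@product_measure_unique _ _ _ _ _ _ _
  ((@lebesgue_measure R) \x^ (@lebesgue_measure R))%E)//.
by move=> B C mB mC; exact: product_measure2E.
Qed.

Lemma lebesgue_pair_shear1 (a : R) (A : set (RT * RT)) : measurable A ->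
  lebesgue_pair ((fun p : RT * RT => (p.1 + a * p.2, p.2)) @^-1` A) =
  lebesgue_pair A.
Proof.
move=> mA.
have mf : measurable_fun [set: RT * RT] (fun p : RT * RT => (p.1 + a * p.2, p.2)).
  apply: measurable_fun_pair => //; apply: measurable_funD => //.
  exact: measurable_funM.
rewrite !lebesgue_pairE//; last by rewrite -[X in measurable X]setTI; exact: mf.
apply: eq_integral => y _.
rewrite -(lebesgue_measure_translate (a * y) (A := ysection A y)); last exact: measurable_ysection.
by congr lebesgue_measure; apply/seteqP; split => x /=; rewrite !ysectionE/=.
Qed.

Lemma lebesgue_pair_shear2 (a : R) (A : set (RT * RT)) : measurable A ->
  lebesgue_pair ((fun p : RT * RT => (p.1, p.2 + a * p.1)) @^-1` A) =
  lebesgue_pair A.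
Proof.
move=> mA.
have mf : measurable_fun [set: RT * RT] (fun p : RT * RT => (p.1, p.2 + a * p.1)).
  apply: measurable_fun_pair => //; apply: measurable_funD => //.
  exact: measurable_funM.
rewrite /lebesgue_pair /product_measure1; apply: eq_integral => x _ /=.
rewrite -(lebesgue_measure_translate (a * x) (A := xsection A x)); last exact: measurable_xsection.
by congr lebesgue_measure; apply/seteqP; split => y /=; rewrite !xsectionE/=.
Qed.

Lemma lebesgue_pair_rotate (c s : R) (A : set (RT * RT)) :
  c ^+ 2 + s ^+ 2 = 1 -> c != -1 -> measurable A ->
  lebesgue_pair ((fun p : RT * RT => (c * p.1 - s * p.2, s * p.1 + c * p.2)) @^-1` A) =
  lebesgue_pair A.
Proof.
move=> cs c1 mA.
have c10 : c + 1 != 0 by rewrite addr_eq0.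
pose t := - (s / (c + 1)).
have mf : measurable_fun [set: RT * RT] (fun p : RT * RT => (p.1 + t * p.2, p.2)).
  apply: measurable_fun_pair => //; apply: measurable_funD => //.
  exact: measurable_funM.
have mg : measurable_fun [set: RT * RT] (fun p : RT * RT => (p.1, p.2 + s * p.1)).
  apply: measurable_fun_pair => //; apply: measurable_funD => //.
  exact: measurable_funM.
have s2 : s ^+ 2 = (1 - c) * (c + 1) by rewrite -[s ^+ 2](addKr (c ^+ 2)) cs; ring.
have rotE (x y : R) :
    c * x - s * y = x + t * y + t * (y + s * (x + t * y)) /\
    s * x + c * y = y + s * (x + t * y).
  have ts : t * s = c - 1 by rewrite /t mulNr mulrAC -expr2 s2 mulfK// opprB.
  have tc : t * (c + 1) = - s by rewrite /t mulNr divfK.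
  have -> : y + s * (x + t * y) = s * x + y * (1 + t * s) by ring.
  have -> : x + t * y + t * (s * x + y * (1 + t * s)) =
    x * (1 + t * s) + t * (1 + (1 + t * s)) * y by ring.
  rewrite ts; split; last by ring.
  by rewrite (_ : 1 + (1 + (c - 1)) = c + 1) ?tc; ring.
pose f (p : RT * RT) : RT * RT := (p.1 + t * p.2, p.2).
pose g (p : RT * RT) : RT * RT := (p.1, p.2 + s * p.1).
have mfA : measurable (f @^-1` A) by rewrite -[X in measurable X]setTI; exact: mf.
have mgfA : measurable (g @^-1` (f @^-1` A)).
  by rewrite -[X in measurable X]setTI; exact: mg.
transitivity (lebesgue_pair (f @^-1` (g @^-1` (f @^-1` A)))).
  congr (lebesgue_pair _); apply/seteqP.
  by split => -[x y] /=; rewrite /f /g /=; have [-> ->] := rotE x y.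
transitivity (lebesgue_pair (g @^-1` (f @^-1` A))).
  exact: lebesgue_pair_shear1.
transitivity (lebesgue_pair (f @^-1` A)).
  exact: lebesgue_pair_shear2.
exact: lebesgue_pair_shear1.
Qed.

Lemma lebesgue_pair_scale (r : R) (A : set (RT * RT)) : 0 < r -> measurable A ->
  lebesgue_pair ((fun p : RT * RT => (r * p.1, r * p.2)) @^-1` A) =
  ((r ^- 2)%R%:E * lebesgue_pair A)%E.
Proof.
move=> r0 mA.
have mf : measurable_fun [set: RT * RT] (fun p : RT * RT => (r * p.1, p.2)).
  apply: measurable_fun_pair => //; exact: measurable_funM.
pose B := (fun p : RT * RT => (r * p.1, p.2)) @^-1` A.
have mB : measurable B.
  by rewrite -[X in measurable X]setTI; exact: mf.
have V0 : (0 <= (r^-1)%:E)%E by rewrite lee_fin invr_ge0 ltW.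
transitivity ((r^-1)%:E * lebesgue_pair B)%E.
  rewrite /lebesgue_pair /product_measure1 -ge0_integralZl//=; last exact: measurable_fun_xsection.
  apply: eq_integral => x _ /=.
  rewrite -(lebesgue_measure_affine 0)//; last exact: measurable_xsection.
  by congr lebesgue_measure; apply/seteqP; split => y /=; rewrite !xsectionE/= addr0.
rewrite (lebesgue_pairE mB) (lebesgue_pairE mA).
transitivity ((r^-1)%:E * \int[@lebesgue_measure R]_y
   ((r^-1)%:E * lebesgue_measure (ysection A y)))%E.
  congr (_ * _)%E.
  apply: eq_integral => y _ /=.
  rewrite -(lebesgue_measure_affine 0)//; last exact: measurable_ysection.
  by congr lebesgue_measure; apply/seteqP; split => x /=; rewrite !ysectionE/= addr0.
rewrite ge0_integralZl//=; last by exact: measurable_fun_ysection.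
by rewrite muleA -EFinM -invfM.
Qed.

End lebesgue_affine.

(* FILE A2 *)

Section tuple_measure_theory.
Context dT (T : measurableType dT) (R : realType).
Variable m : {sigma_finite_measure set T -> \bar R}.
Local Open Scope ereal_scope.

Lemma tuple_measureS n (A : set (n.+1.-tuple T)) :
  tuple_measure m n.+1 A =
  (m \x tuple_measure m n) (@pair_cons _ T n @^-1` A).
Proof. by []. Qed.

Lemma tuple_measureSE n (A : set (n.+1.-tuple T)) : measurable A ->
  tuple_measure m n.+1 A =
  \int[tuple_measure m n]_t m (ysection (@pair_cons _ T n @^-1` A) t).
Proof.
move=> mA; rewrite tuple_measureS.
rewrite (@product_measure_unique _ _ _ _ _ _ _ (m \x^ tuple_measure m n)%E)//.
  by move=> B C mB mC; exact: product_measure2E.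
by rewrite -[X in measurable X]setTI; exact: measurable_pair_cons.
Qed.

Lemma measurable_pair_cons_preimage n (A : set (n.+1.-tuple T)) :
  measurable A -> measurable (@pair_cons _ T n @^-1` A).
Proof. by move=> mA; rewrite -[X in measurable X]setTI; exact: measurable_pair_cons. Qed.

Lemma measurable_map_tuple n (f : T -> T) : measurable_fun [set: T] f ->
  measurable_fun [set: n.-tuple T] (fun t => map_tuple f t).
Proof.
move=> mf; apply/measurable_fun_tnthP => i.
rewrite (_ : _ \o _ = f \o (fun t : n.-tuple T => tnth t i)).
  by apply: measurableT_comp => //; exact: measurable_tnth.
by apply/funext => t /=; rewrite tnth_map.
Qed.

Lemma tuple_measure_map (f : T -> T) (c : R) : (0 <= c)%R ->
  measurable_fun [set: T] f ->
  (forall A, measurable A -> m (f @^-1` A) = c%:E * m A) ->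
  forall n (A : set (n.-tuple T)), measurable A ->
  tuple_measure m n ((fun t => map_tuple f t) @^-1` A) =
  (c ^+ n)%:E * tuple_measure m n A.
Proof.
move=> c0 mf fm; elim => [A mA|n IH A mA].
  rewrite expr0 mul1e; congr (tuple_measure m 0 _); apply/seteqP.
  by split => t /=; rewrite (_ : map_tuple f t = t)// tuple0 [RHS]tuple0.
have mA' := measurable_pair_cons_preimage mA.
have mfn : measurable_fun [set: T * n.-tuple T]
    (fun p : T * n.-tuple T => (f p.1, p.2)).
  by apply: measurable_fun_pair => //; apply: measurableT_comp.
pose B := (fun p : T * n.-tuple T => (f p.1, p.2)) @^-1` (@pair_cons _ T n @^-1` A).
have mB : measurable B by rewrite -[X in measurable X]setTI; exact: mfn.
transitivity ((c ^+ n)%:E * (m \x tuple_measure m n) B).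
  rewrite tuple_measureS /product_measure1 -ge0_integralZl//=; last 2 first.
    exact: measurable_fun_xsection.
    by rewrite lee_fin exprn_ge0.
  apply: eq_integral => x _ /=.
  rewrite -IH; last exact: measurable_xsection.
  have e (t : n.-tuple T) :
      map_tuple f (pair_cons (x, t)) = pair_cons (f x, map_tuple f t).
    exact: val_inj.
  by congr (tuple_measure _ _ _); apply/seteqP; split => t /=;
    rewrite !xsectionE /B/= e.
rewrite (@product_measure_unique _ _ _ _ _ _ _ (m \x^ tuple_measure m n)%E)//; last first.
  by move=> C D mC mD; exact: product_measure2E.
rewrite tuple_measureSE// exprSr EFinM -muleA; congr (_ * _)%E.
rewrite -ge0_integralZl//=; last first.
  exact: measurable_fun_ysection.
apply: eq_integral => t _ /=.
rewrite -fm; last exact: measurable_ysection.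
by congr (m _); apply/seteqP; split => x /=; rewrite !ysectionE.
Qed.

Lemma tnth_pair_cons0 n (p : T * n.-tuple T) : tnth (pair_cons p) ord0 = p.1.
Proof. by []. Qed.

Lemma tnth_pair_consS n (p : T * n.-tuple T) i :
  tnth (pair_cons p) (lift ord0 i) = tnth p.2 i.
Proof. by rewrite tnthS. Qed.

Definition tuple_box n (Q : 'I_n -> set T) : set (n.-tuple T) :=
  [set t | forall i, Q i (tnth t i)].

Lemma tuple_boxS n (Q : 'I_n.+1 -> set T) :
  @pair_cons _ T n @^-1` tuple_box Q =
  Q ord0 `*` tuple_box (fun i => Q (lift ord0 i)).
Proof.
apply/seteqP; split => -[x t] /=.
  move=> h; split => [|i]; first exact: h ord0.
  by have := h (lift ord0 i); rewrite tnth_pair_consS.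
move=> [Qx Qt] i; have [->|[j ->]] : i = ord0 \/ exists j, i = lift ord0 j.
  by case: (unliftP ord0 i) => [j ->|->]; [right; exists j|left].
- by rewrite tnth_pair_cons0.
- by rewrite tnth_pair_consS; exact: Qt.
Qed.

Lemma measurable_tuple_box n (Q : 'I_n -> set T) :
  (forall i, measurable (Q i)) -> measurable (tuple_box Q).
Proof.
move=> mQ; have -> : tuple_box Q =
    \big[setI/setT]_(i : 'I_n) ((fun t : n.-tuple T => tnth t i) @^-1` Q i).
  rewrite -bigcap_seq; apply/seteqP; split => t /= h i; first by move=> _; exact: h.
  exact: (h i (mem_index_enum i)).
apply: bigsetI_measurable => i _.
by rewrite -[X in measurable X]setTI; exact: measurable_tnth.
Qed.

Lemma tuple_measure_box n (Q : 'I_n -> set T) (q : R) :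
  (forall i, measurable (Q i)) -> (forall i, m (Q i) = q%:E) ->
  tuple_measure m n (tuple_box Q) = (q ^+ n)%:E.
Proof.
elim: n Q => [Q _ _|n IH Q mQ Qq].
  rewrite /= diracE mem_set ?expr0// => i; by case: i.
rewrite tuple_measureS tuple_boxS product_measure1E//; last first.
  exact: measurable_tuple_box.
by rewrite exprS EFinM; congr (_ * _); [exact: Qq|exact: IH].
Qed.

Lemma tuple_measure_box_le n (Q : 'I_n -> set T) (q : R) : (0 <= q)%R ->
  (forall i, measurable (Q i)) -> (forall i, m (Q i) <= q%:E) ->
  tuple_measure m n (tuple_box Q) <= (q ^+ n)%:E.
Proof.
move=> q0; elim: n Q => [Q _ _|n IH Q mQ Qq].
  by rewrite /= diracE mem_set ?expr0// => i; by case: i.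
rewrite tuple_measureS tuple_boxS product_measure1E//; last first.
  exact: measurable_tuple_box.
by rewrite exprS EFinM; apply: lee_pmul => //; [exact: Qq|exact: IH].
Qed.

Lemma tuple_measure_slab n (j : 'I_n) (Q : 'I_n -> set T) (q c : R)
    (A : set (n.-tuple T)) :
  (0 <= q)%R -> (0 <= c)%R -> measurable A ->
  (forall i, measurable (Q i)) -> (forall i, m (Q i) <= q%:E) ->
  (forall t, A t -> forall i, i != j -> Q i (tnth t i)) ->
  (forall t, A t -> exists D, [/\ measurable D, m D <= c%:E &
     forall t', A t' -> (forall i, i != j -> tnth t' i = tnth t i) ->
       D (tnth t' j)]) ->
  tuple_measure m n A <= (c * q ^+ n.-1)%:E.
Proof.
move=> q0 c0; elim: n j Q A => [[]//|n IH j Q A mA mQ Qq AQ AD].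
have mA' := measurable_pair_cons_preimage mA.
have [j0|[k jk]] : j = ord0 \/ exists k, j = lift ord0 k.
  by case: (unliftP ord0 j) => [k ->|->]; [right; exists k|left].
- subst j; rewrite tuple_measureSE//=.
  pose Bx := tuple_box (fun i => Q (lift ord0 i)).
  have mBx : measurable Bx by exact: measurable_tuple_box.
  apply: (@le_trans _ _ (\int[tuple_measure m n]_t (c%:E * (\1_Bx t)%:E))).
    apply: ge0_le_integral => //.
    - exact: measurable_fun_ysection.
    - by apply: measurable_funeM; exact/measurable_EFinP/measurable_indic.
    move=> t _; have [[x Ax]|/forallNP Ax] := pselect (exists x, A (pair_cons (x, t))).
      have [D [mD Dc DA]] := AD _ Ax.
      rewrite indicE mem_set ?mule1; last first.
        move=> i; have := AQ _ Ax (lift ord0 i) isT.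
        by rewrite tnth_pair_consS.
      apply: le_trans Dc; apply: le_measure; rewrite ?inE//.
        exact: measurable_ysection.
      move=> y; rewrite ysectionE/= => Ay.
      apply: (DA (pair_cons (y, t))) => // i.
      case: (unliftP ord0 i) => [k -> _|->]; last by rewrite eqxx.
      by rewrite !tnth_pair_consS.
    rewrite (_ : ysection _ t = set0) ?measure0 ?mule_ge0 ?lee_fin//.
    by apply/seteqP; split => x //; rewrite ysectionE/= => /Ax.
  rewrite ge0_integralZl//; last exact/measurable_EFinP/measurable_indic.
  rewrite integral_indic// setIT EFinM lee_wpmul2l ?lee_fin//.
  exact: tuple_measure_box_le.
subst j; rewrite tuple_measureS /product_measure1/=.
have n0 : (0 < n)%N by case: (n) (k) => [[]|].
apply: (@le_trans _ _ (\int[m]_x ((c * q ^+ n.-1)%:E * (\1_(Q ord0) x)%:E))).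
  apply: ge0_le_integral => //.
  - exact: measurable_fun_xsection.
  - by apply: measurable_funeM; exact/measurable_EFinP/measurable_indic.
  move=> x _ /=; have [Qx|Qx] := pselect (Q ord0 x); last first.
    rewrite (_ : xsection _ x = set0) ?measure0.
      by rewrite mule_ge0// lee_fin ?mulr_ge0 ?exprn_ge0.
    apply/seteqP; split => t //; rewrite xsectionE/= => /AQ /(_ ord0 isT).
    by rewrite tnth_pair_cons0.
  rewrite indicE mem_set ?mule1//.
  apply: (IH k (fun i => Q (lift ord0 i))) => //.
  - exact: measurable_xsection.
  - move=> t; rewrite xsectionE/= => At i ik.
    have := AQ _ At (lift ord0 i); rewrite tnth_pair_consS; apply.
    by apply: contra ik => /eqP/lift_inj ->.
  - move=> t; rewrite xsectionE/= => At; have [D [mD Dc DA]] := AD _ At.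
    exists D; split => // t' At' tt'.
    have := DA _ At'; rewrite tnth_pair_consS; apply => i.
    case: (unliftP ord0 i) => [l ->|-> _]; last by rewrite !tnth_pair_cons0.
    rewrite !tnth_pair_consS => lk; apply: tt'.
    by apply: contra lk => /eqP ->.
have k0 : 0 <= (c * q ^+ n.-1)%:E by rewrite lee_fin mulr_ge0// exprn_ge0.
rewrite ge0_integralZl//; last exact/measurable_EFinP/measurable_indic.
rewrite integral_indic// setIT.
apply: (@le_trans _ _ ((c * q ^+ n.-1)%:E * q%:E)).
  by apply: lee_wpmul2l => //; exact: Qq.
by rewrite -EFinM -mulrA -exprSr prednK.
Qed.

End tuple_measure_theory.

(* FILE A3 *)

Section complex_modulus.
Context (R : realType).
Implicit Types x y : R[i].

Lemma normc_ge0 x : 0 <= normc x.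
Proof. by case: x => a b; exact: sqrtr_ge0. Qed.

Lemma sqr_normc x : normc x ^+ 2 = Re x ^+ 2 + Im x ^+ 2.
Proof. by case: x => a b /=; rewrite sqr_sqrtr// addr_ge0// sqr_ge0. Qed.

Lemma normc_real (a : R) : normc a%:C%C = `|a|.
Proof. by rewrite /= expr0n/= addr0 sqrtr_sqr. Qed.

Lemma normc_conj x : normc (x^*)%C = normc x.
Proof. by case: x => a b /=; rewrite sqrrN. Qed.

Lemma normcB x y : normc (x - y) = normc (y - x).
Proof. by rewrite -normcN opprB. Qed.

Lemma normcX x n : normc (x ^+ n) = normc x ^+ n.
Proof. by elim: n => [|n IH]; rewrite ?expr0 ?Normc.normc1// !exprS Normc.normcM IH. Qed.

Lemma le_normcB x y : normc (x - y) <= normc x + normc y.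
Proof. by rewrite -(normcN y); exact: le_normcD. Qed.

Lemma ler_normc_sub x y : normc x - normc y <= normc (x - y).
Proof. by rewrite lerBlDr -{1}(subrK y x); exact: le_normcD. Qed.

Lemma mulc_conj x : x * (x^*)%C = (normc x ^+ 2)%:C%C.
Proof.
rewrite sqr_normc; case: x => a b; apply/eqP; rewrite eq_complex/=; apply/andP.
by split; apply/eqP; ring.
Qed.

Lemma ReD x y : Re (x + y) = Re x + Re y.
Proof. by case: x; case: y. Qed.

Lemma ImD x y : Im (x + y) = Im x + Im y.
Proof. by case: x; case: y. Qed.

Lemma Re_sum (I : Type) (r : seq I) (P : pred I) (F : I -> R[i]) :
  Re (\sum_(i <- r | P i) F i) = \sum_(i <- r | P i) Re (F i).
Proof. by elim/big_rec2: _ => // i y1 y2 _ <-; rewrite ReD. Qed.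

Lemma Im_sum (I : Type) (r : seq I) (P : pred I) (F : I -> R[i]) :
  Im (\sum_(i <- r | P i) F i) = \sum_(i <- r | P i) Im (F i).
Proof. by elim/big_rec2: _ => // i y1 y2 _ <-; rewrite ImD. Qed.

Lemma normc_sum (I : Type) (r : seq I) (P : pred I) (F : I -> R[i]) :
  normc (\sum_(i <- r | P i) F i) <= \sum_(i <- r | P i) normc (F i).
Proof.
elim/big_rec2: _ => [|i y1 y2 _ h]; first by rewrite Normc.normc0.
by apply: le_trans (le_normcD _ _) _; rewrite lerD2l.
Qed.

Lemma sum_realC (I : Type) (r : seq I) (P : pred I) (F : I -> R) :
  \sum_(i <- r | P i) (F i)%:C%C = (\sum_(i <- r | P i) F i)%:C%C :> R[i].
Proof. by rewrite -rmorph_sum. Qed.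

End complex_modulus.

Section hermitian_geometry.
Context (R : realType) (d : nat).
Local Notation Cd := 'rV[R[i]]_d.
Implicit Types z w : Cd.

Lemma enorm_ge0 z : 0 <= enorm z. Proof. exact: sqrtr_ge0. Qed.

Lemma sqr_enorm z : enorm z ^+ 2 = \sum_i normc (z ord0 i) ^+ 2.
Proof. by rewrite sqr_sqrtr// sumr_ge0// => i _; exact: sqr_ge0. Qed.

Lemma enormZ (a : R[i]) z : enorm (a *: z) = normc a * enorm z.
Proof.
rewrite /enorm; under eq_bigr do rewrite mxE Normc.normcM exprMn.
by rewrite -mulr_sumr sqrtrM ?sqr_ge0// sqrtr_sqr ger0_norm ?normc_ge0.
Qed.

Lemma enormZr (a : R) z : 0 <= a -> enorm (a%:C%C *: z) = a * enorm z.
Proof. by move=> a0; rewrite enormZ normc_real ger0_norm. Qed.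

Lemma normc_coord_le z i : normc (z ord0 i) <= enorm z.
Proof.
rewrite -(@ler_pXn2r _ 2) ?nnegrE ?normc_ge0 ?enorm_ge0// sqr_enorm.
by rewrite (bigD1 i)//= lerDl sumr_ge0// => j _; exact: sqr_ge0.
Qed.

Lemma hdotZl (a : R[i]) z w : hdot (a *: z) w = a * hdot z w.
Proof. by rewrite /hdot mulr_sumr; apply: eq_bigr => i _; rewrite mxE mulrA. Qed.

Lemma hdotC z w : hdot w z = (hdot z w)^*%C.
Proof.
by rewrite /hdot rmorph_sum/=; apply: eq_bigr => i _; rewrite rmorphM/= conjcK mulrC.
Qed.

Lemma hdotZr (a : R[i]) z w : hdot z (a *: w) = a^*%C * hdot z w.
Proof. by rewrite hdotC hdotZl rmorphM/= -hdotC. Qed.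

Lemma sqr_enormB z w :
  enorm (z - w) ^+ 2 = enorm z ^+ 2 + enorm w ^+ 2 - 2 * Re (hdot z w).
Proof.
rewrite !sqr_enorm /hdot Re_sum mulr_sumr -big_split -sumrB; apply: eq_bigr => i _.
rewrite !mxE !sqr_normc ReB ImB; case: (z ord0 i) => a b; case: (w ord0 i) => c e.
by rewrite /=; ring.
Qed.

Lemma hdot_le z w : normc (hdot z w) <= enorm z * enorm w.
Proof.
apply: (@le_trans _ _ (\sum_i normc (z ord0 i) * normc (w ord0 i))).
  apply: le_trans (normc_sum _ _ _) _; apply: ler_sum => i _.
  by rewrite Normc.normcM normc_conj.
have [z0|z0] := eqVneq (enorm z) 0.
  rewrite z0 mul0r big1// => i _.
  have := normc_coord_le z i; rewrite z0 => zi.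
  by rewrite (_ : normc (z ord0 i) = 0) ?mul0r//; apply: le_anti; rewrite zi normc_ge0.
have [w0|w0] := eqVneq (enorm w) 0.
  rewrite w0 mulr0 big1// => i _.
  have := normc_coord_le w i; rewrite w0 => wi.
  by rewrite (_ : normc (w ord0 i) = 0) ?mulr0//; apply: le_anti; rewrite wi normc_ge0.
have zw0 : 0 < 2 * (enorm z * enorm w).
  by rewrite mulr_gt0// mulr_gt0// lt0r ?z0 ?w0 enorm_ge0.
rewrite -(ler_pM2l zw0) mulr_sumr.
apply: (@le_trans _ _ (\sum_i ((enorm w ^+ 2 * normc (z ord0 i) ^+ 2) +
                         (enorm z ^+ 2 * normc (w ord0 i) ^+ 2)))).
  apply: ler_sum => i _; rewrite -subr_ge0.
  rewrite (_ : _ - _ = (enorm w * normc (z ord0 i) - enorm z * normc (w ord0 i)) ^+ 2).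
    exact: sqr_ge0.
  by ring.
rewrite big_split/= -!mulr_sumr -!sqr_enorm.
by rewrite le_eqVlt; apply/orP; left; apply/eqP; ring.
Qed.

Lemma enorm_gt0 z : z != 0 -> 0 < enorm z.
Proof.
move=> z0; rewrite lt0r enorm_ge0 andbT; apply: contra z0 => /eqP z0.
apply/eqP/rowP => i; rewrite mxE; apply: Normc.eq0_normc.
by apply: le_anti; rewrite normc_ge0 -{1}z0 normc_coord_le.
Qed.

Lemma enorm0 : enorm (0 : Cd) = 0.
Proof. by rewrite -(scale0r 0) enormZ Normc.normc0 mul0r. Qed.

Lemma enorm_radial_proj z : z != 0 -> enorm (radial_proj z) = 1.
Proof.
move=> /enorm_gt0 z0.
by rewrite /radial_proj enormZr ?invr_ge0 ?enorm_ge0// mulVf// gt_eqF.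
Qed.

End hermitian_geometry.

Section lebesgueC_theory.
Context (R : realType) (d : nat).
Local Notation Cd := 'rV[R[i]]_d.
Local Notation RT := (measurableTypeR R).
Implicit Types (z w : Cd) (A : set Cd).

Lemma measurable_scaleC (a : R[i]) : measurable_fun [set: Cd] (fun z => a *: z).
Proof.
apply: measurable_fun_rowC => i.
  rewrite (_ : (fun _ => _) = fun z : Cd =>
      Re a * Re (z ord0 i) - Im a * Im (z ord0 i)).
    apply: measurable_funB; apply: measurable_funM => //; apply: measurable_coord.
      exact: Re_continuous.
    exact: Im_continuous.
  by apply/funext => z; rewrite mxE; case: a (z ord0 i) => x y [].
rewrite (_ : (fun _ => _) = fun z : Cd =>
    Re a * Im (z ord0 i) + Im a * Re (z ord0 i)).
  apply: measurable_funD; apply: measurable_funM => //; apply: measurable_coord.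
    exact: Im_continuous.
  exact: Re_continuous.
by apply/funext => z; rewrite mxE; case: a (z ord0 i) => x y [].
Qed.

Lemma measurable_preimageC (f : Cd -> Cd) A : measurable_fun [set: Cd] f ->
  measurable A -> measurable (f @^-1` A).
Proof. by move=> mf mA; rewrite -[X in measurable X]setTI; exact: mf. Qed.

Lemma measurable_row_preimage A : measurable A ->
  measurable (@row_of_pairs R d @^-1` A).
Proof. by move=> mA; rewrite -[X in measurable X]setTI; exact: measurable_row_of_pairs. Qed.

Lemma lebesgueCE A :
  lebesgueC A = tuple_measure (@lebesgue_pair R) d (@row_of_pairs R d @^-1` A).
Proof. by []. Qed.

Lemma lebesgueC_rotate (a : R[i]) A : normc a = 1 -> Re a != -1 ->
  measurable A -> lebesgueC ((fun z => a *: z) @^-1` A) = lebesgueC A.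
Proof.
move=> a1 aN1 mA.
pose f (p : RT * RT) : RT * RT := (Re a * p.1 - Im a * p.2, Im a * p.1 + Re a * p.2).
have mf : measurable_fun [set: RT * RT] f.
  apply: measurable_fun_pair.
    by apply: measurable_funB; apply: measurable_funM.
  by apply: measurable_funD; apply: measurable_funM.
rewrite !lebesgueCE -[RHS]mul1e -(expr1n R d).
rewrite -(tuple_measure_map ler01 mf); last exact: measurable_row_preimage.
  congr (tuple_measure _ _ _); apply/seteqP.
  have e t : row_of_pairs (map_tuple f t) = a *: row_of_pairs t.
    apply/rowP => i; rewrite !mxE tnth_map /f /=.
    case: (a) => x y; case: (tnth t i) => u v /=.
    by apply/eqP; rewrite eq_complex/= eqxx/= [X in X == _]addrC.
  by split => t; rewrite /preimage/= e.
move=> B mB; rewrite mul1e; apply: lebesgue_pair_rotate => //.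
by rewrite -sqr_normc a1 expr1n.
Qed.

Lemma lebesgueC_scale (r : R) A : 0 < r -> measurable A ->
  lebesgueC ((fun z => r%:C%C *: z) @^-1` A) = ((r ^- (2 * d))%:E * lebesgueC A)%E.
Proof.
move=> r0 mA.
pose f (p : RT * RT) : RT * RT := (r * p.1, r * p.2).
have mf : measurable_fun [set: RT * RT] f.
  by apply: measurable_fun_pair; apply: measurable_funM.
rewrite exprM -exprVn !lebesgueCE.
have r2 : 0 <= r ^- 2 by rewrite invr_ge0 sqr_ge0.
rewrite -(tuple_measure_map r2 mf); last exact: measurable_row_preimage.
  congr (tuple_measure _ _ _); apply/seteqP.
  have e t : row_of_pairs (map_tuple f t) = r%:C%C *: row_of_pairs t.
    apply/rowP => i; rewrite !mxE tnth_map /f /=.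
    case: (tnth t i) => u v /=.
    by apply/eqP; rewrite eq_complex/= !mul0r subr0 addr0 !eqxx.
  by split => t; rewrite /preimage/= e.
by move=> B mB; exact: lebesgue_pair_scale.
Qed.

Definition square (c : RT * RT) (e : R) : set (RT * RT) :=
  `](c.1 - e), (c.1 + e)[ `*` `](c.2 - e), (c.2 + e)[.

Lemma measurable_square c e : measurable (square c e).
Proof. exact: measurableX. Qed.

Lemma lebesgue_pair_square c e : 0 <= e ->
  lebesgue_pair (square c e) = ((2 * e) ^+ 2)%:E.
Proof.
move=> e0; rewrite /lebesgue_pair /square product_measure1E//.
have E (x : R) : lebesgue_measure `](x - e), (x + e)[%classic = (2 * e)%:E.
  rewrite lebesgue_measure_itv/= lte_fin ltrBlDr -addrA ltrDl -mulr2n.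
  rewrite pmulrn_lgt0//; case: ltP => e0'; first by rewrite -EFinB; congr (_%:E); ring.
  have -> : e = 0 by apply: le_anti; rewrite e0 e0'.
  by rewrite mulr0.
by rewrite expr2 EFinM; congr (_ * _)%E; exact: E.
Qed.

Lemma lebesgueC_ball_fin : (lebesgueC (@unit_ball R d) < +oo)%E.
Proof.
rewrite lebesgueCE.
apply: (@le_lt_trans _ _ (tuple_measure (@lebesgue_pair R) d
    (tuple_box (fun=> square (0, 0) 1)))).
  apply: le_measure; rewrite ?inE.
  - by apply: measurable_row_preimage; exact: measurable_unit_ball.
  - by apply: measurable_tuple_box => i; exact: measurable_square.
  move=> t tB i; have := le_lt_trans (normc_coord_le _ i) tB.
  rewrite mxE; case: (tnth t i) => x y /= xy.
  split; rewrite /= in_itv/= sub0r add0r -ltr_norml.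
    exact: le_lt_trans (Re_le_normc (x +i* y)%C) xy.
  exact: le_lt_trans (Im_le_normc (x +i* y)%C) xy.
apply: le_lt_trans (tuple_measure_box_le _ _ _) (ltry _).
- exact: sqr_ge0 (2 * 1).
- by move=> i; exact: measurable_square.
- by move=> i; rewrite -(@lebesgue_pair_square (0, 0) 1).
Qed.

Lemma lebesgueC_ball_gt0 : (0 < lebesgueC (@unit_ball R d))%E.
Proof.
pose e : R := (2 * d.+1%:R)^-1.
have e0 : 0 < e by rewrite invr_gt0 mulr_gt0.
rewrite lebesgueCE.
apply: (@lt_le_trans _ _ (tuple_measure (@lebesgue_pair R) d
    (tuple_box (fun=> square (0, 0) e)))).
  rewrite (@tuple_measure_box _ _ _ _ _ _ ((2 * e) ^+ 2)).
  - by rewrite lte_fin !exprn_gt0// mulr_gt0.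
  - by move=> i; exact: measurable_square.
  - by move=> i; apply: lebesgue_pair_square; exact: ltW.
apply: le_measure; rewrite ?inE.
- by apply: measurable_tuple_box => i; exact: measurable_square.
- by apply: measurable_row_preimage; exact: measurable_unit_ball.
move=> t tQ; rewrite /preimage/= /unit_ball/=.
rewrite -(@ltr_pXn2r _ 2) ?nnegrE ?enorm_ge0// sqr_enorm expr1n.
apply: (@le_lt_trans _ _ (\sum_(i < d) (2 * e ^+ 2))).
  apply: ler_sum => i _; rewrite sqr_normc !mxE/=.
  have [/=] := tQ i; rewrite !in_itv/= !sub0r !add0r -!ltr_norml => h1 h2.
  rewrite mulr_natl mulr2n; apply: lerD.
    by rewrite -[leLHS]real_normK ?num_real// ler_pXn2r ?nnegrE ?normr_ge0 ?ltW.
  by rewrite -[leLHS]real_normK ?num_real// ler_pXn2r ?nnegrE ?normr_ge0 ?ltW.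
rewrite sumr_const card_ord -[ltLHS]mulr_natl.
have d1 : d.+1%:R != 0 :> R by rewrite pnatr_eq0.
rewrite (_ : d%:R * (2 * e ^+ 2) = (d%:R / d.+1%:R) * (d.+1%:R^-1 / 2)); last by rewrite /e; field.
rewrite -[ltRHS]mulr1 ltr_pM ?divr_ge0//.
  by rewrite ltr_pdivrMr ?ltr0n// mul1r ltr_nat.
rewrite ltr_pdivrMr// mul1r (@le_lt_trans _ _ 1)//; last by rewrite ltr1n.
by rewrite invf_le1 ?ltr0n// ler1n.
Qed.

End lebesgueC_theory.

(* FILE A4 *)

Section complex_measurability.
Context dT (T : measurableType dT) (R : realType).
Implicit Types (D : set T) (f g : T -> R[i]).

Definition cmeasurable D f :=
  measurable_fun D (fun t => Re (f t)) /\ measurable_fun D (fun t => Im (f t)).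

Lemma cmeasurable_cst D (a : R[i]) : cmeasurable D (fun=> a).
Proof. by split; exact: measurable_cst. Qed.

Lemma cmeasurableD D f g : cmeasurable D f -> cmeasurable D g ->
  cmeasurable D (fun t => f t + g t).
Proof.
move=> [mf1 mf2] [mg1 mg2]; split.
  by under eq_fun do rewrite ReD; exact: measurable_funD.
by under eq_fun do rewrite ImD; exact: measurable_funD.
Qed.

Lemma cmeasurableN D f : cmeasurable D f -> cmeasurable D (fun t => - f t).
Proof.
move=> [mf1 mf2]; split.
  rewrite (_ : (fun _ => _) = fun t => - Re (f t)); last first.
    by apply/funext => t; case: (f t).
  exact: measurableT_comp.
rewrite (_ : (fun _ => _) = fun t => - Im (f t)); last first.
  by apply/funext => t; case: (f t).
exact: measurableT_comp.
Qed.

Lemma cmeasurableB D f g : cmeasurable D f -> cmeasurable D g ->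
  cmeasurable D (fun t => f t - g t).
Proof. by move=> mf mg; apply: cmeasurableD => //; exact: cmeasurableN. Qed.

Lemma cmeasurableM D f g : cmeasurable D f -> cmeasurable D g ->
  cmeasurable D (fun t => f t * g t).
Proof.
move=> [mf1 mf2] [mg1 mg2]; split.
  rewrite (_ : (fun _ => _) = fun t => Re (f t) * Re (g t) - Im (f t) * Im (g t)).
    by apply: measurable_funB; apply: measurable_funM.
  by apply/funext => t; case: (f t); case: (g t).
rewrite (_ : (fun _ => _) = fun t => Re (f t) * Im (g t) + Im (f t) * Re (g t)).
  by apply: measurable_funD; apply: measurable_funM.
by apply/funext => t; case: (f t); case: (g t).
Qed.

Lemma cmeasurable_conj D f : cmeasurable D f -> cmeasurable D (fun t => (f t)^*%C).
Proof.
move=> [mf1 mf2]; split.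
  rewrite (_ : (fun _ => _) = fun t => Re (f t))//.
  by apply/funext => t; case: (f t).
rewrite (_ : (fun _ => _) = fun t => - Im (f t)); last first.
  by apply/funext => t; case: (f t).
exact: measurableT_comp.
Qed.

Lemma cmeasurable_sum D (I : Type) (s : seq I) (h : I -> T -> R[i]) :
  (forall i, cmeasurable D (h i)) -> cmeasurable D (fun t => \sum_(i <- s) h i t).
Proof.
move=> mh; elim: s => [|i s IH].
  rewrite (_ : (fun _ => _) = fun=> 0); first exact: cmeasurable_cst.
  by apply/funext => t; rewrite big_nil.
rewrite (_ : (fun _ => _) = fun t => h i t + \sum_(j <- s) h j t).
  exact: cmeasurableD.
by apply/funext => t; rewrite big_cons.
Qed.

Lemma measurable_normc D f : cmeasurable D f ->
  measurable_fun D (fun t => normc (f t)).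
Proof.
move=> [mf1 mf2].
rewrite (_ : (fun _ => _) = @Num.sqrt R \o (fun t => Re (f t) ^+ 2 + Im (f t) ^+ 2)).
  apply: measurableT_comp.
    by apply: continuous_measurable_fun; exact: sqrt_continuous.
  by apply: measurable_funD; exact: measurable_funX.
by apply/funext => t /=; case: (f t).
Qed.

Context (d : nat).
Local Notation Cd := 'rV[R[i]]_d.

Lemma cmeasurable_coord D (f : T -> Cd) i : measurable_fun D f ->
  cmeasurable D (fun t => f t ord0 i).
Proof.
move=> mf; split.
  exact: (measurableT_comp (measurable_coord i (@Re_continuous R)) mf).
exact: (measurableT_comp (measurable_coord i (@Im_continuous R)) mf).
Qed.

Lemma cmeasurable_hdot D (f g : T -> Cd) :
  measurable_fun D f -> measurable_fun D g ->
  cmeasurable D (fun t => hdot (f t) (g t)).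
Proof.
move=> mf mg; apply: cmeasurable_sum => i; apply: cmeasurableM.
  exact: cmeasurable_coord.
by apply: cmeasurable_conj; exact: cmeasurable_coord.
Qed.

End complex_measurability.

Section sphere_measure_theory.
Context (R : realType) (d : nat) (hd : (0 < d)%N).
Local Notation Cd := 'rV[R[i]]_d.
Local Notation B := (@unit_ball R d).
Local Notation S := (@unit_sphere R d).
Local Notation RT := (measurableTypeR R).
Local Notation sigma := (@sphere_measure R d).
Local Notation proj := (@radial_proj R d).
Implicit Types (z w : Cd) (A : set Cd).

Definition ball_volume : R := fine (lebesgueC B).

Lemma ball_volumeE : lebesgueC B = ball_volume%:E.
Proof.
by rewrite fineK// ge0_fin_numE ?measure_ge0//; exact: lebesgueC_ball_fin.
Qed.

Lemma ball_volume_gt0 : 0 < ball_volume.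
Proof. by rewrite -lte_fin -ball_volumeE; exact: lebesgueC_ball_gt0. Qed.

Lemma sphere_measureE A :
  sigma A = (lebesgueC (proj @^-1` A `&` B) * (ball_volume^-1)%:E)%E.
Proof.
have E : mrestr (@lebesgueC R d) (@measurable_unit_ball R d) (proj @^-1` setT) =
    ball_volume%:E.
  by rewrite -ball_volumeE /mrestr preimage_setT setTI.
rewrite /sphere_measure /mnormalize /mimage /pushforward/= !E.
by rewrite eqe gt_eqF ?ball_volume_gt0.
Qed.

Lemma radial_projZ (a : R[i]) z : normc a = 1 -> proj (a *: z) = a *: proj z.
Proof.
by move=> a1; rewrite /radial_proj enormZ a1 mul1r !scalerA mulrC.
Qed.

Lemma sphere_measure_rotate (a : R[i]) A : normc a = 1 -> Re a != -1 ->
  measurable A -> sigma ((fun z => a *: z) @^-1` A) = sigma A.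
Proof.
move=> a1 aN1 mA; rewrite !sphere_measureE; congr (_ * _)%E.
rewrite -[RHS](lebesgueC_rotate a1 aN1); last first.
  apply: measurableI; last exact: measurable_unit_ball.
  by apply: measurable_preimageC => //; exact: measurable_radial_proj.
congr (lebesgueC _); apply/seteqP.
by split=> z; rewrite /preimage/= /unit_ball/= radial_projZ// enormZ a1 mul1r.
Qed.

Definition cap z (e : R) : set Cd := [set w | S w /\ normc (1 - hdot z w) < e].

Lemma measurable_cap z e : measurable (cap z e).
Proof.
rewrite (_ : cap z e = S `&` (fun w => normc (1 - hdot z w)) @^-1` `]-oo, e[); last first.
  by apply/seteqP; split => w /=; rewrite /cap/= in_itv/=.
apply: measurableI; first exact: measurable_unit_sphere.
rewrite -[X in measurable X]setTI.
apply: measurable_normc => //; apply: cmeasurableB; first exact: cmeasurable_cst.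
exact: cmeasurable_hdot.
Qed.

Definition shell_piece z (e : R) : set Cd :=
  proj @^-1` cap z e `&` [set v | 1 - e <= enorm v < 1].

Lemma measurable_shell_piece z e : measurable (shell_piece z e).
Proof.
apply: measurableI.
  by apply: measurable_preimageC; [exact: measurable_radial_proj|exact: measurable_cap].
rewrite (_ : [set v | _] = @enorm R d @^-1` `[1 - e, 1[).
  by rewrite -[X in measurable X]setTI; exact: measurable_enorm.
by apply/seteqP; split => v /=; rewrite in_itv.
Qed.

Lemma shell_piece_hdot z e v : enorm z = 1 -> 0 < e -> shell_piece z e v ->
  normc (1 - hdot z v) < 2 * e.
Proof.
move=> z1 e0 [[Sv cv] /andP[ev v1]].
have v0 : v != 0.
  apply/eqP => v0; move: Sv; rewrite /unit_sphere/= v0 /radial_proj scaler0 enorm0.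
  by move=> /eqP; rewrite eq_sym oner_eq0.
have hz : normc (hdot z (proj v)) <= 1.
  by apply: le_trans (hdot_le _ _) _; rewrite z1 enorm_radial_proj// mulr1.
have hv : normc (hdot z (proj v) - hdot z v) <= e.
  have -> : hdot z v = (enorm v)%:C%C * hdot z (proj v).
    rewrite /radial_proj hdotZr conjc_real mulrA -rmorphM/= mulfV ?mul1r//.
    by rewrite gt_eqF// enorm_gt0.
  rewrite -{1}[hdot z (proj v)]mul1r -mulrBl Normc.normcM.
  rewrite (_ : 1 - _ = (1 - enorm v)%:C%C); last by rewrite rmorphB.
  rewrite normc_real ger0_norm; last by rewrite subr_ge0 ltW.
  have e1 : 1 - enorm v <= e by lra.
  by apply: le_trans e1; rewrite ler_piMr// subr_ge0 ltW.
rewrite (_ : 1 - hdot z v = (1 - hdot z (proj v)) + (hdot z (proj v) - hdot z v)); last by ring.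
by apply: le_lt_trans (le_normcD _ _) _; lra.
Qed.

Lemma shell_piece_volume z e : enorm z = 1 -> 0 < e ->
  (lebesgueC (shell_piece z e) <= (64 * d%:R * e ^+ 2 * (16 * e) ^+ d.-1)%:E)%E.
Proof.
move=> z1 e0.
have [j zj] : exists j, 1 <= d%:R * normc (z ord0 j) ^+ 2.
  apply/not_existsP => H.
  have : \sum_(j < d) d%:R * normc (z ord0 j) ^+ 2 < \sum_(j < d) (1 : R).
    apply: ltr_sum; first by apply/hasP; exists (Ordinal hd).
    by move=> j _; rewrite ltNge; apply/negP; exact: H.
  by rewrite -mulr_sumr -sqr_enorm z1 expr1n mulr1 sumr_const card_ord ltxx.
pose e2 : R := 2 * Num.sqrt e.
have se : Num.sqrt e ^+ 2 = e by rewrite sqr_sqrtr// ltW.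
have s0 : 0 < Num.sqrt e by rewrite sqrtr_gt0.
pose e4 : R := 4 * e * Num.sqrt d%:R.
have sd : Num.sqrt (d%:R : R) ^+ 2 = d%:R by rewrite sqr_sqrtr.
have e40 : 0 < e4 by rewrite !mulr_gt0// sqrtr_gt0 ltr0n.
rewrite lebesgueCE.
have -> : 64 * d%:R * e ^+ 2 * (16 * e) ^+ d.-1 = (2 * e4) ^+ 2 * ((2 * e2) ^+ 2) ^+ d.-1.
  congr (_ * _); last by congr (_ ^+ _); rewrite /e2 -{1}se; ring.
  by rewrite /e4 -{1}sd; ring.
pose c i : RT * RT := (Re (z ord0 i), Im (z ord0 i)).
apply: (@tuple_measure_slab _ _ _ _ _ j (fun i => square (c i) e2)).
- exact: sqr_ge0.
- exact: sqr_ge0.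
- by apply: measurable_row_preimage; exact: measurable_shell_piece.
- by move=> i; exact: measurable_square.
- move=> i; rewrite -(@lebesgue_pair_square _ (c i) e2)//.
  by rewrite /e2 mulr_ge0// ltW.
- move=> t tV i _; have h := shell_piece_hdot z1 e0 tV.
  have [_ /andP[_ v1]] := tV.
  have zv : enorm (row_of_pairs t - z) < e2.
    rewrite -(@ltr_pXn2r _ 2) ?nnegrE ?enorm_ge0//; last by rewrite /e2 mulr_ge0// ltW.
    rewrite sqr_enormB z1 /e2 exprMn se hdotC.
    have : Re (1 - hdot z (row_of_pairs t)) < 2 * e.
      by apply: le_lt_trans h; apply: le_trans (Re_le_normc _); exact: ler_norm.
    rewrite ReB /=; have -> : Re (hdot z (row_of_pairs t))^*%C = Re (hdot z (row_of_pairs t)).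
      by case: (hdot _ _).
    have : enorm (row_of_pairs t) ^+ 2 < 1 by rewrite expr_lt1 ?enorm_ge0.
    lra.
  have := le_lt_trans (normc_coord_le _ i) zv; rewrite !mxE.
  case: (tnth t i) => x y; rewrite /square /c/=; case: (z ord0 i) => a b /= ab.
  have h1 := le_lt_trans (Re_le_normc ((x +i* y) - (a +i* b))%C) ab.
  have h2 := le_lt_trans (Im_le_normc ((x +i* y) - (a +i* b))%C) ab.
  by split; rewrite /= in_itv/= -ltr_distl.
- move=> t tV; exists (square (tnth t j) e4); split; first exact: measurable_square.
    by rewrite -(@lebesgue_pair_square _ (tnth t j) e4)// ltW.
  move=> t' t'V tt'.
  have h := shell_piece_hdot z1 e0 tV; have h' := shell_piece_hdot z1 e0 t'V.
  set v := row_of_pairs t in h; set v' := row_of_pairs t' in h'.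
  have vv' : hdot z v - hdot z v' = z ord0 j * (v ord0 j - v' ord0 j)^*%C.
    rewrite /hdot -sumrB (bigD1 j)//= big1 ?addr0 => [|i ij].
      by rewrite rmorphB/= mulrBr.
    by rewrite !mxE tt'// subrr.
  have hj : normc (z ord0 j) * normc (v' ord0 j - v ord0 j) < 4 * e.
    rewrite normcB -[X in _ * X]normc_conj -Normc.normcM -vv'.
    rewrite (_ : _ - _ = (1 - hdot z v') - (1 - hdot z v)); last by ring.
    by apply: le_lt_trans (le_normcB _ _) _; lra.
  have zj' : 1 <= Num.sqrt d%:R * normc (z ord0 j).
    rewrite -(@ler_pXn2r _ 2) ?nnegrE ?mulr_ge0 ?normc_ge0//.
    by rewrite exprMn sd expr1n.
  have vj : normc (v' ord0 j - v ord0 j) < e4.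
    apply: (@le_lt_trans _ _ (Num.sqrt d%:R * (normc (z ord0 j) * normc (v' ord0 j - v ord0 j)))).
      by rewrite mulrA ler_peMl ?normc_ge0.
    by rewrite /e4 [ltRHS]mulrC ltr_pM2l// sqrtr_gt0 ltr0n.
  move: vj; rewrite !mxE; case: (tnth t j) => a b; case: (tnth t' j) => x y ab.
  have h1 := le_lt_trans (Re_le_normc ((x +i* y) - (a +i* b))%C) ab.
  have h2 := le_lt_trans (Im_le_normc ((x +i* y) - (a +i* b))%C) ab.
  by split; rewrite /= in_itv/= -ltr_distl.
Qed.

Definition cap_const : R := 64 * d%:R * 16 ^+ d.-1 / ball_volume + 1.

Lemma cap_const_gt0 : 0 < cap_const.
Proof. by rewrite ltr_wpDl// divr_ge0 ?(ltW ball_volume_gt0)// !mulr_ge0// exprn_ge0. Qed.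

Lemma sphere_measure_cap z e : enorm z = 1 -> 0 < e ->
  (sigma (cap z e) <= (cap_const * e ^+ d)%:E)%E.
Proof.
move=> z1 e0.
have [e1|e1] := leP 1 e.
  apply: (@le_trans _ _ 1%:E); first by apply: probability_le1; exact: measurable_cap.
  rewrite lee_fin -[leLHS]mulr1; apply: ler_pM => //; last exact: exprn_ege1.
  by rewrite lerDr divr_ge0 ?(ltW ball_volume_gt0)// !mulr_ge0// exprn_ge0.
pose E := proj @^-1` cap z e `&` B.
have mE : measurable E.
  apply: measurableI; last exact: measurable_unit_ball.
  by apply: measurable_preimageC; [exact: measurable_radial_proj|exact: measurable_cap].
have rho0 : 0 < 1 - e by rewrite subr_gt0.
pose E' := (fun v : Cd => ((1 - e)^-1)%:C%C *: v) @^-1` E.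
have mE' : measurable E' by apply: measurable_preimageC => //; exact: measurable_scaleC.
have projZ v : proj (((1 - e)^-1)%:C%C *: v) = proj v.
  have r0 : (1 - e)^-1 != 0 by rewrite invr_eq0 gt_eqF.
  rewrite /radial_proj enormZr ?invr_ge0 ?(ltW rho0)// scalerA -rmorphM/=; congr (_%:C%C *: _).
  by rewrite invfM mulrAC invrK mulfV ?mul1r// gt_eqF.
have E'E : lebesgueC E' = (((1 - e) ^+ (2 * d))%:E * lebesgueC E)%E.
  by rewrite lebesgueC_scale ?invr_gt0// exprVn invrK.
have EE' : E' `<=` E.
  move=> v [] ; rewrite /preimage/= projZ => cv Bv; split => //.
  move: Bv; rewrite /unit_ball/= enormZr ?invr_ge0 ?(ltW rho0)//.
  rewrite mulrC ltr_pdivrMr// mul1r => /lt_le_trans; apply.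
  by rewrite lerBlDr lerDl ltW.
have finE : lebesgueC E \is a fin_num.
  rewrite ge0_fin_numE ?measure_ge0//; apply: le_lt_trans (lebesgueC_ball_fin R d).
  by apply: le_measure; rewrite ?inE//; [exact: measurable_unit_ball|exact: subIsetr].
have EB : (lebesgueC E - lebesgueC E' <= lebesgueC (shell_piece z e))%E.
  rewrite -(setIidr EE') -(@measureD _ _ _ (@lebesgueC R d))//; last first.
    by rewrite -ge0_fin_numE ?measure_ge0.
  apply: le_measure; rewrite ?inE//; first exact: measurableD.
    exact: measurable_shell_piece.
  move=> v [[cv Bv] nE']; split => //; apply/andP; split => //.
  rewrite leNgt; apply/negP => ve; apply: nE'; split.
    by rewrite /preimage/= projZ.
  by rewrite /unit_ball/= enormZr ?invr_ge0 ?(ltW rho0)// mulrC ltr_pdivrMr// mul1r.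
have le1 : (e%:E * lebesgueC E <= lebesgueC (shell_piece z e))%E.
  apply: le_trans EB; rewrite E'E -(fineK finE) -!EFinM -EFinB lee_fin.
  rewrite -{2}[fine _]mul1r -mulrBl ler_wpM2r ?fine_ge0 ?measure_ge0//.
  rewrite lerBrDr -lerBrDl; apply: (@le_trans _ _ ((1 - e) ^+ 1)); last by rewrite expr1.
  apply: ler_wiXn2l; rewrite ?(ltW rho0)//; first by rewrite lerBlDr lerDl ltW.
  by rewrite muln_gt0.
have le2 := le_trans le1 (shell_piece_volume z1 e0).
rewrite sphere_measureE -/E.
move: le2; rewrite -(fineK finE) -!EFinM !lee_fin => le2.
rewrite ler_pdivrMr ?ball_volume_gt0// -(ler_pM2l e0); apply: le_trans le2 _.
have V0 := ball_volume_gt0.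
pose X : R := 64 * d%:R * 16 ^+ d.-1.
have -> : 64 * d%:R * e ^+ 2 * (16 * e) ^+ d.-1 = X * (e * e ^+ d).
  have -> : e ^+ d = e * e ^+ d.-1 by rewrite -exprS prednK.
  by rewrite /X exprMn; ring.
have -> : e * (cap_const * e ^+ d * ball_volume) =
    X * (e * e ^+ d) + ball_volume * (e * e ^+ d).
  by rewrite /cap_const /X; field; rewrite gt_eqF.
by rewrite lerDl !mulr_ge0 ?exprn_ge0// ltW.
Qed.

End sphere_measure_theory.

(* FILE A5 *)

Section szego_mass.
Context (R : realType) (d : nat) (hd : (0 < d)%N).
Local Notation Cd := 'rV[R[i]]_d.
Local Notation S := (@unit_sphere R d).
Local Notation sigma := (@sphere_measure R d).
Implicit Types (z w x : Cd).

Definition mass_const : R := 2 * (cap_const R d * 8 ^+ d).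

Lemma mass_const_gt0 : 0 < mass_const.
Proof. by rewrite !mulr_gt0 ?cap_const_gt0// exprn_gt0. Qed.

Lemma ge_normc_1B_hdot w x : enorm x = 1 -> 1 - enorm w <= normc (1 - hdot w x).
Proof.
move=> x1; apply: le_trans (ler_normc_sub _ _).
by rewrite Normc.normc1 lerD2l lerN2; apply: le_trans (hdot_le _ _) _; rewrite x1 mulr1.
Qed.

Lemma cap_hdot_le w x : w != 0 -> enorm w < 1 -> enorm x = 1 ->
  normc (1 - hdot (radial_proj w) x) <= 2 * normc (1 - hdot w x).
Proof.
move=> w0 w1 x1; have ew0 := enorm_gt0 w0.
have -> : hdot w x = (enorm w)%:C%C * hdot (radial_proj w) x.
  by rewrite /radial_proj hdotZl mulrA -rmorphM/= mulfV ?mul1r// gt_eqF.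
set h := hdot _ _; set s := enorm w in w1 ew0 *.
have h1 : normc h <= 1.
  by apply: le_trans (hdot_le _ _) _; rewrite enorm_radial_proj// x1 mulr1.
rewrite (_ : 1 - h = (1 - s%:C%C * h) - (1 - s)%:C%C * h); last first.
  by rewrite rmorphB/=; ring.
apply: le_trans (le_normcB _ _) _.
rewrite [X in _ + X <= _]Normc.normcM normc_real ger0_norm; last by rewrite subr_ge0 ltW.
have l1 : (1 - s) * normc h <= 1 - s by rewrite ler_piMr// subr_ge0 ltW.
have l2 : 1 - s <= normc (1 - s%:C%C * h).
  apply: le_trans (ler_normc_sub _ _); rewrite Normc.normc1 lerD2l lerN2.
  by rewrite Normc.normcM normc_real ger0_norm ?(ltW ew0)// ler_piMr// ltW.
lra.
Qed.

Lemma measurable_szego w : measurable_fun [set: Cd]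
  (fun x => ((1 - enorm w) / normc (1 - hdot w x) ^+ 2) ^+ d).
Proof.
apply: measurable_funX; apply: measurable_funM => //.
have mn : measurable_fun [set: Cd] (fun x => normc (1 - hdot w x) ^+ 2).
  apply: measurable_funX; apply: measurable_normc; apply: cmeasurableB.
    exact: cmeasurable_cst.
  exact: cmeasurable_hdot.
rewrite (_ : (fun _ => _) = (fun r : R => r `^ (-1)) \o
    (fun x => normc (1 - hdot w x) ^+ 2)).
  by apply: measurableT_comp => //; exact: measurable_powR.
by apply/funext => x /=; rewrite powR_inv1// sqr_ge0.
Qed.

Lemma szego_mass w : enorm w < 1 ->
  (\int[sigma]_(x in S)
     (((1 - enorm w) / normc (1 - hdot w x) ^+ 2) ^+ d)%:E <= mass_const%:E)%E.
Proof.
move=> w1; set e := 1 - enorm w; have e0 : 0 < e by rewrite subr_gt0.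
have [w0|w0] := eqVneq w 0.
  rewrite (eq_integral (cst 1%:E)).
    rewrite integral_cst//; last exact: measurable_unit_sphere.
    rewrite mul1e; apply: le_trans (probability_le1 _ _) _; first exact: measurable_unit_sphere.
    rewrite lee_fin /mass_const -[leLHS]mul1r ler_pM//; first by lra.
    rewrite -[leLHS]mul1r ler_pM// ?exprn_ege1//; last by lra.
    by rewrite lerDr divr_ge0 ?(ltW (ball_volume_gt0 _ _))// !mulr_ge0// exprn_ge0.
  move=> x _; congr (_%:E); rewrite /e w0 enorm0.
  have -> : hdot (0 : Cd) x = 0 by rewrite -(scale0r 0) hdotZl mul0r.
  by rewrite !subr0 Normc.normc1 expr1n divr1 expr1n.
pose eta := radial_proj w.
have eta1 : enorm eta = 1 by exact: enorm_radial_proj.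
have four_pow j : 4 ^+ j = 2 ^+ j * 2 ^+ j :> R.
  by rewrite -exprMn; congr (_ ^+ _); ring.
have quot1 (p q : R) : p != 0 -> q != 0 -> 4 / (p * p * q) = q / (p * q / 2) ^+ 2.
  by move=> p0 q0; field; rewrite p0 q0.
have quot2 (p q : R) : p != 0 -> q != 0 -> 4 / (p * p * q) * (2 * p * q) = 8 * p^-1.
  by move=> p0 q0; field; rewrite p0 q0.
have pow_gt0 j : 0 < 2 ^+ j :> R by exact: exprn_gt0.
pose a (j : nat) : R := (4 / (4 ^+ j * e)) ^+ d.
have a0 j : 0 <= a j by rewrite exprn_ge0// divr_ge0// mulr_ge0 ?exprn_ge0// ltW.
pose c (j : nat) := cap eta (2 ^+ j.+1 * e).
pose f (j : nat) (x : Cd) : \bar R := ((a j)%:E * (\1_(c j) x)%:E)%E.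
have f0 j x : (0 <= f j x)%E by rewrite mule_ge0// lee_fin.
have mc j : measurable (c j) by exact: measurable_cap.
have mf j : measurable_fun S (f j).
  apply: measurable_funeM; apply/measurable_EFinP/(measurable_funS (E := setT)) => //.
have mS := @measurable_unit_sphere R d.
apply: (@le_trans _ _ (\int[sigma]_(x in S) \sum_(j <oo) f j x)%E).
  apply: ge0_le_integral => //.
  - by move=> x _; rewrite lee_fin exprn_ge0// divr_ge0 ?(ltW e0)// sqr_ge0.
  - apply/measurable_EFinP/(measurable_funS (E := setT)) => //; exact: measurable_szego.
  - by apply: ge0_emeasurable_sum => j.
  move=> x Sx; have m2 := cap_hdot_le w0 w1 Sx.
  have me := ge_normc_1B_hdot w Sx; rewrite -/e in me.
  set t := normc (1 - hdot eta x) in m2; set m := normc (1 - hdot w x) in m2 me *.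
  have exj : exists j, t < 2 ^+ j.+1 * e.
    exists (Num.bound (t / e)); rewrite -ltr_pdivrMr//.
    apply: lt_trans (archi_boundP _) _; first by rewrite divr_ge0 ?normc_ge0// ltW.
    rewrite -natrX ltr_nat; exact: ltn_trans (ltnSn _) (ltn_expl _ _).
  pose j := ex_minn exj.
  have [jt jm] : t < 2 ^+ j.+1 * e /\ (2 ^+ j * e / 2 <= m).
    rewrite /j; case: ex_minnP => -[|i] ti mini; split => //.
      by rewrite expr0 mul1r; lra.
    have : 2 ^+ i.+1 * e <= t by rewrite leNgt; apply/negP => /mini; rewrite ltnn.
    by lra.
  apply: (@le_trans _ _ (f j x)).
    rewrite /f indicE mem_set ?mule1// lee_fin /a.
    have m0 : 0 < m by exact: lt_le_trans me.
    apply: lerXn2r; rewrite ?nnegrE ?divr_ge0 ?mulr_ge0 ?exprn_ge0 ?(ltW e0) ?(ltW m0)//.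
    rewrite (_ : 4 / (4 ^+ j * e) = e / (2 ^+ j * e / 2) ^+ 2); last first.
      by rewrite four_pow; apply: quot1; rewrite gt_eqF.
    have p0 : 0 < 2 ^+ j * e / 2 by rewrite divr_gt0// mulr_gt0// exprn_gt0.
    rewrite ler_pM2l// lef_pV2 ?posrE ?exprn_gt0//.
    by apply: lerXn2r; rewrite ?nnegrE ?(ltW p0) ?(ltW m0).
  have := @nneseries_lim_ge R (fun j => f j x) xpredT 0 j.+1 (fun n _ _ => f0 n x).
  apply: le_trans; rewrite big_nat_recr//= leeDr// sume_ge0//.
rewrite integral_nneseries//.
have k0 : 0 <= cap_const R d * 8 ^+ d.
  by rewrite mulr_ge0 ?exprn_ge0// (ltW (cap_const_gt0 _ _)).
apply: le_trans (epsilon_trick0 xpredT (ltW mass_const_gt0)).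
apply: lee_nneseries => [j _ _|j _]; first exact: integral_ge0.
have mcj : measurable_fun S (fun x => (\1_(c j) x)%:E : \bar R).
  by apply/measurable_EFinP/(measurable_funS (E := setT)).
rewrite /f ge0_integralZl ?lee_fin//.
rewrite integral_indic//.
apply: (@le_trans _ _ ((a j)%:E * (cap_const R d * (2 ^+ j.+1 * e) ^+ d)%:E)%E).
  rewrite lee_wpmul2l ?lee_fin//.
  rewrite (_ : c j `&` S = c j); last by apply/setIidPl => x [].
  by apply: sphere_measure_cap => //; rewrite mulr_gt0// exprn_gt0.
rewrite -EFinM lee_fin /a.
have -> : (4 / (4 ^+ j * e)) ^+ d * (cap_const R d * (2 ^+ j.+1 * e) ^+ d) =
    cap_const R d * 8 ^+ d * (2 ^+ j)^-1 ^+ d.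
  rewrite mulrCA -exprMn -mulrA -exprMn; congr (_ * _ ^+ _).
  by rewrite four_pow exprS; apply: quot2; rewrite gt_eqF.
have -> : mass_const / (2 ^ j.+1)%:R = cap_const R d * 8 ^+ d * (2 ^+ j)^-1.
  rewrite /mass_const natrX exprS; move: (cap_const R d * 8 ^+ d) (gt_eqF (pow_gt0 j)).
  by move: (2 ^+ j) => p k p0; field; rewrite p0.
apply: ler_wpM2l => //; rewrite -(prednK hd) exprS ler_piMr ?invr_ge0 ?(ltW (pow_gt0 _))//.
by rewrite exprn_ile1 ?invr_ge0 ?(ltW (pow_gt0 _))// invf_le1// exprn_ege1//; lra.
Qed.

End szego_mass.

Section inner_regularity.
Context (R : realType) (d : nat).
Local Notation Cd := 'rV[R[i]]_d.
Variable m : {finite_measure set Cd -> \bar R}.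
Implicit Types A F U : set Cd.

Lemma open_measurableC U : open U -> measurable U.
Proof. by move=> oU; exact: sub_sigma_algebra. Qed.

Lemma closed_measurableC F : closed F -> measurable F.
Proof.
by move=> cF; rewrite -[F]setCK; apply: measurableC; apply: open_measurableC; exact: closed_openC.
Qed.

Definition inner_regular A := forall e : R, 0 < e ->
  exists F, [/\ closed F, F `<=` A & (m (A `\` F) < e%:E)%E].

Lemma fin_measureC A : measurable A -> (m A < +oo)%E.
Proof. by move=> mA; rewrite -ge0_fin_numE ?measure_ge0// fin_num_measure. Qed.

Lemma inner_regular_open U : open U -> inner_regular U.
Proof.
move=> oU e e0.
pose F n := ~` \bigcup_(w in ~` U) ball (w : Cd) ((n.+1%:R^-1 : R)%:C%C).
have cF n : closed (F n).
  apply: open_closedC; apply: bigcup_open => w _; exact: ball_open.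
have FU n : F n `<=` U.
  move=> z Fz; apply: contrapT => Uz; apply: Fz; exists z => //.
  by apply: ballxx; rewrite ltcR invr_gt0.
pose G n := U `\` F n.
have mG n : measurable (G n).
  by apply: measurableD; [exact: open_measurableC|exact: closed_measurableC].
have G0 : \bigcap_n G n = set0.
  apply/seteqP; split => // z Gz.
  have [Uz _] := Gz 0%N I.
  have /nbhs_ballP[r /= r0 rU] : nbhs z U by exact: open_nbhs_nbhs.
  have rE : r = (Re r)%:C%C by rewrite RRe_real// gtr0_real.
  move: r0; rewrite rE ltcR => r0.
  have [n _ /(_ n (leqnn n)) nr] := near_infty_natSinv_lt (PosNum r0).
  have [_] := Gz n I; apply => -[w Uw]; move=> /ball_sym wz; apply: Uw; apply: rU.
  by apply: le_ball wz; rewrite rE lecR ltW.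
have niG : nonincreasing_seq G.
  move=> i j ij; apply/subsetPset => z [Uz Fz]; split => // Fz'; apply: Fz => -[w Uw wz].
  apply: Fz'; exists w => //; apply: le_ball wz.
  by rewrite lecR lef_pV2 ?posrE// ler_nat.
have := @nonincreasing_cvg_mu _ _ _ m G (fin_measureC (mG 0%N)) mG.
rewrite G0 measure0 => /(_ measurable0 niG) /fine_cvgP[_ /cvgrPdist_lt /(_ _ e0)[n _ /(_ n (leqnn n))]].
rewrite /= sub0r normrN ger0_norm ?fine_ge0 ?measure_ge0// => h.
exists (F n); split => //.
by rewrite -(fineK (fin_num_measure m _ (mG n))) lte_fin.
Qed.

Lemma inner_regular_closed F : closed F -> inner_regular F.
Proof. by move=> cF e e0; exists F; split => //; rewrite setDv measure0 lte_fin. Qed.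

Lemma inner_regular_bigcup (A : nat -> set Cd) : (forall n, measurable (A n)) ->
  (forall n, inner_regular (A n)) -> inner_regular (\bigcup_n A n).
Proof.
move=> mA rA e e0; have e20 : 0 < e / 2 by rewrite divr_gt0.
have mU : measurable (\bigcup_n A n) by exact: bigcup_measurable.
pose G n := \bigcup_n A n `\` \big[setU/set0]_(i < n) A i.
have mG n : measurable (G n) by apply: measurableD => //; exact: bigsetU_measurable.
have G0 : \bigcap_n G n = set0.
  apply/seteqP; split => // z Gz; have [[k _ Akz] _] := Gz 0%N I.
  have [_] := Gz k.+1 I; apply; rewrite -bigcup_mkord.
  by exists k => //=.
have niG : nonincreasing_seq G.
  move=> i j ij; apply/subsetPset => z [Uz Fz]; split => // Fz'; apply: Fz.
  move: Fz'; rewrite -!bigcup_mkord => -[k /= ki Akz].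
  by exists k => //=; exact: leq_trans ij.
have := @nonincreasing_cvg_mu _ _ _ m G (fin_measureC (mG 0%N)) mG.
rewrite G0 measure0 => /(_ measurable0 niG) /fine_cvgP[_ /cvgrPdist_lt /(_ _ e20)[n _ /(_ n (leqnn n))]].
rewrite /= sub0r normrN ger0_norm ?fine_ge0 ?measure_ge0// => hn.
have n0 : 0 < e / 2 / n.+1%:R by rewrite divr_gt0.
have /choice[F hF] i : exists F, [/\ closed F, F `<=` A i &
    (m (A i `\` F) < (e / 2 / n.+1%:R)%:E)%E] by exact: rA.
have cF i : closed (F i) by have [] := hF i.
have mF i := closed_measurableC (cF i).
exists (\big[setU/set0]_(i < n) F i); split.
- elim/big_ind: _ => //; first exact: closed0.
  by move=> X Y; exact: closedU.
- rewrite -bigcup_mkord => z [k _ Fz]; exists k => //.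
  by have [_ + _] := hF k; apply.
apply: (@le_lt_trans _ _ (m (G n `|` \big[setU/set0]_(i < n) (A i `\` F i)))%E).
  apply: le_measure; rewrite ?inE.
  - by apply: measurableD => //; apply: bigsetU_measurable => i _; exact: mF.
  - apply: measurableU => //; apply: bigsetU_measurable => i _; exact: measurableD.
  move=> z [Uz nFz]; have [Gz|Gz] := pselect ((\big[setU/set0]_(i < n) A i) z).
    right; rewrite -(bigcup_mkord _ (fun i => A i `\` F i)); move: Gz nFz; rewrite -!bigcup_mkord => -[k /= kn Az] nFz.
    by exists k; [|split => // Fz; apply: nFz; exists k].
  by left; split.
apply: le_lt_trans (measureU2 _ _ _) _ => //.
  by apply: bigsetU_measurable => i _; exact: measurableD.
rewrite [X in (_ < X%:E)%E](splitr e) EFinD; apply: lte_leD.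
- by rewrite ge0_fin_numE ?measure_ge0// fin_measureC//; apply: bigsetU_measurable => i _; exact: measurableD.
- by rewrite -(fineK (fin_num_measure m _ (mG n))) lte_fin.
have mAF i : measurable (A i `\` F i) by exact: measurableD.
apply: (@le_trans _ _ (\sum_(i < n) m (A i `\` F i))%E).
  exact: (@Boole_inequality _ _ _ m (fun i => A i `\` F i)%classic n (fun i _ => mAF i)).
apply: (@le_trans _ _ (\sum_(i < n) (e / 2 / n.+1%:R)%:E)%E).
  by apply: lee_sum => i _; have [_ _ /ltW] := hF i.
rewrite sumEFin lee_fin sumr_const card_ord -[leLHS]mulr_natr mulrAC.
by rewrite ler_pdivrMr// ler_wpM2l ?(ltW e20)// ler_nat.
Qed.

Lemma inner_regular_bigcap (A : nat -> set Cd) : (forall n, measurable (A n)) ->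
  (forall n, inner_regular (A n)) -> inner_regular (\bigcap_n A n).
Proof.
move=> mA rA e e0; have e20 : 0 < e / 2 by rewrite divr_gt0.
have /choice[F hF] i : exists F, [/\ closed F, F `<=` A i &
    (m (A i `\` F) < (e / 2 / (2 ^ i.+1)%:R)%:E)%E].
  by apply: rA; rewrite divr_gt0// ltr0n expn_gt0.
have cF i : closed (F i) by have [] := hF i.
have mF i := closed_measurableC (cF i).
have mAF i : measurable (A i `\` F i) by exact: measurableD.
exists (\bigcap_n F n); split.
- exact: closed_bigI.
- by move=> z Fz n _; have [_ + _] := hF n; apply; exact: Fz.
apply: (@le_lt_trans _ _ (\sum_(i <oo) m (A i `\` F i))%E).
  apply: measure_sigma_subadditive => //.
    by apply: measurableD; exact: bigcap_measurable.
  move=> z [Az nFz]; have [k Fk] : exists k, ~ F k z.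
    by apply/existsNP => H; apply: nFz => k _; exact: H.
  by exists k => //; split => //; exact: Az.
apply: (@le_lt_trans _ _ (e / 2)%:E); last by rewrite lte_fin; lra.
apply: le_trans (epsilon_trick0 xpredT (ltW e20)).
by apply: lee_nneseries => // i _; have [_ _ /ltW] := hF i.
Qed.

Lemma measurable_inner_regular A : measurable A -> inner_regular A.
Proof.
pose G : set (set Cd) := [set A | [/\ measurable A, inner_regular A & inner_regular (~` A)]].
suff : @measurable _ Cd `<=` G by move=> /[apply] -[].
apply: smallest_sub; last first.
  move=> U oU; split; first exact: open_measurableC.
    exact: inner_regular_open.
  by apply: inner_regular_closed; exact: open_closedC.
split.
- split; first exact: measurable0.
    by apply: inner_regular_closed; exact: closed0.
  by rewrite setC0; apply: inner_regular_closed; exact: closedT.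
- move=> X [mX rX rX']; rewrite setTD; split => //; first exact: measurableC.
  by rewrite setCK.
move=> X GX; split.
- by apply: bigcup_measurable => n _; have [] := GX n.
- by apply: inner_regular_bigcup => n; have [] := GX n.
rewrite setC_bigcup; apply: inner_regular_bigcap => n; have [] := GX n => //.
by move=> *; exact: measurableC.
Qed.

End inner_regularity.

(* FILE B1 *)

Section binomial_series.
Context (R : realType).
Implicit Types (x : R[i]) (r : R).

Fixpoint binom_coef (d l : nat) : nat :=
  if d is d'.+1 then \sum_(m < l.+1) binom_coef d' m else (l == 0)%N.

Arguments binom_coef : simpl never.

Definition binom_sum d L r : R := \sum_(l < L) (binom_coef d l)%:R * r ^+ l.
Definition binom_csum d L x : R[i] := \sum_(l < L) (binom_coef d l)%:R * x ^+ l.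

Lemma binom_coefE d l : binom_coef d.+1 l = (\sum_(m < l.+1) binom_coef d m)%N.
Proof. by []. Qed.

Lemma binom_coefS d l :
  binom_coef d.+1 l.+1 = (binom_coef d.+1 l + binom_coef d l.+1)%N.
Proof. by rewrite !binom_coefE big_ord_recr. Qed.

Lemma binom_coef0 d : binom_coef d 0 = 1%N.
Proof. by elim: d => // d IH; rewrite binom_coefE big_ord_recr big_ord0 /= IH. Qed.

Lemma binom_sum_rec (F : comNzRingType) d L (x : F) :
  (1 - x) * \sum_(l < L.+1) (binom_coef d.+1 l)%:R * x ^+ l =
  \sum_(l < L.+1) (binom_coef d l)%:R * x ^+ l -
  (binom_coef d.+1 L)%:R * x ^+ L.+1.
Proof.
elim: L => [|L IH].
  by rewrite !big_ord_recr !big_ord0/= !add0r !binom_coef0; ring.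
rewrite big_ord_recr [in RHS]big_ord_recr/= mulrDr IH binom_coefS natrD.
rewrite !exprS; move: (\sum_(l < L.+1) _ * _) => S; ring.
Qed.

Definition binom_tail d L r := ((1 - r) ^- d) - binom_sum d L r.

Lemma binom_tail_rec d L r : r < 1 ->
  binom_tail d.+1 L.+1 r = (binom_tail d L.+1 r + (binom_coef d.+1 L)%:R * r ^+ L.+1) / (1 - r).
Proof.
move=> r1; have r10 : 1 - r != 0 by rewrite subr_eq0 gt_eqF.
have := binom_sum_rec d L r; rewrite -/(binom_sum d.+1 L.+1 r) -/(binom_sum d L.+1 r).
rewrite /binom_tail; move: (binom_sum d.+1 _ _) (binom_sum d _ _) => S' S.
move: (_%:R * _) => k rec; apply: (mulfI r10).
rewrite mulrBr rec mulrCA mulfV// mulr1 exprS invfM mulrA mulfV// mul1r.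
by ring.
Qed.

Lemma binom_tail_ge0 d L r : 0 <= r -> r < 1 -> 0 <= binom_tail d L.+1 r.
Proof.
move=> r0 r1; elim: d => [|d IH].
  rewrite /binom_tail /binom_sum big_ord_recl/= big1 => [|i _]; last by rewrite mul0r.
  by rewrite !expr0 invr1 mulr1 addr0 subrr.
rewrite binom_tail_rec// divr_ge0 ?subr_ge0 ?(ltW r1)// addr_ge0//.
by rewrite mulr_ge0// exprn_ge0.
Qed.

Lemma binom_csum_tail d L x r : normc x <= r -> r < 1 ->
  normc ((1 - x) ^- d - binom_csum d L.+1 x) <= binom_tail d L.+1 r.
Proof.
move=> xr r1; have r0 : 0 <= r by apply: le_trans xr; exact: normc_ge0.
have x1 : 1 - x != 0.
  apply/eqP => /subr0_eq x1; move: xr; rewrite -x1 Normc.normc1 => /le_lt_trans/(_ r1).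
  by rewrite ltxx.
elim: d => [|d IH].
  rewrite /binom_csum big_ord_recl/= big1 => [|i _]; last by rewrite mul0r.
  by rewrite !expr0 invr1 mulr1 addr0 subrr Normc.normc0 binom_tail_ge0.
have -> : (1 - x) ^- d.+1 - binom_csum d.+1 L.+1 x =
    (((1 - x) ^- d - binom_csum d L.+1 x) + (binom_coef d.+1 L)%:R * x ^+ L.+1) / (1 - x).
  have := binom_sum_rec d L x; rewrite -/(binom_csum d.+1 L.+1 x) -/(binom_csum d L.+1 x).
  move: (binom_csum d.+1 _ _) (binom_csum d _ _) => S' S.
  move: (_%:R * _) => k rec; apply: (mulfI x1).
  rewrite mulrBr rec mulrCA mulfV// mulr1 exprS invfM mulrA mulfV// mul1r.
  by ring.
rewrite binom_tail_rec// Normc.normcM Normc.normcV; apply: ler_pM.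
- exact: normc_ge0.
- by rewrite invr_ge0 normc_ge0.
- apply: le_trans (le_normcD _ _) _; apply: lerD => //.
  rewrite Normc.normcM normcX; apply: ler_pM; rewrite ?normc_ge0 ?exprn_ge0 ?normc_ge0//.
    by rewrite -(rmorph_nat (real_complex R)) normc_real ger0_norm.
  by apply: lerXn2r; rewrite ?nnegrE ?normc_ge0.
have h : 1 - r <= normc (1 - x).
  by apply: le_trans (ler_normc_sub _ _); rewrite Normc.normc1 lerD2l lerN2.
by rewrite lef_pV2 ?posrE//; [apply: lt_le_trans h|]; rewrite subr_gt0.
Qed.

Lemma binom_tail_cvg d r : 0 <= r -> r < 1 -> binom_tail d L.+1 r @[L --> \oo] --> (0 : R).
Proof.
move=> r0 r1; elim: d => [|d IH].
  rewrite [X in X @ _ --> _](_ : _ = fun=> 0); first exact: cvg_cst.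
  apply/funext => L; rewrite /binom_tail /binom_sum big_ord_recl/= big1 => [|i _]; last by rewrite mul0r.
  by rewrite !expr0 invr1 mulr1 addr0 subrr.
have cu : (binom_coef d.+1 L)%:R * r ^+ L @[L --> \oo] --> (0 : R).
  apply: cvg_series_cvg_0; apply: nondecreasing_is_cvgn.
    apply/nondecreasing_seqP => n; rewrite /series/= big_nat_recr//= lerDl.
    by rewrite mulr_ge0// exprn_ge0.
  exists ((1 - r) ^- d.+1) => _ [[|n] _ <-].
    by rewrite /series/= big_geq// invr_ge0 exprn_ge0// subr_ge0 ltW.
  by rewrite /series/= big_mkord -subr_ge0; exact: binom_tail_ge0.
rewrite [X in X @ _ --> _](_ : _ = (fun L => (binom_tail d L.+1 r +
    (binom_coef d.+1 L)%:R * r ^+ L.+1) / (1 - r))); last first.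
  by apply/funext => L; rewrite binom_tail_rec.
rewrite -[X in _ --> X](mul0r ((1 - r)^-1)); apply: cvgMl.
rewrite -[X in _ --> X]addr0; apply: cvgD => //.
rewrite [X in X @ _ --> _](_ : _ = (fun L => (binom_coef d.+1 L)%:R * r ^+ L * r)).
  by rewrite -[X in _ --> X](mul0r r); exact: cvgMl.
by apply/funext => L; rewrite exprSr mulrA.
Qed.

End binomial_series.

(* FILE B2 *)

Section szego_contraction.
Context (R : realType) (d : nat).
Implicit Types (g : R[i] -> R[i]).

Section quadratic_form.
Context (I : finType) (l : I -> R[i]).
Implicit Types c : I -> R[i].

Definition szego_form c : R[i] :=
  \sum_i \sum_j c i * (c j)^*%C * (1 - l i * (l j)^*%C) ^- d.

Definition moment c n : R[i] := \sum_i c i * l i ^+ n.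

Lemma szego_form_moments c L (r : R) : (forall i, normc (l i) <= r) -> r < 1 ->
  normc (szego_form c -
    (\sum_(n < L.+1) (binom_coef d n)%:R * normc (moment c n) ^+ 2)%:C%C) <=
  (\sum_i normc (c i)) ^+ 2 * binom_tail d L.+1 (r ^+ 2).
Proof.
move=> lr r1; have [i0|/forallNP noI] := pselect (exists i : I, True); last first.
  have I0 (V : nmodType) (F : I -> V) : \sum_i F i = 0 by rewrite big1// => i _; case: (noI i).
  rewrite /szego_form !I0 big1 => [|n _]; last by rewrite /moment I0 Normc.normc0 expr0n/= mulr0.
  by rewrite subr0 Normc.normc0 expr0n/= mul0r.
have r0 : 0 <= r by case: i0 => i _; apply: le_trans (lr i); exact: normc_ge0.
have -> : (\sum_(n < L.+1) (binom_coef d n)%:R * normc (moment c n) ^+ 2)%:C%C =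
    \sum_i \sum_j c i * (c j)^*%C * binom_csum d L.+1 (l i * (l j)^*%C).
  transitivity (\sum_(n < L.+1) \sum_i \sum_j
      (binom_coef d n)%:R * (c i * l i ^+ n * (c j * l j ^+ n)^*%C) : R[i]).
    rewrite rmorph_sum/=; apply: eq_bigr => n _.
    rewrite rmorphM/= rmorph_nat -mulc_conj /moment rmorph_sum/= mulr_suml mulr_sumr.
    apply: eq_bigr => i _; rewrite mulr_sumr mulr_sumr; apply: eq_bigr => j _ //.
  rewrite exchange_big/=; apply: eq_bigr => i _.
  rewrite exchange_big/=; apply: eq_bigr => j _.
  rewrite /binom_csum mulr_sumr; apply: eq_bigr => n _.
  by rewrite exprMn rmorphM/= rmorphXn/=; ring.
have -> : (\sum_i normc (c i)) ^+ 2 * binom_tail d L.+1 (r ^+ 2) =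
    \sum_i \sum_j normc (c i) * normc (c j) * binom_tail d L.+1 (r ^+ 2).
  rewrite expr2 -mulrA mulr_suml; apply: eq_bigr => i _.
  by rewrite mulr_suml mulr_sumr; apply: eq_bigr => j _; rewrite mulrA.
rewrite /szego_form -sumrB; apply: le_trans (normc_sum _ _ _) _; apply: ler_sum => i _.
rewrite -sumrB; apply: le_trans (normc_sum _ _ _) _; apply: ler_sum => j _.
rewrite -mulrBr !Normc.normcM normc_conj.
apply: ler_wpM2l; first by rewrite mulr_ge0 ?normc_ge0.
apply: binom_csum_tail; last by rewrite exprn_ilt1.
by rewrite Normc.normcM normc_conj expr2; apply: ler_pM; rewrite ?normc_ge0.
Qed.

End quadratic_form.

Definition szego_contractive g := forall (I : finType) (c l : I -> R[i]),
  (forall i, normc (l i) < 1) ->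
  0 <= Re (\sum_i \sum_j c i * (c j)^*%C *
    ((1 - g (l i) * (g (l j))^*%C) * (1 - l i * (l j)^*%C) ^- d)).

Lemma szego_contractive_moments g (I : finType) (c l : I -> R[i]) (r : R) L :
  szego_contractive g -> (forall z, normc z < 1 -> normc (g z) < 1) ->
  (forall i, normc (l i) <= r) -> r < 1 ->
  normc (\sum_i c i * g (l i)) ^+ 2 <=
  \sum_(n < L.+1) (binom_coef d n)%:R * normc (moment l c n) ^+ 2 +
  2 * (\sum_i normc (c i)) ^+ 2 * binom_tail d L.+1 (r ^+ 2).
Proof.
move=> gP g1 lr r1; have l1 i : normc (l i) < 1 by exact: le_lt_trans (lr i) r1.
pose c' i := c i * g (l i).
have [i0|/forallNP noI] := pselect (exists i : I, True); last first.
  have I0 (V : nmodType) (F : I -> V) : \sum_i F i = 0 by rewrite big1// => i _; case: (noI i).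
  rewrite !I0 Normc.normc0 !expr0n/= mulr0 mul0r addr0 sumr_ge0// => n _.
  by rewrite mulr_ge0// sqr_ge0.
have r0 : 0 <= r by case: i0 => i _; apply: le_trans (lr i); exact: normc_ge0.
have T0 : 0 <= binom_tail d L.+1 (r ^+ 2).
  by apply: binom_tail_ge0; rewrite ?sqr_ge0// exprn_ilt1.
have := gP I c l l1.
have -> : \sum_i \sum_j c i * (c j)^*%C *
    ((1 - g (l i) * (g (l j))^*%C) * (1 - l i * (l j)^*%C) ^- d) =
    szego_form l c - szego_form l c'.
  rewrite /szego_form -sumrB; apply: eq_bigr => i _.
  rewrite -sumrB; apply: eq_bigr => j _; rewrite /c' rmorphM/=; ring.
rewrite ReB subr_ge0 => Qcc'.
have approx (e : I -> R[i]) : `|Re (szego_form l e) -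
    \sum_(n < L.+1) (binom_coef d n)%:R * normc (moment l e n) ^+ 2| <=
    (\sum_i normc (e i)) ^+ 2 * binom_tail d L.+1 (r ^+ 2).
  by apply: le_trans (szego_form_moments e L lr r1); rewrite -[X in _ - X]/(Re _%:C%C) -ReB Re_le_normc.
have := approx c; have := approx c'; rewrite !ler_distl => /andP[h1 _] /andP[_ h2].
have h3 : normc (\sum_i c i * g (l i)) ^+ 2 <=
    \sum_(n < L.+1) (binom_coef d n)%:R * normc (moment l c' n) ^+ 2.
  rewrite big_ord_recl/= binom_coef0 mul1r.
  rewrite [moment l c' 0](_ : _ = \sum_i c i * g (l i)); last first.
    by apply: eq_bigr => i _; rewrite expr0 mulr1.
  by rewrite lerDl sumr_ge0// => n _; rewrite mulr_ge0// sqr_ge0.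
have h4 : (\sum_i normc (c' i)) ^+ 2 * binom_tail d L.+1 (r ^+ 2) <=
    (\sum_i normc (c i)) ^+ 2 * binom_tail d L.+1 (r ^+ 2).
  rewrite ler_wpM2r// lerXn2r ?nnegrE ?sumr_ge0//; do ?by move=> i _; exact: normc_ge0.
  apply: ler_sum => i _; rewrite /c' Normc.normcM ler_piMr ?normc_ge0//.
  by apply: ltW; exact: g1.
lra.
Qed.

Lemma sum_option (V : nmodType) (I : finType) (F : option I -> V) :
  \sum_i F i = F None + \sum_j F (Some j).
Proof.
rewrite (bigD1 None)//= (reindex_omap Some id)//=; last by case.
by congr (_ + _); apply: eq_bigl => j; rewrite eqxx.
Qed.

Lemma primitive_root_exists n : (0 < n)%N -> exists z : R[i], n.-primitive_root z.
Proof.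
pose p : {poly R[i]} := 'X^n - 1; have [r Dp] := closed_field_poly_normal p.
move=> n_gt0; rewrite (monicP _) ?monicXnsubC // scale1r in Dp.
have rn1: all n.-unity_root r by apply/allP=> z; rewrite -root_prod_XsubC -Dp.
have sz_r: (n < (size r).+1)%N.
  by rewrite -(size_prod_XsubC r id) -Dp size_XnsubC.
have [|z] := hasP (has_prim_root n_gt0 rn1 _ sz_r); last by exists z.
by rewrite -separable_prod_XsubC -Dp separable_Xn_sub_1 // pnatr_eq0 -lt0n.
Qed.

Lemma normc_unity_root n (z : R[i]) : (0 < n)%N -> z ^+ n = 1 -> normc z = 1.
Proof.
move=> n0 z1; have := Normc.normc1 R; rewrite -z1 normcX => /eqP.
by rewrite pexpr_eq1 ?normc_ge0// => /eqP.
Qed.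

Lemma mean_prim_root n (w : R[i]) i j : n.-primitive_root w ->
  n%:R^-1 * \sum_(k < n) (w ^+ i / w ^+ j) ^+ k = (i == j %[mod n])%:R.
Proof.
move=> pw; have n0 : n%:R != 0 :> R[i] by rewrite pnatr_eq0 -lt0n (prim_order_gt0 pw).
have wX0 k : w ^+ k != 0.
  by rewrite expf_neq0// (prim_root_eq0 pw) -lt0n (prim_order_gt0 pw).
rewrite -(eq_prim_root_expr pw); have [->|ij] := eqVneq.
  rewrite divff//; under eq_bigr do rewrite expr1n.
  by rewrite sumr_const card_ord mulVf.
have u1 : w ^+ i / w ^+ j - 1 != 0.
  by rewrite subr_eq0; apply: contra ij => /eqP/divr1_eq ->.
apply/eqP; rewrite mulf_eq0; apply/orP; right; rewrite -(mulrI_eq0 _ (mulfI u1)) -subrX1.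
by rewrite expr_div_n -!exprM ![(_ * n)%N]mulnC !exprM (prim_expr_order pw) !expr1n divr1 subrr.
Qed.

Theorem szego_contractive_poly g (r e : R) :
  szego_contractive g -> (forall z, normc z < 1 -> normc (g z) < 1) ->
  0 < r -> r < 1 -> 0 < e ->
  exists p : {poly R[i]}, forall z, normc z <= r -> normc (g z - p.[z]) <= e.
Proof.
move=> gP g1 r0 r1 e0.
have r21 : r ^+ 2 < 1 by rewrite exprn_ilt1// ltW.
have e40 : 0 < e ^+ 2 / 4 by rewrite divr_gt0// exprn_gt0.
have /cvgrPdist_le/(_ _ e40)[M _ /(_ M (leqnn M))] := binom_tail_cvg d (sqr_ge0 r) r21.
rewrite /= sub0r normrN ger0_norm ?binom_tail_ge0 ?sqr_ge0// => TM.
pose N := M.+1.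
have [w pw] := primitive_root_exists (ltn0Sn M).
have w1 : normc w = 1 by apply: (normc_unity_root (ltn0Sn M)); exact: prim_expr_order.
have w0 : w != 0 by rewrite (prim_root_eq0 pw).
have rc0 : r%:C%C != 0 :> R[i] by rewrite (inj_eq (@complexI R)) gt_eqF.
pose A n := (N%:R^-1 * \sum_(j < N) g (r%:C%C * w ^+ j) / w ^+ (n * j)) / r%:C%C ^+ n.
exists (\poly_(n < N) A n) => z zr.
pose I := option 'I_N.
pose l (i : I) : R[i] := if i is Some j then r%:C%C * w ^+ j else z.
pose c (i : I) : R[i] := if i is Some j then
  - (N%:R^-1 * \sum_(n < N) (z / r%:C%C) ^+ n / w ^+ (n * j)) else 1.
have lr i : normc (l i) <= r.
  case: i => [j|]//=; rewrite Normc.normcM normcX w1 expr1n mulr1 normc_real.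
  by rewrite ger0_norm// ltW.
have -> : g z - (\poly_(n < N) A n).[z] = \sum_i c i * g (l i).
  rewrite sum_option/= mul1r; congr (_ + _); rewrite horner_poly -sumrN.
  rewrite [RHS](_ : _ = \sum_(j < N) \sum_(n < N)
     - (N%:R^-1 * ((z / r%:C%C) ^+ n / w ^+ (n * j) * g (r%:C%C * w ^+ j)))); last first.
    by apply: eq_bigr => j _; rewrite mulNr -mulrA mulr_suml mulr_sumr sumrN.
  rewrite exchange_big/=; apply: eq_bigr => n _.
  rewrite sumrN /A; congr (- _).
  rewrite (_ : _ * z ^+ n = N%:R^-1 * ((\sum_(j < N) g (r%:C%C * w ^+ j) / w ^+ (n * j)) *
    (z ^+ n / r%:C%C ^+ n))); last by ring.
  rewrite mulr_suml mulr_sumr; apply: eq_bigr => j _; rewrite expr_div_n; ring.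
have mom k : moment l c k = z ^+ k - r%:C%C ^+ k * (z / r%:C%C) ^+ (k %% N).
  rewrite /moment sum_option/= mul1r; congr (_ + _).
  rewrite [LHS](_ : _ = \sum_(j < N) \sum_(n < N)
     - (N%:R^-1 * ((z / r%:C%C) ^+ n / w ^+ (n * j) * (r%:C%C * w ^+ j) ^+ k))); last first.
    by apply: eq_bigr => j _; rewrite mulNr -mulrA mulr_suml mulr_sumr sumrN.
  rewrite exchange_big/= [LHS](_ : _ = - \sum_(n < N)
     (r%:C%C ^+ k * (z / r%:C%C) ^+ n) * (k == n %[mod N])%:R).
    have kN : (k %% N < N)%N by rewrite ltn_mod.
    rewrite (bigD1 (Ordinal kN))//= modn_mod eqxx mulr1 big1 ?addr0//.
    move=> n nk; suff -> : (k == n %[mod N]) = false by rewrite mulr0.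
    apply: contra_neqF nk => /eqP kn; apply: val_inj => /=.
    by rewrite kn modn_small.
  rewrite -sumrN; apply: eq_bigr => n _; rewrite sumrN -(mean_prim_root k n pw).
  rewrite mulrCA mulr_sumr; congr (- _); rewrite mulr_sumr; apply: eq_bigr => j _.
  rewrite /N !expr_div_n exprMn -!exprM [(j * k)%N]mulnC; ring.
have momN k : (k < N)%N -> moment l c k = 0.
  move=> kN; rewrite mom modn_small// expr_div_n mulrCA mulfV ?expf_neq0// mulr1.
  by rewrite subrr.
have zr1 : normc (z / r%:C%C) <= 1.
  by rewrite Normc.normcM Normc.normcV normc_real ger0_norm ?(ltW r0)// ler_pdivrMr// mul1r.
have momle k : normc (moment l c k) ^+ 2 <= 4 * (r ^+ 2) ^+ k.
  have -> : 4 * (r ^+ 2) ^+ k = (2 * r ^+ k) ^+ 2.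
    by rewrite [RHS]exprMn [(r ^+ k) ^+ 2]exprAC; congr (_ * _); ring.
  apply: lerXn2r; rewrite ?nnegrE ?normc_ge0 ?mulr_ge0 ?exprn_ge0 ?(ltW r0)//.
  rewrite mom; apply: le_trans (le_normcB _ _) _; rewrite mulr2n mulrDl mul1r.
  apply: lerD; first by rewrite normcX lerXn2r ?nnegrE ?normc_ge0 ?(ltW r0).
  rewrite Normc.normcM !normcX normc_real ger0_norm ?(ltW r0)// ler_piMr ?exprn_ge0 ?(ltW r0)//.
  by rewrite exprn_ile1 ?normc_ge0.
have key L : normc (\sum_i c i * g (l i)) ^+ 2 <= e ^+ 2 +
   2 * (\sum_i normc (c i)) ^+ 2 * binom_tail d (N + L).+1 (r ^+ 2).
  apply: le_trans (szego_contractive_moments c (N + L) gP g1 lr r1) _.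
  rewrite lerD2r -addnS big_split_ord/= big1 ?add0r; last first.
    by move=> n _; rewrite momN// Normc.normc0 expr0n/= mulr0.
  apply: (@le_trans _ _ (4 * binom_tail d N (r ^+ 2))); last by lra.
  have : 0 <= binom_tail d (N + L).+1 (r ^+ 2) by rewrite binom_tail_ge0// sqr_ge0.
  rewrite /binom_tail /binom_sum -addnS big_split_ord/= opprD addrA subr_ge0 => h.
  apply: le_trans (ler_wpM2l _ h) => //; rewrite mulr_sumr; apply: ler_sum => n _.
  by rewrite [leRHS]mulrCA ler_wpM2l.
have cvK : e ^+ 2 + 2 * (\sum_i normc (c i)) ^+ 2 * binom_tail d (N + L).+1 (r ^+ 2)
    @[L --> \oo] --> e ^+ 2.
  rewrite -[X in _ --> X]addr0; apply: cvgD; first exact: cvg_cst.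
  rewrite -[X in _ --> X](mulr0 (2 * (\sum_i normc (c i)) ^+ 2)); apply: cvgMr.
  rewrite [X in X @ _ --> _](_ : _ = (fun L => binom_tail d (L + N).+1 (r ^+ 2))).
    by rewrite (cvg_shiftn N (fun L => binom_tail d L.+1 (r ^+ 2))); exact: (binom_tail_cvg d (sqr_ge0 r) r21).
  by apply/funext => L; rewrite addnC.
have : normc (\sum_i c i * g (l i)) ^+ 2 <= e ^+ 2.
  by apply: (cvgr_to_ge cvK); exact: nearW.
by rewrite ler_pXn2r ?nnegrE ?normc_ge0// ltW.
Qed.

End szego_contraction.

(* FILE B3 *)

Section rkhs_theory.
Context (T : Type) (R : realType) (D : set T) (K : T -> T -> R[i]) (H : rkhs D K).
Implicit Types (f h : T -> R[i]).

Lemma rkhs_dot0l h : rkhs_mem H h -> rkhs_dot H (fun=> 0) h = 0.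
Proof.
move=> mh; have m0 := rkhs_mem0 H.
have := rkhs_dotP 1 m0 m0 mh.
rewrite (_ : (fun z : T => 1 * 0 + 0) = fun=> 0); last first.
  by apply/funext => z; rewrite mulr0 addr0.
by rewrite mul1r => /eqP; rewrite -subr_eq0 opprD addrA subrr sub0r oppr_eq0 => /eqP.
Qed.

Lemma rkhs_dot_kernel_sum (I : Type) (s : seq I) (a : I -> R[i]) (w : I -> T) :
  (forall i, D (w i)) ->
  let f := fun z => \sum_(i <- s) a i * rkhs_kernel H (w i) z in
  rkhs_mem H f /\ forall h, rkhs_mem H h ->
    rkhs_dot H f h = \sum_(i <- s) a i * rkhs_dot H (rkhs_kernel H (w i)) h.
Proof.
move=> Dw; elim: s => [|i s [IH1 IH2]] /=.
  have -> : (fun z => \sum_(i <- [::]) a i * rkhs_kernel H (w i) z) = fun=> 0.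
    by apply/funext => z; rewrite big_nil.
  by split; [exact: rkhs_mem0|move=> h mh; rewrite big_nil rkhs_dot0l].
have -> : (fun z => \sum_(i <- i :: s) a i * rkhs_kernel H (w i) z) =
    fun z => a i * rkhs_kernel H (w i) z + \sum_(i <- s) a i * rkhs_kernel H (w i) z.
  by apply/funext => z; rewrite big_cons.
have mk := rkhs_kernel_mem H (Dw i).
split; first exact: rkhs_memP.
by move=> h mh; rewrite big_cons rkhs_dotP// IH2.
Qed.

Lemma rkhs_kernel_psd (I : finType) (a : I -> R[i]) (w : I -> T) :
  (forall i, D (w i)) -> 0 <= \sum_i \sum_j a i * (a j)^*%C * K (w i) (w j).
Proof.
move=> Dw; have [mf df] := rkhs_dot_kernel_sum (index_enum I) (fun i => (a i)^*%C) Dw.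
set S := \sum_i \sum_j _; suff E : S^*%C = \sum_i (a i)^*%C * rkhs_dot H
    (rkhs_kernel H (w i)) (fun z => \sum_i (a i)^*%C * rkhs_kernel H (w i) z).
  by rewrite -conj_ge0 E -df//; exact: rkhs_dot_ge0.
rewrite rmorph_sum/=; apply: eq_bigr => i _.
rewrite (rkhs_dotC mf (rkhs_kernel_mem H (Dw i))) -rkhs_reproducing//.
rewrite !rmorph_sum mulr_sumr; apply: eq_bigr => j _.
by rewrite !rmorphM/= !conjcK mulrA /rkhs_kernel asboolT.
Qed.

End rkhs_theory.

Section slices.
Context (R : realType) (d : nat).
Local Notation Cd := 'rV[R[i]]_d.

Lemma dbr_slice_contractive (b : Cd -> R[i]) (H : dbr_space b) (z : Cd) :
  enorm z = 1 -> szego_contractive d (fun l => b (l *: z)).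
Proof.
move=> z1 I c l l1.
have Bl i : unit_ball (l i *: z) by rewrite /unit_ball/= enormZ z1 mulr1.
have := rkhs_kernel_psd H c Bl; rewrite lecE => /andP[_ /=].
congr (_ <= Re _); apply: eq_bigr => i _; apply: eq_bigr => j _.
rewrite /dbr_kernel hdotZl hdotZr mulrA; congr (_ * (_ / (1 - _) ^+ d)).
have -> : hdot z z = 1.
  rewrite -[RHS](rmorph1 (real_complex R)) -[in RHS](expr1n R 2) -{1}z1 sqr_enorm.
  by rewrite rmorph_sum/=; apply: eq_bigr => i' _; rewrite mulc_conj.
by rewrite mulr1.
Qed.

End slices.

(* FILE B4 *)

Section trigonometric_polynomials.
Context (R : realType).
Implicit Types (x y r : R) (q : {poly R[i]}).

Definition expi x : R[i] := (cos x +i* sin x)%C.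

Lemma normc_expi x : normc (expi x) = 1.
Proof. by rewrite /= cos2Dsin2 sqrtr1. Qed.

Lemma expiD x y : expi (x + y) = expi x * expi y.
Proof. by apply/eqP; rewrite eq_complex/= cosD sinD eqxx addrC eqxx. Qed.

Lemma expi0 : expi 0 = 1.
Proof. by rewrite /expi cos0 sin0. Qed.

Lemma expiMn x n : expi (n%:R * x) = expi x ^+ n.
Proof.
elim: n => [|n IH]; first by rewrite mul0r expi0 expr0.
by rewrite -natr1 mulrDl mul1r expiD IH exprSr.
Qed.

Lemma mean_value_bound (f f' : R -> R) (M a b : R) : a <= b ->
  (forall x, a <= x <= b -> is_derive x (1 : R) f (f' x)) ->
  (forall x, a <= x <= b -> `|f' x| <= M) -> `|f b - f a| <= M * (b - a).
Proof.
move=> ab df f'M.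
have cf : {within `[a, b], continuous f}.
  apply/continuous_in_subspaceT => x; rewrite inE/= in_itv/= => xab.
  have dfx := df x xab; apply: differentiable_continuous; apply/derivable1_diffP.
  exact: ex_derive.
have [c] := MVT_segment ab (fun x xab => df x (subset_itv_oo_cc xab)) cf.
by rewrite in_itv/= => cab ->; rewrite normrM (ger0_norm (x := b - a)) ?subr_ge0// ler_wpM2r ?subr_ge0// f'M.
Qed.

Definition angular_primitive q r x : R :=
  \sum_(1 <= n < size q) r ^+ n * Im (q`_n * expi (n%:R * x)) / n%:R.

Lemma horner_split q (z : R[i]) :
  q.[z] - q`_0 = \sum_(1 <= n < size q) q`_n * z ^+ n.
Proof.
rewrite horner_coef -(big_mkord xpredT (fun i => q`_i * z ^+ i)).
have [q0|q0] := posnP (size q).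
  by rewrite q0 !big_geq// (size0nil q0) nth_nil subrr.
by rewrite big_ltn// expr0 mulr1 addrAC subrr add0r.
Qed.

Lemma ReZ (a : R) (z : R[i]) : Re (a%:C%C * z) = a * Re z.
Proof. by case: z => u v; rewrite /= mul0r subr0. Qed.

Lemma ImZ (a : R) (z : R[i]) : Im (a%:C%C * z) = a * Im z.
Proof. by case: z => u v; rewrite /= mul0r addr0. Qed.

Lemma Re_horner_polar q r x :
  Re (q.[r%:C%C * expi x] - q`_0) =
  \sum_(1 <= n < size q) r ^+ n * Re (q`_n * expi (n%:R * x)).
Proof.
rewrite horner_split Re_sum; apply: eq_bigr => n _.
by rewrite exprMn expiMn mulrCA -rmorphXn/= ReZ.
Qed.

Lemma Im_horner_polar q r x :
  Im (q.[r%:C%C * expi x] - q`_0) =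
  \sum_(1 <= n < size q) r ^+ n * Im (q`_n * expi (n%:R * x)).
Proof.
rewrite horner_split Im_sum; apply: eq_bigr => n _.
by rewrite exprMn expiMn mulrCA -rmorphXn/= ImZ.
Qed.

Lemma is_derive_big_nat (m n : nat) (f f' : nat -> R -> R) x :
  (forall i, (m <= i)%N -> is_derive x (1 : R) (f i) (f' i x)) ->
  is_derive x (1 : R) (fun x => \sum_(m <= i < n) f i x) (\sum_(m <= i < n) f' i x).
Proof.
move=> df; elim: n => [|n IH].
  rewrite big_geq//; rewrite (_ : (fun _ => _) = cst 0); first exact: is_derive_cst.
  by apply/funext => y; rewrite big_geq.
have [mn|mn] := leqP m n; last first.
  rewrite big_geq//; rewrite (_ : (fun _ => _) = cst 0); first exact: is_derive_cst.
  by apply/funext => y; rewrite big_geq.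
rewrite big_nat_recr//=.
rewrite (_ : (fun _ => _) = (fun x => \sum_(m <= i < n) f i x) \+ f n).
  by apply: is_deriveD; exact: df.
by apply/funext => y; rewrite big_nat_recr.
Qed.

Lemma is_derive_angular q r x :
  is_derive x (1 : R) (angular_primitive q r) (Re (q.[r%:C%C * expi x] - q`_0)).
Proof.
rewrite Re_horner_polar.
apply: (@is_derive_big_nat 1 (size q)
  (fun n x => r ^+ n * Im (q`_n * expi (n%:R * x)) / n%:R)
  (fun n x => r ^+ n * Re (q`_n * expi (n%:R * x)))) => n n0.
have n0' : n%:R != 0 :> R by rewrite pnatr_eq0 -lt0n.
case: (q`_n) => u v /=.
rewrite (_ : (fun _ => _) = (fun x => r ^+ n / n%:R * (u * sin (n%:R * x) + v * cos (n%:R * x)))); last first.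
  by apply/funext => y; rewrite mulrAC.
apply: is_derive_eq.
by rewrite /GRing.scale/=; field.
Qed.

Lemma is_derive_radial q r x : 0 < r ->
  is_derive r (1 : R) (fun r => angular_primitive q r x)
    (Im (q.[r%:C%C * expi x] - q`_0) / r).
Proof.
move=> r0; rewrite Im_horner_polar mulr_suml.
apply: (@is_derive_big_nat 1 (size q)
  (fun n r => r ^+ n * Im (q`_n * expi (n%:R * x)) / n%:R)
  (fun n r => r ^+ n * Im (q`_n * expi (n%:R * x)) / r)) => -[//|n] _.
have n0 : n.+1%:R != 0 :> R by rewrite pnatr_eq0.
move: (Im _) => c.
rewrite (_ : (fun _ => _) = (c / n.+1%:R) *: (id ^+ n.+1 : R -> R)); last first.
  by apply/funext => y; rewrite /GRing.scale/= fctE mulrAC mulrC mulrA mulrAC.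
apply: is_derive_eq.
rewrite /GRing.scale/= mulr1 exprS -mulr_natr; field.
by move: n0; rewrite mulrS (gt_eqF r0) => ->.
Qed.

End trigonometric_polynomials.

(* FILE B5 *)

Section poisson_kernel.
Context (R : realType).
Implicit Types (f g : R -> R) (r t : R).

Definition pi_integral f : R := (\int[@lebesgue_measure R]_(t in `[0, pi]) f t)%R.

Lemma continuous_pi_integrable f : continuous f ->
  (@lebesgue_measure R).-integrable `[0, pi] (EFin \o f).
Proof.
move=> cf; apply: continuous_compact_integrable; first exact: segment_compact.
exact: continuous_subspaceT.
Qed.

Lemma pi_integralD f g : continuous f -> continuous g ->
  pi_integral (fun t => f t + g t) = pi_integral f + pi_integral g.
Proof. by move=> cf cg; apply: RintegralD => //; exact: continuous_pi_integrable. Qed.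

Lemma pi_integralB f g : continuous f -> continuous g ->
  pi_integral (fun t => f t - g t) = pi_integral f - pi_integral g.
Proof. by move=> cf cg; apply: RintegralB => //; exact: continuous_pi_integrable. Qed.

Lemma pi_integralZ (k : R) f : continuous f ->
  pi_integral (fun t => k * f t) = k * pi_integral f.
Proof. by move=> cf; apply: RintegralZl => //; exact: continuous_pi_integrable. Qed.

Lemma le_pi_integral f g : continuous f -> continuous g ->
  (forall t, 0 <= t <= pi -> f t <= g t) -> pi_integral f <= pi_integral g.
Proof.
move=> cf cg fg; apply: le_Rintegral => //; do ?exact: continuous_pi_integrable.
Qed.

Lemma le_norm_pi_integral f g : continuous f -> continuous g ->
  (forall t, 0 <= t <= pi -> `|f t| <= g t) -> `|pi_integral f| <= pi_integral g.
Proof.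
move=> cf cg fg; rewrite ler_norml; apply/andP; split.
  rewrite -[pi_integral g]mul1r -mulNr -pi_integralZ//; apply: le_pi_integral => //.
    by move=> t; apply: cvgM; [exact: cvg_cst|exact: cg].
  by move=> t /fg; rewrite ler_norml mulN1r => /andP[].
by apply: le_pi_integral => // t /fg; rewrite ler_norml => /andP[].
Qed.

Lemma eq_pi_integral f g : (forall t, f t = g t) -> pi_integral f = pi_integral g.
Proof. by move=> fg; apply: eq_Rintegral => t _; exact: fg. Qed.

Lemma pi_integral_derive f F : continuous f ->
  (forall t, is_derive t (1 : R) F (f t)) -> pi_integral f = F pi - F 0.
Proof.
move=> cf dF; have cF t : {for t, continuous F}.
  apply: differentiable_continuous; apply/derivable1_diffP.
  by have dFt := dF t; exact: ex_derive.
have := @continuous_FTC2 R f F 0 pi (pi_gt0 R).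
rewrite /pi_integral /Rintegral => -> //.
- exact: continuous_subspaceT.
- split.
  + by move=> t _; have dFt := dF t; exact: ex_derive.
  + by apply: cvg_at_right_filter; exact: cF.
  + by apply: cvg_at_left_filter; exact: cF.
- by move=> t _; rewrite derive1E; have dFt := dF t; exact: derive_val.
Qed.

Lemma pi_integral_cst (k : R) : pi_integral (fun=> k) = k * pi.
Proof.
rewrite -[RHS]subr0 -[X in _ - X](mulr0 k).
apply: (@pi_integral_derive (fun=> k) (fun t => k * t)); first by move=> t; exact: cvg_cst.
move=> t; rewrite (_ : (fun _ => _) = k \*: (id : R -> R)); last by apply/funext.
by apply: is_derive_eq; rewrite /GRing.scale/= mulr1.
Qed.

Definition poisson_den r t : R := 1 - 2 * r * cos t + r ^+ 2.
Definition poisson r t : R := (1 - r ^+ 2) / poisson_den r t.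
Definition poisson_slope r t : R :=
  (1 - r ^+ 2) * (2 * r * sin t) / (pi * poisson_den r t ^+ 2).

Lemma poisson_denE r t : poisson_den r t = (r - cos t) ^+ 2 + sin t ^+ 2.
Proof. by rewrite sin2cos2 /poisson_den; ring. Qed.

Lemma poisson_den_gt0 r t : 0 < r -> r < 1 -> 0 < poisson_den r t.
Proof.
move=> r0 r1; apply: (@lt_le_trans _ _ ((1 - r) ^+ 2)).
  by rewrite exprn_gt0// subr_gt0.
rewrite /poisson_den (_ : (1 - r) ^+ 2 = 1 - 2 * r * 1 + r ^+ 2); last by ring.
by rewrite lerD2r lerD2l lerN2 ler_wpM2l ?cos_le1// mulr_ge0// ltW.
Qed.

Lemma is_derive_poisson r t : 0 < r -> r < 1 ->
  is_derive t (1 : R) (poisson r) (- (pi * poisson_slope r t)).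
Proof.
move=> r0 r1; have d0 := poisson_den_gt0 t r0 r1.
have dd : is_derive t (1 : R) (poisson_den r) (2 * r * sin t).
  rewrite (_ : poisson_den r = cst (1 + r ^+ 2) - (2 * r) \*: (@cos R : R -> R)).
    by apply: is_derive_eq; rewrite /GRing.scale/=; ring.
  by apply/funext => y; rewrite /poisson_den !fctE/= /GRing.scale/=; ring.
have d0' : poisson_den r t != 0 by rewrite gt_eqF.
have dV : is_derive t (1 : R) (fun y => (poisson_den r y)^-1)
    (- poisson_den r t ^- 2 * (2 * r * sin t)).
  apply: DeriveDef; first by apply: derivableV => //; exact: ex_derive.
  by rewrite deriveV// derive_val.
rewrite (_ : poisson r = (1 - r ^+ 2) \*: ((fun y => (poisson_den r y)^-1) : R -> R)); last by apply/funext.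
apply: is_derive_eq.
have p0 : pi != 0 :> R by rewrite gt_eqF// pi_gt0.
rewrite /GRing.scale/= /poisson_slope; move: (pi : R) p0 => p p0.
by field; rewrite d0' p0.
Qed.

Section fix_radius.
Context (r : R) (r0 : 0 < r) (r1 : r < 1).

Lemma continuous_poisson : continuous (poisson r).
Proof.
move=> t; apply: differentiable_continuous; apply/derivable1_diffP.
by have dP := is_derive_poisson t r0 r1; exact: ex_derive.
Qed.

Lemma continuous_poisson_den : continuous (poisson_den r).
Proof.
move=> t; apply: cvgD; last exact: cvg_cst.
apply: cvgB; first exact: cvg_cst.
by apply: cvgM; [exact: cvg_cst|exact: continuous_cos].
Qed.

Lemma continuous_poisson_slope : continuous (poisson_slope r).
Proof.
move=> t; apply: cvgM.
  apply: cvgM; first exact: cvg_cst.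
  by apply: cvgM; [exact: cvg_cst|exact: continuous_sin].
apply: cvgV; first by rewrite gt_eqF// mulr_gt0 ?pi_gt0// exprn_gt0// poisson_den_gt0.
apply: cvgM; first exact: cvg_cst.
by apply: (@cvgM _ _ _ _ (poisson_den r) (poisson_den r)); exact: continuous_poisson_den.
Qed.


Definition poisson_moment n : R := pi_integral (fun t => poisson r t * cos (n%:R * t)).

Lemma continuous_cosn (n : nat) : continuous (fun t => cos (n%:R * t) : R).
Proof.
move=> t; apply: (@continuous_comp _ _ _ (fun t => n%:R * t) (@cos R)).
  by apply: cvgM; [exact: cvg_cst|exact: cvg_id].
exact: continuous_cos.
Qed.

Lemma continuous_sinn (n : nat) : continuous (fun t => sin (n%:R * t) : R).
Proof.
move=> t; apply: (@continuous_comp _ _ _ (fun t => n%:R * t) (@sin R)).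
  by apply: cvgM; [exact: cvg_cst|exact: cvg_id].
exact: continuous_sin.
Qed.

Lemma continuous_mul f g : continuous f -> continuous g ->
  continuous (fun t => f t * g t).
Proof. by move=> cf cg t; apply: cvgM; [exact: cf|exact: cg]. Qed.

Lemma continuous_scal (k : R) f : continuous f -> continuous (fun t => k * f t).
Proof. by move=> cf t; apply: cvgM; [exact: cvg_cst|exact: cf]. Qed.

Lemma sin_natpi (n : nat) : sin (n%:R * pi) = 0 :> R.
Proof.
by rewrite mulr_natl; elim: n => [|n IH]; rewrite ?sin0// mulrS sinD IH sinpi mul0r mulr0 addr0.
Qed.

Lemma is_derive_sinn (n : nat) t :
  is_derive t (1 : R) (fun t => sin (n%:R * t)) (n%:R * cos (n%:R * t)).
Proof. by apply: is_derive_eq; rewrite /GRing.scale/=; ring. Qed.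

Lemma pi_integral_cosn (n : nat) : (0 < n)%N ->
  pi_integral (fun t => cos (n%:R * t)) = 0.
Proof.
move=> n0; have n0' : n%:R != 0 :> R by rewrite pnatr_eq0 -lt0n.
apply: (mulfI n0'); rewrite mulr0 -pi_integralZ; last exact: continuous_cosn.
have -> : 0 = sin (n%:R * pi) - sin (n%:R * 0) :> R.
  by rewrite sin_natpi mulr0 sin0 subrr.
apply: (@pi_integral_derive _ (fun t => sin (n%:R * t))).
  by apply: continuous_scal; exact: continuous_cosn.
by move=> t; exact: is_derive_sinn.
Qed.

Lemma continuous_pcos n : continuous (fun t => poisson r t * cos (n%:R * t)).
Proof. by apply: continuous_mul; [exact: continuous_poisson|exact: continuous_cosn]. Qed.

Lemma poisson_moment_rec n : (0 < n)%N ->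
  (1 + r ^+ 2) * poisson_moment n = r * (poisson_moment n.+1 + poisson_moment n.-1).
Proof.
case: n => // n _; apply/eqP; rewrite -subr_eq0 /=; apply/eqP.
have cp k := @continuous_pcos k.
have csum : continuous (fun t => poisson r t * cos (n.+2%:R * t) + poisson r t * cos (n%:R * t)).
  by move=> t; apply: cvgD; exact: cp.
rewrite /poisson_moment -pi_integralD; [|exact: cp..].
rewrite -[X in X - _]pi_integralZ; last exact: cp.
rewrite -[X in _ - X]pi_integralZ//.
rewrite -pi_integralB; [|apply: continuous_scal; exact: cp|exact: continuous_scal].
rewrite -[RHS](mulr0 (1 - r ^+ 2)) -(pi_integral_cosn (ltn0Sn n)) -pi_integralZ; last exact: continuous_cosn.
apply: eq_pi_integral => t.
have cc : cos (n.+2%:R * t) + cos (n%:R * t) = 2 * cos t * cos (n.+1%:R * t).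
  have -> : n.+2%:R * t = n.+1%:R * t + t by rewrite -[n.+2%:R]natr1; ring.
  have -> : n%:R * t = n.+1%:R * t - t by rewrite -[n.+1%:R]natr1; ring.
  by rewrite cosD cosB; ring.
rewrite -mulrDr cc /poisson.
have d0 : poisson_den r t != 0 by rewrite gt_eqF// poisson_den_gt0.
have dE : 1 + r ^+ 2 - 2 * r * cos t = poisson_den r t by rewrite /poisson_den; ring.
transitivity ((1 - r ^+ 2) / poisson_den r t * (1 + r ^+ 2 - 2 * r * cos t) * cos (n.+1%:R * t)).
  by ring.
by rewrite dE divfK.
Qed.

Lemma poisson_moment_rec0 :
  (1 + r ^+ 2) * poisson_moment 0 - 2 * r * poisson_moment 1 = (1 - r ^+ 2) * pi.
Proof.
have cp k := @continuous_pcos k.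
rewrite /poisson_moment -[X in X - _]pi_integralZ; last exact: cp.
rewrite -[X in _ - X]pi_integralZ; last exact: cp.
rewrite -pi_integralB; [|apply: continuous_scal; exact: cp..].
rewrite -pi_integral_cst; apply: eq_pi_integral => t.
have d0 : poisson_den r t != 0 by rewrite gt_eqF// poisson_den_gt0.
have dE : 1 + r ^+ 2 - 2 * r * cos t = poisson_den r t by rewrite /poisson_den; ring.
rewrite mul0r cos0 mul1r /poisson.
transitivity ((1 - r ^+ 2) / poisson_den r t * (1 + r ^+ 2 - 2 * r * cos t)).
  by ring.
by rewrite dE divfK.
Qed.

Lemma poisson_ge0 t : 0 <= poisson r t.
Proof.
by rewrite /poisson divr_ge0 ?(ltW (poisson_den_gt0 t r0 r1))// subr_ge0 exprn_ile1// ltW.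
Qed.

Lemma poisson_moment_le n : `|poisson_moment n| <= poisson_moment 0.
Proof.
apply: le_norm_pi_integral; do ?exact: continuous_pcos.
move=> t _; rewrite mul0r cos0 mulr1 normrM (ger0_norm (poisson_ge0 t)) ler_piMr ?poisson_ge0//.
by rewrite ler_norml cos_le1 cos_geN1.
Qed.

Lemma poisson_momentE n : poisson_moment n = r ^+ n * pi.
Proof.
pose B n := poisson_moment n.+1 - r * poisson_moment n.
have Brec k : r * B k.+1 = B k.
  by have := poisson_moment_rec (ltn0Sn k); rewrite /B/=; lra.
have B0 k : B 0%N = r ^+ k * B k.
  by elim: k => [|k ->]; rewrite ?expr0 ?mul1r// exprSr -mulrA Brec.
have Ble k : `|B k| <= 2 * poisson_moment 0.
  rewrite /B; apply: le_trans (ler_normB _ _) _; rewrite mulr2n mulrDl mul1r.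
  apply: lerD; first exact: poisson_moment_le.
  rewrite normrM (ger0_norm (ltW r0)); apply: le_trans (poisson_moment_le k).
  by rewrite ler_piMl// ltW.
have cv : r ^+ k * (2 * poisson_moment 0) @[k --> \oo] --> (0 : R).
  rewrite -[X in _ --> X](mul0r (2 * poisson_moment 0)); apply: cvgMl.
  by apply: cvg_expr; rewrite ger0_norm// ltW.
have B00 : B 0%N = 0.
  apply/eqP; rewrite -normr_le0; apply: (cvgr_to_ge cv).
  apply: nearW => k; rewrite (B0 k) normrM ger0_norm ?exprn_ge0 ?(ltW r0)//.
  by rewrite ler_wpM2l ?exprn_ge0 ?(ltW r0).
have Bk k : B k = 0.
  by have /esym/eqP := B0 k; rewrite B00 mulf_eq0 expf_eq0 (gt_eqF r0) andbF/= => /eqP.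
have AS k : poisson_moment k.+1 = r * poisson_moment k.
  by have := Bk k; rewrite /B => /eqP; rewrite subr_eq0 => /eqP.
have A0 : poisson_moment 0 = pi.
  have h := poisson_moment_rec0; rewrite AS in h.
  have r2 : 1 - r ^+ 2 != 0 by rewrite gt_eqF// subr_gt0 exprn_ilt1// ltW.
  by apply: (mulfI r2); rewrite -h; ring.
by elim: n => [|n IH]; [rewrite A0 expr0 mul1r|rewrite AS IH exprS mulrA].
Qed.

Lemma poisson_slope_sin n :
  pi_integral (fun t => poisson_slope r t * sin (n%:R * t)) = n%:R * r ^+ n.
Proof.
have cs : continuous (fun t => poisson_slope r t * sin (n%:R * t)).
  by apply: continuous_mul; [exact: continuous_poisson_slope|exact: continuous_sinn].
have cp := @continuous_pcos n.
have p0 : pi != 0 :> R by rewrite gt_eqF// pi_gt0.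
have E : pi_integral (fun t => n%:R * (poisson r t * cos (n%:R * t)) -
    pi * (poisson_slope r t * sin (n%:R * t))) = 0.
  have -> : 0 = poisson r pi * sin (n%:R * pi) - poisson r 0 * sin (n%:R * 0) :> R.
    by rewrite sin_natpi !mulr0 sin0 mulr0 subrr.
  apply: (@pi_integral_derive _ (fun t => poisson r t * sin (n%:R * t))).
    by move=> t; apply: cvgB; [exact: (continuous_scal cp)|exact: (continuous_scal cs)].
  move=> t; have dp := is_derive_poisson t r0 r1; have ds := is_derive_sinn n t.
  rewrite (_ : (fun _ => _) = poisson r * (fun t => sin (n%:R * t))); last by apply/funext.
  by apply: is_derive_eq; rewrite /GRing.scale/=; ring.
have := E; rewrite pi_integralB; [|exact: continuous_scal..].
rewrite !pi_integralZ// -/(poisson_moment n) poisson_momentE => /eqP.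
rewrite subr_eq0 mulrA [pi * _]mulrC => /eqP/(mulIf p0) ->//.
Qed.

Lemma poisson_slope_ge0 t : 0 <= t <= pi -> 0 <= poisson_slope r t.
Proof.
move=> tpi; apply: divr_ge0.
  apply: mulr_ge0; first by rewrite subr_ge0 exprn_ile1// ltW.
  apply: mulr_ge0; first by rewrite mulr_ge0// ltW.
  exact: sin_ge0_pi.
by apply: mulr_ge0; [exact: ltW (pi_gt0 R)|exact: sqr_ge0].
Qed.

Lemma poisson_slope_le (e t : R) : 0 < e -> e < pi -> e <= t -> t <= pi ->
  poisson_slope r t <= (1 - r) * (4 / (pi * sin e ^+ 4)).
Proof.
move=> e0 epi et tpi.
have se0 : 0 < sin e by apply: sin_gt0_pi; rewrite e0.
have ct : cos t <= cos e.
  move: et; rewrite le_eqVlt => /predU1P[->//|et]; apply: ltW.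
  rewrite ltr_cos// in_itv/= ?(ltW e0) ?(ltW epi)//.
  by rewrite (ltW (lt_trans e0 et)).
have dle : sin e ^+ 2 <= poisson_den r t.
  apply: (@le_trans _ _ (poisson_den r e)).
    by rewrite poisson_denE lerDr sqr_ge0.
  by rewrite /poisson_den lerD2r lerD2l lerN2 ler_wpM2l// mulr_ge0// ltW.
have p0 : 0 < pi :> R := pi_gt0 R.
have d2 : sin e ^+ 4 <= poisson_den r t ^+ 2.
  rewrite (_ : sin e ^+ 4 = (sin e ^+ 2) ^+ 2); last by rewrite -exprM.
  by apply: lerXn2r; rewrite ?nnegrE ?sqr_ge0// (le_trans _ dle)// sqr_ge0.
rewrite /poisson_slope [leRHS]mulrA; apply: ler_pM.
- apply: mulr_ge0; first by rewrite subr_ge0 exprn_ile1// ltW.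
  apply: mulr_ge0; first by rewrite mulr_ge0// ltW.
  by apply: sin_ge0_pi; rewrite tpi (le_trans (ltW e0)).
- by rewrite invr_ge0 mulr_ge0 ?sqr_ge0// ltW.
- rewrite (_ : 1 - r ^+ 2 = (1 - r) * (1 + r)); last by ring.
  rewrite -mulrA; apply: ler_wpM2l; first by rewrite subr_ge0 ltW.
  rewrite (_ : 4 = 2 * (2 * 1)); last by ring.
  apply: ler_pM; rewrite ?mulr_ge0 ?addr_ge0 ?(ltW r0)//.
  + by apply: sin_ge0_pi; rewrite tpi (le_trans (ltW e0)).
  + by have := r1; lra.
  + rewrite -mulrA ler_wpM2l// -[leRHS]mulr1; apply: ler_pM; rewrite ?(ltW r0) ?(ltW r1) ?sin_le1//.
    by apply: sin_ge0_pi; rewrite tpi (le_trans (ltW e0)).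
rewrite lef_pV2 ?posrE ?mulr_gt0 ?exprn_gt0 ?poisson_den_gt0//.
by rewrite ler_wpM2l// ltW.
Qed.

End fix_radius.
End poisson_kernel.

(* FILE B6 *)

Section lipschitz_derivable.
Context (R : realType).
Local Notation mu := (@lebesgue_measure R).
Implicit Types (F : R -> R) (x y L : R).

Lemma lipschitz_real_continuous F L : (forall x y, `|F x - F y| <= L * `|x - y|) ->
  continuous F.
Proof.
move=> hF x; apply/cvgrPdist_lt => e e0.
have L0 : 0 < `|L| + 1 by rewrite ltr_wpDl.
near=> y; apply: le_lt_trans (hF _ _) _.
apply: (@le_lt_trans _ _ ((`|L| + 1) * `|x - y|)).
  by apply: ler_wpM2r => //; rewrite ler_wpDr// ler_norm.
rewrite mulrC -ltr_pdivlMr//; near: y.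
by apply: (@cvgr_dist_lt _ _ _ _ _ id) => //; rewrite divr_gt0.
Unshelve. all: by end_near. Qed.

Lemma LS_ocitv (G : cumulative R R) (a b : R) : a <= b ->
  lebesgue_stieltjes_measure G `]a, b]%classic = (G b - G a)%:E.
Proof.
move=> ab; rewrite /lebesgue_stieltjes_measure /measure_extension measurable_mu_extE/=.
  by rewrite wlength_itv_bnd.
exact: is_ocitv.
Qed.

Lemma lipschitz_cumulative F L : (forall x y, `|F x - F y| <= L * `|x - y|) ->
  exists G : cumulative R R, forall x, G x = F x + L * x.
Proof.
move=> hF; pose G x := F x + L * x.
have nd : nondecreasing G.
  move=> x y xy; rewrite /G -subr_ge0 opprD addrACA -mulrBr.
  have := hF x y; rewrite ler_norml => /andP[_].
  by rewrite ler0_norm ?subr_le0// opprB; lra.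
have cG : continuous G.
  move=> x; apply: cvgD; first exact: (lipschitz_real_continuous hF).
  by apply: cvgM; [exact: cvg_cst|exact: cvg_id].
have rc : right_continuous G.
  by move=> x; apply: cvg_at_right_filter; exact: cG.
pose G' : cumulative R R := HB.pack G (isCumulative.Build R _ R G nd rc).
by exists G'.
Qed.

Lemma lipschitz_LS_dominated F L (G : cumulative R R) : 0 < L ->
  (forall x y, `|F x - F y| <= L * `|x - y|) -> (forall x, G x = F x + L * x) ->
  lebesgue_stieltjes_measure G `<< mu.
Proof.
move=> L0 hF GE.
have hN x y : `|- F x - - F y| <= L * `|x - y|.
  by rewrite -opprD normrN; exact: hF.
have [H HE] := lipschitz_cumulative hN.
have V0 : 0 <= (2 * L)^-1 by rewrite invr_ge0 mulr_ge0// ltW.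
pose m := mscale (NngNum V0)
  (measure_add (lebesgue_stieltjes_measure G) (lebesgue_stieltjes_measure H)).
have muE A : measurable A -> mu A = m A.
  apply: lebesgue_measure_unique => X [[a b] _ <-].
  have [ab|ba] := leP a b; last first.
    by rewrite set_itv_ge ?measure0// -leNgt bnd_simp ltW.
  rewrite lebesgue_measure_itv/= lte_fin.
  transitivity ((2 * L)^-1%:E * (lebesgue_stieltjes_measure G `]a, b]%classic +
     lebesgue_stieltjes_measure H `]a, b]%classic))%E; last first.
    by rewrite -measure_addE.
  rewrite !LS_ocitv// !GE !HE -EFinD -EFinM.
  transitivity ((b - a)%:E).
    move: ab; rewrite le_eqVlt => /predU1P[->|ab]; first by rewrite ltxx subrr.
    by rewrite ab EFinB.
  by congr (_%:E); field; rewrite gt_eqF.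
apply/null_content_dominatesP => A mA muA0.
have h : m A = 0%E by rewrite -(muE A mA); exact: muA0.
have : ((2 * L)^-1%:E * (lebesgue_stieltjes_measure G A +
     lebesgue_stieltjes_measure H A) = 0)%E.
  by rewrite -h -measure_addE.
move=> /eqP; rewrite mule_eq0 eqe invr_eq0 mulf_eq0 (gt_eqF L0) orbF pnatr_eq0/=.
by rewrite padde_eq0 ?measure_ge0// => /andP[/eqP].
Qed.

Lemma lipschitz_ae_derivable F L : (forall x y, `|F x - F y| <= L * `|x - y|) ->
  {ae mu, forall x, 0 < x < 1 -> derivable F x (1 : R)}.
Proof.
wlog L0 : L / 0 < L => [wl hF|hF].
  apply: (wl (`|L| + 1)) => [|x y]; first by rewrite ltr_wpDl.
  apply: le_trans (hF x y) _; apply: ler_wpM2r => //.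
  by rewrite ler_wpDr// ler_norm.
have [G GE] := lipschitz_cumulative hF.
have dom := lipschitz_LS_dominated L0 hF GE.
pose D : set (measurableTypeR R) := `]0, 1]%classic.
have mD : measurable D by exact: measurable_itv.
have Doo : (lebesgue_stieltjes_measure G D < +oo)%E by rewrite LS_ocitv// ltry.
pose nu : {finite_measure set (measurableTypeR R) -> \bar R} := mfrestr mD Doo.
have nudom : nu `<< mu.
  apply/null_content_dominatesP => A mA A0; rewrite /nu/= /mfrestr /mrestr.
  move/null_content_dominatesP : dom => /(_ A mA A0) GA0.
  apply/eqP; rewrite eq_le measure_ge0 andbT -GA0; apply: le_measure; rewrite ?inE//.
  exact: measurableI.
have [f [f0 ffin fint nuE]] := radon_nikodym_sigma_finite nudom.
pose h x := fine (f x).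
have hint : mu.-integrable setT (EFin \o h).
  by apply: eq_integrable fint => // x _; rewrite /h/= fineK.
have lh : locally_integrable [set: R] h.
  by apply: open_integrable_locally => //; exact: openT.
have hi (y : R) : mu.-integrable [set` Interval (BRight 0) (BRight y)] (EFin \o h).
  by apply: (integrableS _ _ _ hint) => //; exact: measurable_itv.
have := FTC1 hi lh.
apply: filterS; first exact: (ae_filter_ringOfSetsType mu).
move=> x hx /andP[x0 x1]; have [dx _] := hx x0.
have GI y : 0 < y -> y < 1 -> G y - G 0 = (\int[mu]_(t in `]0, y]) h t)%R.
  move=> y0 y1; rewrite /Rintegral.
  have <- : (nu `]0%R, y]%classic = \int[mu]_(t in [set` Interval (BRight 0%R) (BRight y)]) (h t)%:E)%E.
    rewrite nuE; last exact: measurable_itv.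
    by apply: eq_integral => t _; rewrite /h fineK.
  have -> : nu `]0, y]%classic = (G y - G 0)%:E.
    rewrite /nu/= /mfrestr /mrestr -LS_ocitv ?(ltW y0)//; congr (lebesgue_stieltjes_measure _ _).
    apply/seteqP; split => t /=; rewrite /D/= !in_itv/=; first by case.
    by move=> /andP[-> ty]; split => //; rewrite (le_trans ty)// ltW.
  by [].
have dE : derivable (fun y => (\int[mu]_(t in `]0, y]) h t)%R + (G 0 - L * y)) x (1 : R).
  by apply: derivableD => //; apply: derivableB => //; exact: derivableM.
apply: near_eq_derivable dE.
near=> y; rewrite -GI.
- by rewrite GE; lra.
- by near: y; exact: lt_nbhsr.
- by near: y; exact: lt_nbhsl.
Unshelve. all: by end_near. Qed.

End lipschitz_derivable.

(* FILE B7 *)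

Section fatou_disc.
Context (R : realType).
Implicit Types (r s t x y : R) (q : {poly R[i]}).

Definition dyadic (k : nat) : R := 2^-1 ^+ k.+1.

Lemma dyadic_gt0 k : 0 < dyadic k.
Proof. by rewrite exprn_gt0// invr_gt0. Qed.

Lemma dyadic_le k l : (k <= l)%N -> dyadic l <= dyadic k.
Proof.
move=> kl; apply: ler_wiXn2l; rewrite ?invr_ge0// invf_le1//.
by rewrite ler1n.
Qed.

Lemma dyadic_le_half k : dyadic k <= 2^-1.
Proof. by rewrite -[leRHS]expr1; exact: (@dyadic_le 0). Qed.

Lemma dyadic_cvg : dyadic k @[k --> \oo] --> (0 : R).
Proof.
rewrite /dyadic (cvg_shiftS (fun k => (2^-1 : R) ^+ k)); apply: cvg_expr.
by rewrite ger0_norm ?invr_ge0// invf_lt1// ltr1n.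
Qed.

Lemma dyadic_limit (u : nat -> R) (C : R) :
  (forall k l, (k <= l)%N -> `|u k - u l| <= dyadic k * C) ->
  exists L, forall k, `|u k - L| <= dyadic k * C.
Proof.
move=> hu.
have C0 : 0 <= C.
  have := hu 0%N 0%N (leqnn _); rewrite subrr normr0.
  by rewrite pmulr_rge0// dyadic_gt0.
have hu' k l : u k - dyadic k * C <= u l + dyadic l * C.
  have [kl|/ltnW lk] := leqP k l.
    have := hu _ _ kl; rewrite ler_distl => /andP[_ h].
    have : 0 <= dyadic l * C by rewrite mulr_ge0// ltW// dyadic_gt0.
    by lra.
  have := hu _ _ lk; rewrite ler_distl => /andP[h _].
  have : 0 <= dyadic k * C by rewrite mulr_ge0// ltW// dyadic_gt0.
  by lra.
pose A := [set u k - dyadic k * C | k in [set: nat]].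
have ubA l : ubound A (u l + dyadic l * C) by move=> _ [k _ <-]; exact: hu'.
have A0 : A !=set0 by exists (u 0%N - dyadic 0 * C); exists 0%N.
exists (sup A) => k; rewrite distrC ler_distl; apply/andP; split.
  by apply: ub_le_sup; [exists (u 0%N + dyadic 0 * C); exact: ubA|exists k].
by apply: ge_sup => //; exact: ubA.
Qed.

Lemma pi_integral_slope_sum r (c : nat -> R) N : 0 < r -> r < 1 ->
  continuous (fun t => poisson_slope r t * \sum_(1 <= n < N) c n * sin (n%:R * t)) /\
  pi_integral (fun t => poisson_slope r t * \sum_(1 <= n < N) c n * sin (n%:R * t)) =
  \sum_(1 <= n < N) c n * (n%:R * r ^+ n).
Proof.
move=> r0 r1; have cs := continuous_poisson_slope r0 r1.
elim: N => [|N [IHc IH]].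
  rewrite big_geq//; split.
    rewrite (_ : (fun _ => _) = fun=> 0); first by move=> t; exact: cvg_cst.
    by apply/funext => t; rewrite big_geq// mulr0.
  rewrite -[RHS](mul0r pi) -pi_integral_cst; apply: eq_pi_integral => t.
  by rewrite big_geq// mulr0.
have [N1|N1] := posnP N.
  subst N; rewrite big_geq//; split.
    rewrite (_ : (fun _ => _) = fun=> 0); first by move=> t; exact: cvg_cst.
    by apply/funext => t; rewrite big_geq// mulr0.
  rewrite -[RHS](mul0r pi) -pi_integral_cst; apply: eq_pi_integral => t.
  by rewrite big_geq// mulr0.
have cN : continuous (fun t => c N * (poisson_slope r t * sin (N%:R * t))).
  by apply: continuous_scal; apply: continuous_mul => //; exact: continuous_sinn.
have E : (fun t => poisson_slope r t * \sum_(1 <= n < N.+1) c n * sin (n%:R * t)) =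
    fun t => poisson_slope r t * \sum_(1 <= n < N) c n * sin (n%:R * t) +
      c N * (poisson_slope r t * sin (N%:R * t)).
  by apply/funext => t; rewrite big_nat_recr//= mulrDr; ring.
rewrite E big_nat_recr//=; split.
  by move=> t; apply: cvgD; [exact: IHc|exact: cN].
rewrite pi_integralD// IH pi_integralZ ?poisson_slope_sin//.
by apply: continuous_mul => //; exact: continuous_sinn.
Qed.

Definition sym_diff (F : R -> R) x t : R := (F (x + t) - F (x - t)) / 2.

Lemma sym_diff_angular q x t : sym_diff (angular_primitive q 1) x t =
  \sum_(1 <= n < size q) (Re (q`_n * expi (n%:R * x)) / n%:R) * sin (n%:R * t).
Proof.
rewrite /sym_diff /angular_primitive -sumrB mulr_suml; apply: eq_big_nat => n /andP[n0 _].
have E (a : R[i]) : Im (a * expi (n%:R * (x + t))) - Im (a * expi (n%:R * (x - t))) =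
    2 * (Re (a * expi (n%:R * x)) * sin (n%:R * t)).
  case: a => u v; rewrite /= mulrDr mulrBr cosD sinD cosB sinB.
  by ring.
rewrite !expr1n !mul1r -mulrBl E; field.
by rewrite pnatr_eq0 -lt0n.
Qed.

Lemma pi_integral_angular q r x : 0 < r -> r < 1 ->
  continuous (fun t => poisson_slope r t * sym_diff (angular_primitive q 1) x t) /\
  pi_integral (fun t => poisson_slope r t * sym_diff (angular_primitive q 1) x t) =
  Re (q.[r%:C%C * expi x] - q`_0).
Proof.
move=> r0 r1.
have [h1 h2] := pi_integral_slope_sum (fun n => Re (q`_n * expi (n%:R * x)) / n%:R) (size q) r0 r1.
have E : (fun t => poisson_slope r t * sym_diff (angular_primitive q 1) x t) =
  (fun t => poisson_slope r t *
   \sum_(1 <= n < size q) (Re (q`_n * expi (n%:R * x)) / n%:R) * sin (n%:R * t)).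
  by apply/funext => t; rewrite sym_diff_angular.
rewrite E; split => //; rewrite h2 Re_horner_polar; apply: eq_big_nat => n /andP[n0 _].
by field; rewrite pnatr_eq0 -lt0n.
Qed.

Lemma derive_linear_approx (f : R -> R) x c : is_derive x (1 : R) f c ->
  forall e, 0 < e -> exists2 dl, 0 < dl &
    forall h, `|h| < dl -> `|f (x + h) - f x - c * h| <= e * `|h|.
Proof.
move=> [df dc] e e0.
have hc : h^-1 *: ((f \o shift x) (h *: 1) - f x) @[h --> (0 : R)^'] --> c.
  by rewrite -dc; exact: df.
have /cvgrPdist_le/(_ _ e0) := hc.
rewrite /dnbhs near_withinE => /nbhs_ballP[dl /= dl0 hdl].
exists dl => // h hh; have [->|h0] := eqVneq h 0.
  by rewrite addr0 mulr0 !subr0 subrr normr0 mulr0.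
have := hdl h; rewrite /ball/= sub0r normrN => /(_ hh h0).
rewrite /GRing.scale/= mulr1 [h + x]addrC => hle.
have hn : 0 < `|h| by rewrite normr_gt0.
rewrite -ler_pdivrMr// -normfV -normrM mulrBl mulfK// distrC.
by rewrite [_ / h]mulrC.
Qed.

Lemma lipschitz_sym_diff F (L : R) x t : (forall x y, `|F x - F y| <= L * `|x - y|) ->
  0 <= t -> `|sym_diff F x t| <= L * t.
Proof.
move=> hF t0; rewrite /sym_diff normrM (ger0_norm (x := 2^-1)) ?invr_ge0//.
rewrite ler_pdivrMr//; apply: le_trans (hF _ _) _.
rewrite (_ : x + t - (x - t) = 2 * t); last by ring.
by rewrite ger0_norm ?mulr_ge0// -mulrA [t * 2]mulrC.
Qed.

Lemma continuous_sym_diff F x : continuous F -> continuous (sym_diff F x).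
Proof.
move=> cF t; apply: cvgM; last exact: cvg_cst.
apply: cvgB.
  apply: (@continuous_comp _ _ _ (fun t => x + t) F); last exact: cF.
  by apply: cvgD; [exact: cvg_cst|exact: cvg_id].
apply: (@continuous_comp _ _ _ (fun t => x - t) F); last exact: cF.
by apply: cvgB; [exact: cvg_cst|exact: cvg_id].
Qed.

Lemma sym_diff_asymp F x : derivable F x (1 : R) -> exists c, forall e, 0 < e ->
  exists2 dl, 0 < dl & forall t, 0 <= t < dl -> `|sym_diff F x t - c * sin t| <= e * sin t.
Proof.
move=> /derivableP/derive_linear_approx; move: ('D_1 F x) => c hc; exists c => e e0.
have e40 : 0 < e / 4 by rewrite divr_gt0.
have c0 : 0 < 4 * (`|c| + 1) by rewrite mulr_gt0// ltr_wpDl.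
have e10 : 0 < Num.min (2^-1) (e / (4 * (`|c| + 1))).
  by rewrite lt_min; apply/andP; split; [rewrite invr_gt0|exact: divr_gt0].
have [d1 d10 h1] := hc _ e40.
have [d2 d20 h2] := derive_linear_approx (is_derive_sin (0 : R)) e10.
exists (Num.min d1 d2) => [|t /andP[t0]]; first by rewrite lt_min d10.
rewrite lt_min => /andP[td1 td2].
have := h1 t; rewrite (ger0_norm t0) => /(_ td1) a1.
have := h1 (- t); rewrite normrN (ger0_norm t0) => /(_ td1) a2.
have := h2 t; rewrite (ger0_norm t0) => /(_ td2).
rewrite add0r sin0 subr0 cos0 mul1r => a3.
have a4 : `|sin t - t| <= 2^-1 * t.
  by apply: le_trans a3 _; rewrite ler_wpM2r// ge_min lexx.
have a5 : `|c| * `|sin t - t| <= e / 4 * t.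
  apply: (@le_trans _ _ (`|c| * (e / (4 * (`|c| + 1)) * t))).
    apply: ler_wpM2l => //; apply: le_trans a3 _; rewrite ler_wpM2r// ge_min.
    by rewrite lexx orbT.
  rewrite mulrA; apply: ler_wpM2r => //.
  rewrite mulrA ler_pdivrMr// (_ : e / 4 * _ = e * (`|c| + 1)); last by field.
  by rewrite mulrC ler_pM2l// lerDl.
have st : t <= 2 * sin t.
  by move: a4; rewrite ler_distl => /andP[a4 _]; lra.
rewrite (_ : _ - _ = ((F (x + t) - F x - c * t) - (F (x - t) - F x - c * - t)) / 2
    - c * (sin t - t)); last by rewrite /sym_diff; field.
apply: le_trans (ler_normB _ _) _; rewrite !normrM (ger0_norm (x := 2^-1)) ?invr_ge0//.
have a6 := le_trans (ler_normB _ _) (lerD a1 a2).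
by have := e0; nra.
Qed.

Lemma slope_integral_limit F (L : R) x : (forall x y, `|F x - F y| <= L * `|x - y|) ->
  derivable F x (1 : R) -> exists c, forall e, 0 < e ->
  \forall r \near (1 : R)^'-,
    `|pi_integral (fun t => poisson_slope r t * sym_diff F x t) - c| <= e.
Proof.
move=> hF /sym_diff_asymp[c hc]; exists c => e e0.
have e40 : 0 < e / 4 by rewrite divr_gt0.
have [dl' dl'0 hdl'] := hc _ e40.
pose dl := Num.min (dl' / 2) (pi / 2).
have dl0 : 0 < dl by rewrite lt_min !divr_gt0// pi_gt0.
have dlpi : dl < pi by rewrite gt_min orbC ltr_pdivrMr// ltr_pMr ?pi_gt0// ltr1n.
have dldl' : dl < dl' by rewrite gt_min ltr_pdivrMr// ltr_pMr// ltr1n.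
have L0 : 0 <= L by have := hF 1 0; rewrite subr0 normr1 mulr1; apply: le_trans.
pose K := 4 / (pi * sin dl ^+ 4).
have K0 : 0 <= K.
  by rewrite divr_ge0// mulr_ge0 ?(ltW (pi_gt0 R))// exprn_even_ge0.
pose M := L * pi + `|c|.
have M0 : 0 <= M by rewrite addr_ge0// mulr_ge0// ltW// pi_gt0.
have cH : continuous (sym_diff F x).
  by apply: continuous_sym_diff; exact: lipschitz_real_continuous hF.
have key r : 0 < r -> r < 1 ->
    `|pi_integral (fun t => poisson_slope r t * sym_diff F x t) - c * r| <=
    e / 4 + (1 - r) * (K * M * pi).
  move=> r0 r1; have cs := continuous_poisson_slope r0 r1.
  have I1 : pi_integral (fun t => poisson_slope r t * sin t) = r.
    have := poisson_slope_sin r0 r1 1; rewrite mul1r expr1 => {2}<-.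
    by apply: eq_pi_integral => t; rewrite mul1r.
  have csin : continuous (fun t => poisson_slope r t * sin t).
    by apply: continuous_mul => //; exact: continuous_sin.
  have cQH : continuous (fun t => poisson_slope r t * sym_diff F x t).
    exact: continuous_mul.
  rewrite -[in c * r]I1 -pi_integralZ// -pi_integralB//; last exact: continuous_scal.
  apply: (@le_trans _ _ (pi_integral (fun t => e / 4 * (poisson_slope r t * sin t) + (1 - r) * (K * M)))).
    apply: le_norm_pi_integral.
    - by move=> t; apply: cvgB; [exact: cQH|exact: (continuous_scal csin)].
    - by move=> t; apply: cvgD; [exact: (continuous_scal csin)|exact: cvg_cst].
    move=> t tpi; have Q0 := poisson_slope_ge0 r0 r1 tpi.
    have /andP[t0 tpi'] := tpi.
    have s0 := sin_ge0_pi tpi.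
    rewrite [c * _]mulrCA -mulrBr normrM (ger0_norm Q0).
    have [tdl|dlt] := ltP t dl.
      apply: (@le_trans _ _ (e / 4 * (poisson_slope r t * sin t))); last first.
        by rewrite lerDl; apply: mulr_ge0; [rewrite subr_ge0 ltW|exact: mulr_ge0].
      rewrite mulrCA; apply: ler_wpM2l => //; apply: hdl'.
      by rewrite t0 (lt_trans tdl).
    apply: (@le_trans _ _ ((1 - r) * (K * M))); last first.
      rewrite lerDr; apply: mulr_ge0; first exact: ltW.
      by apply: mulr_ge0 => //; exact: ltW.
    rewrite mulrA; apply: ler_pM => //.
      exact: poisson_slope_le.
    apply: le_trans (ler_normB _ _) _; apply: lerD.
      by apply: le_trans (lipschitz_sym_diff x hF t0) _; rewrite ler_wpM2l.
    by rewrite normrM ler_piMr// sin_max.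
  rewrite pi_integralD; [|exact: continuous_scal|by move=> t; exact: cvg_cst].
  rewrite pi_integralZ// I1 pi_integral_cst; apply: lerD; last by rewrite -!mulrA.
  by rewrite ler_piMr ?(ltW e40)// ltW.
pose B := K * M * pi + `|c| + 1.
have B0 : 0 < B.
  rewrite ltr_wpDl// addr_ge0//; apply: mulr_ge0; last exact/ltW/pi_gt0.
  exact: mulr_ge0.
near=> r.
have r0 : 0 < r by near: r; exact: nbhs_left_gt.
have r1 : r < 1 by near: r; exact: nbhs_left_lt.
have rB : (1 - r) * B <= e / 4.
  rewrite -ler_pdivlMr// lerBlDr -lerBlDl; apply: ltW.
  by near: r; apply: nbhs_left_gt; rewrite gtrBl divr_gt0.
rewrite (_ : _ - c = (pi_integral (fun t => poisson_slope r t * sym_diff F x t) - c * r)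
  - c * (1 - r)); last by ring.
apply: le_trans (ler_normB _ _) _.
have r1' : 0 <= 1 - r by rewrite subr_ge0 ltW.
rewrite [X in _ + X <= _]normrM (ger0_norm r1').
have := key r r0 r1; rewrite /B in rB.
have := e0; move: rB r1'; move: (K * M * pi) `|c| `|_| (1 - r) => k c' I u.
by lra.
Unshelve. all: by end_near. Qed.

End fatou_disc.

(* FILE B8 *)

Section boundary_primitive.
Context (R : realType).
Implicit Types (r s t x y : R).
Local Notation dy := (@dyadic R).

Lemma mean_value_lipschitz (f f' : R -> R) (M : R) :
  (forall x, is_derive x (1 : R) f (f' x)) -> (forall x, `|f' x| <= M) ->
  forall x y, `|f x - f y| <= M * `|x - y|.
Proof.
move=> df f'M x y; have [xy|/ltW yx] := leP x y.
  rewrite distrC [`|x - y|]distrC (ger0_norm (x := y - x)) ?subr_ge0//.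
  by apply: mean_value_bound => // z _.
rewrite (ger0_norm (x := x - y)) ?subr_ge0//.
by apply: mean_value_bound => // z _.
Qed.

Variables (g : R[i] -> R[i]) (q : nat -> {poly R[i]}).
Hypothesis g1 : forall z, normc z < 1 -> normc (g z) < 1.
Hypothesis gq : forall k z, normc z <= 1 ->
  normc (g ((1 - dy k)%:C%C * z) - (q k).[z]) <= dy k.

Let dy1 k : 0 < 1 - dy k < 1.
Proof.
have := dyadic_gt0 R k; have := dyadic_le_half R k.
by move=> h1 h2; apply/andP; split; lra.
Qed.

Lemma normc_dyadic_scale k z : normc z <= 1 -> normc ((1 - dy k)%:C%C * z) < 1.
Proof.
have /andP[a0 a1] := dy1 k.
move=> z1; rewrite Normc.normcM normc_real (ger0_norm (ltW a0)).
by apply: le_lt_trans a1; rewrite ler_piMr// ltW.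
Qed.

Lemma approx_coef0 k : normc (g 0 - (q k)`_0) <= dy k.
Proof.
rewrite -horner_coef0 -{1}(mulr0 (1 - dy k)%:C%C); apply: gq.
by rewrite Normc.normc0.
Qed.

Lemma approx_derivative_le k z : normc z <= 1 -> `|Re ((q k).[z] - (q k)`_0)| <= 4 /\
  `|Im ((q k).[z] - (q k)`_0)| <= 4.
Proof.
move=> z1; have h : normc ((q k).[z] - (q k)`_0) <= 4.
  have h1 := gq k z1; have h2 := approx_coef0 k.
  have h3 := g1 (normc_dyadic_scale k z1).
  have h4 : normc (g 0) < 1 by apply: g1; rewrite Normc.normc0.
  have h5 := dyadic_le_half R k.
  have := ler_normc_sub (g 0) (g ((1 - dy k)%:C%C * z)).
  have E : (q k).[z] - (q k)`_0 = (g 0 - (q k)`_0) - (g ((1 - dy k)%:C%C * z) - (q k).[z])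
     + (g ((1 - dy k)%:C%C * z) - g 0) by ring.
  rewrite E; have t1 := le_normcD ((g 0 - (q k)`_0) - (g ((1 - dy k)%:C%C * z) - (q k).[z])) (g ((1 - dy k)%:C%C * z) - g 0).
  have t2 := le_normcB (g 0 - (q k)`_0) (g ((1 - dy k)%:C%C * z) - (q k).[z]).
  have t3 := le_normcB (g ((1 - dy k)%:C%C * z)) (g 0).
  by move=> _; lra.
by split; apply: le_trans h; [exact: Re_le_normc|exact: Im_le_normc].
Qed.

Lemma normc_scale_expi s x : 0 <= s <= 1 -> normc (s%:C%C * expi x) <= 1.
Proof. by move=> /andP[s0 s1]; rewrite Normc.normcM normc_expi mulr1 normc_real ger0_norm. Qed.

Lemma angular_lipschitz k x y :
  `|angular_primitive (q k) 1 x - angular_primitive (q k) 1 y| <= 4 * `|x - y|.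
Proof.
apply: (mean_value_lipschitz (is_derive_angular (q k) 1)) => {}x.
have z1 : normc (1%:C%C * expi x : R[i]) <= 1 by apply: normc_scale_expi; rewrite ler01 lexx.
by have [] := approx_derivative_le k z1.
Qed.

Lemma radial_lipschitz k s x : 2^-1 <= s <= 1 ->
  `|angular_primitive (q k) 1 x - angular_primitive (q k) s x| <= 8 * (1 - s).
Proof.
move=> /andP[s2 s1]; have s0 : 0 < s by apply: lt_le_trans s2; rewrite invr_gt0.
apply: (mean_value_bound (f := fun r => angular_primitive (q k) r x) s1 (f' := fun r => Im ((q k).[r%:C%C * expi x] - (q k)`_0) / r)).
  by move=> r /andP[sr _]; apply: is_derive_radial; exact: lt_le_trans sr.
move=> r /andP[sr r1]; have r0 : 0 < r := lt_le_trans s0 sr.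
rewrite normrM normfV (ger0_norm (ltW r0)) ler_pdivrMr//.
have z1 : normc (r%:C%C * expi x : R[i]) <= 1 by apply: normc_scale_expi; rewrite (ltW r0).
have [_ h] := approx_derivative_le k z1.
by apply: le_trans h _; lra.
Qed.


Lemma angular_diff_lipschitz k l x y : (k <= l)%N ->
  forall s, s = (1 - dy k) / (1 - dy l) ->
  `|(angular_primitive (q k) 1 x - angular_primitive (q l) s x) -
    (angular_primitive (q k) 1 y - angular_primitive (q l) s y)| <= 4 * dy k * `|x - y|.
Proof.
move=> kl s sE.
have /andP[rk0 rk1] := dy1 k; have /andP[rl0 rl1] := dy1 l.
have dkl := @dyadic_le R _ _ kl.
have s01 : 0 <= s <= 1.
  rewrite sE; apply/andP; split; first by rewrite divr_ge0// ltW.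
  by rewrite ler_pdivrMr// mul1r; lra.
apply: (mean_value_lipschitz
  (f := fun x => angular_primitive (q k) 1 x - angular_primitive (q l) s x)
  (f' := fun x => Re ((q k).[1%:C%C * expi x] - (q k)`_0) -
    Re ((q l).[s%:C%C * expi x] - (q l)`_0))) => {x y} x.
  have d1 := is_derive_angular (q k) 1 x.
  have d2 := is_derive_angular (q l) s x.
  exact: is_deriveB.
rewrite -ReB; apply: le_trans (Re_le_normc _) _.
have z1 : normc (1%:C%C * expi x : R[i]) <= 1 by apply: normc_scale_expi; rewrite ler01 lexx.
have h1 := gq k z1; have h2 := approx_coef0 k.
have h3 := gq l (normc_scale_expi x s01); have h4 := approx_coef0 l.
have E0 : (1 - dy k)%:C%C * (1%:C%C * expi x) = (1 - dy l)%:C%C * (s%:C%C * expi x).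
  by rewrite !mulrA -!rmorphM/= mulr1 sE mulrCA divff ?mulr1// gt_eqF.
rewrite E0 in h1.
set G := g _ in h1 h3.
have -> : (q k).[1%:C%C * expi x] - (q k)`_0 - ((q l).[s%:C%C * expi x] - (q l)`_0) =
  ((G - (q l).[s%:C%C * expi x]) - (G - (q k).[1%:C%C * expi x])) +
  ((g 0 - (q k)`_0) - (g 0 - (q l)`_0)) by ring.
apply: le_trans (le_normcD _ _) _.
have t1 := le_normcB (G - (q l).[s%:C%C * expi x]) (G - (q k).[1%:C%C * expi x]).
have t2 := le_normcB (g 0 - (q k)`_0) (g 0 - (q l)`_0).
by lra.
Qed.

Definition centered_primitive k x : R :=
  angular_primitive (q k) 1 x - angular_primitive (q k) 1 0.

Lemma centered_primitive_cauchy k l x : (k <= l)%N ->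
  `|centered_primitive k x - centered_primitive l x| <= dy k * (4 * `|x| + 32).
Proof.
move=> kl; have h := angular_diff_lipschitz x 0 kl erefl; rewrite subr0 in h.
have /andP[rk0 rk1] := dy1 k; have /andP[rl0 rl1] := dy1 l.
have dkl := @dyadic_le R _ _ kl.
have dk2 := dyadic_le_half R k.
have s01 : 2^-1 <= (1 - dy k) / (1 - dy l) <= 1.
  apply/andP; split.
    by rewrite ler_pdivlMr//; have := dyadic_gt0 R l; lra.
  by rewrite ler_pdivrMr// mul1r; lra.
have h1 := radial_lipschitz l x s01; have h2 := radial_lipschitz l 0 s01.
have h3 : 1 - (1 - dy k) / (1 - dy l) <= 2 * dy k.
  rewrite lerBlDr -lerBlDl ler_pdivlMr//.
  have := dyadic_gt0 R l; have := dyadic_gt0 R k; have := dyadic_le_half R l.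
  by nra.
rewrite /centered_primitive; move: h h1 h2 h3.
move: ((1 - dy k) / (1 - dy l)) => s.
set a := angular_primitive (q k) 1 x; set a' := angular_primitive (q k) 1 0.
set c := angular_primitive (q l) s x; set c' := angular_primitive (q l) s 0.
set e := angular_primitive (q l) 1 x; set e' := angular_primitive (q l) 1 0.
move=> h h1 h2 h3.
have -> : a - a' - (e - e') = (a - c - (a' - c')) - ((e - c) - (e' - c')) by ring.
apply: le_trans (ler_normB _ _) _; have := ler_normB (e - c) (e' - c').
by move=> h4; lra.
Qed.

Lemma boundary_primitive_exists : exists F : R -> R,
  (forall x y, `|F x - F y| <= 4 * `|x - y|) /\
  forall k x, `|centered_primitive k x - F x| <= dy k * (4 * `|x| + 32).
Proof.
have /choice[F hF] x : exists L, forall k, `|centered_primitive k x - L| <= dy k * (4 * `|x| + 32).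
  by apply: dyadic_limit => k l kl; exact: centered_primitive_cauchy.
exists F; split; last by move=> k x; exact: hF.
move=> x y; apply/ler_addgt0Pr => e e0.
have A0 : 0 < 4 * `|x| + 32 + (4 * `|y| + 32).
  by have := normr_ge0 x; have := normr_ge0 y; lra.
have [k hk] : exists k, dy k * (4 * `|x| + 32 + (4 * `|y| + 32)) <= e.
  have /cvgrPdist_le/(_ _ (divr_gt0 e0 A0))[k _ /(_ k (leqnn k))] := @dyadic_cvg R.
  rewrite sub0r normrN (ger0_norm (ltW (dyadic_gt0 _ _))) ler_pdivlMr// => ?.
  by exists k.
have h1 := hF x k; have h2 := hF y k.
have h3 := angular_lipschitz k x y.
have -> : F x - F y = (centered_primitive k x - centered_primitive k y)
  - (centered_primitive k x - F x) + (centered_primitive k y - F y) by ring.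
apply: le_trans (ler_normD _ _) _.
have := ler_normB (centered_primitive k x - centered_primitive k y) (centered_primitive k x - F x).
have -> : centered_primitive k x - centered_primitive k y =
  angular_primitive (q k) 1 x - angular_primitive (q k) 1 y by rewrite /centered_primitive; ring.
by lra.
Qed.

End boundary_primitive.

(* FILE B9 *)

Section fatou_disc_theorem.
Context (R : realType).
Implicit Types (r s t x y : R) (g : R[i] -> R[i]).
Local Notation dy := (@dyadic R).

Definition dyadic_continuous g := forall z : R[i], normc z < 1 -> forall e : R, 0 < e ->
  exists K, forall k, (K <= k)%N -> normc (g ((1 - dy k)%:C%C * z) - g z) <= e.

Lemma le_dyadic_eps (C e : R) : 0 <= C -> 0 < e ->
  exists K, forall k, (K <= k)%N -> dy k * C <= e.
Proof.
move=> C0 e0; have C1 : 0 < C + 1 by rewrite ltr_wpDl.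
have /cvgrPdist_le/(_ _ (divr_gt0 e0 C1))[K _ hK] := @dyadic_cvg R.
exists K => k /hK /=; rewrite sub0r normrN (ger0_norm (ltW (dyadic_gt0 _ _))).
rewrite ler_pdivlMr// => h; apply: le_trans h.
by rewrite ler_wpM2l ?ltW ?dyadic_gt0// ltrDl.
Qed.

Lemma boundary_primitive_poisson g (q : nat -> {poly R[i]}) F r x :
  (forall z, normc z < 1 -> normc (g z) < 1) -> dyadic_continuous g ->
  (forall k z, normc z <= 1 -> normc (g ((1 - dy k)%:C%C * z) - (q k).[z]) <= dy k) ->
  (forall x y, `|F x - F y| <= 4 * `|x - y|) ->
  (forall k x, `|centered_primitive q k x - F x| <= dy k * (4 * `|x| + 32)) ->
  0 < r -> r < 1 ->
  pi_integral (fun t => poisson_slope r t * sym_diff F x t) =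
  Re (g (r%:C%C * expi x) - g 0).
Proof.
move=> g1 gc gq Flip Fq r0 r1.
pose C := 4 * (`|x| + pi) + 32.
have C0 : 0 <= C by have := normr_ge0 x; have := pi_gt0 R; rewrite /C; lra.
have cQ := continuous_poisson_slope r0 r1.
have cF : continuous (fun t => poisson_slope r t * sym_diff F x t).
  by apply: continuous_mul => //; apply: continuous_sym_diff; exact: lipschitz_real_continuous Flip.
have I0 : 0 <= pi_integral (poisson_slope r).
  rewrite -(mul0r pi) -pi_integral_cst; apply: le_pi_integral => //.
    by move=> t; exact: cvg_cst.
  exact: poisson_slope_ge0.
apply/eqP; rewrite -subr_eq0 -normr_le0; apply/ler_addgt0Pr => e e0; rewrite add0r.
have e20 : 0 < e / 2 by rewrite divr_gt0.
have z1 : normc (r%:C%C * expi x) < 1.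
  by rewrite Normc.normcM normc_expi mulr1 normc_real ger0_norm// ltW.
have [K1 hK1] := gc _ z1 _ e20.
have M0 : 0 <= C * pi_integral (poisson_slope r) + 2 by rewrite addr_ge0// mulr_ge0.
have [K2 hK2] := le_dyadic_eps M0 e20.
pose k := maxn K1 K2; have {hK1} h1 := hK1 k (leq_maxl _ _); have {hK2} h2 := hK2 k (leq_maxr _ _).
have [cW IW] := pi_integral_angular (q k) x r0 r1.
have h3 : `|pi_integral (fun t => poisson_slope r t * sym_diff F x t) -
    Re ((q k).[r%:C%C * expi x] - (q k)`_0)| <= dy k * (C * pi_integral (poisson_slope r)).
  rewrite -IW -pi_integralB// mulrA -pi_integralZ//.
  apply: le_norm_pi_integral.
  - by move=> t; apply: cvgB; [exact: cF|exact: cW].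
  - exact: continuous_scal.
  move=> t tpi; have Q0 := poisson_slope_ge0 r0 r1 tpi; have /andP[t0 tpi'] := tpi.
  rewrite -mulrBr normrM (ger0_norm Q0) mulrC; apply: ler_wpM2r => //.
  have a1 := Fq k (x + t); have a2 := Fq k (x - t).
  have -> : sym_diff F x t - sym_diff (angular_primitive (q k) 1) x t =
    - ((centered_primitive q k (x + t) - F (x + t)) - (centered_primitive q k (x - t) - F (x - t))) / 2.
    by rewrite /sym_diff /centered_primitive; field.
  rewrite normrM normrN (ger0_norm (x := 2^-1)) ?invr_ge0// ler_pdivrMr//.
  apply: le_trans (ler_normB _ _) _.
  have b1 : `|x + t| <= `|x| + pi.
    by apply: le_trans (ler_normD _ _) _; rewrite lerD2l ger0_norm.
  have b2 : `|x - t| <= `|x| + pi.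
    by apply: le_trans (ler_normB _ _) _; rewrite lerD2l ger0_norm.
  have d0 := dyadic_gt0 R k.
  have b3 : dy k * (4 * `|x + t| + 32) <= dy k * C by rewrite ler_pM2l// /C; lra.
  have b4 : dy k * (4 * `|x - t| + 32) <= dy k * C by rewrite ler_pM2l// /C; lra.
  by lra.
have z1' := ltW z1; have a1 := gq k _ z1'; have a2 := approx_coef0 gq k.
set G := g (_ * (_ * _)) in a1 h1.
set I := pi_integral _ in h3 *.
set z := r%:C%C * expi x in a1 h1 h3 *.
have -> : I - Re (g z - g 0) = (I - Re ((q k).[z] - (q k)`_0)) +
  Re ((G - g z) - ((G - (q k).[z]) - (g 0 - (q k)`_0))).
  by rewrite !ReB; ring.
apply: le_trans (ler_normD _ _) _.
have b1 := Re_le_normc ((G - g z) - ((G - (q k).[z]) - (g 0 - (q k)`_0))).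
have b2 := le_normcB (G - g z) ((G - (q k).[z]) - (g 0 - (q k)`_0)).
have b3 := le_normcB (G - (q k).[z]) (g 0 - (q k)`_0).
by move: h2; rewrite mulrDr; lra.
Qed.

Lemma dilated_poly_approx (d : nat) g : szego_contractive d g ->
  (forall z, normc z < 1 -> normc (g z) < 1) ->
  exists q : nat -> {poly R[i]}, forall k z, normc z <= 1 ->
    normc (g ((1 - dy k)%:C%C * z) - (q k).[z]) <= dy k.
Proof.
move=> gP g1.
have /choice[q hq] k : exists q : {poly R[i]}, forall z, normc z <= 1 ->
    normc (g ((1 - dy k)%:C%C * z) - q.[z]) <= dy k.
  have dk := dyadic_gt0 R k; have dk2 := dyadic_le_half R k.
  have k0 : 0 < 1 - dy k by lra.
  have k1 : 1 - dy k < 1 by lra.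
  have [p hp] := szego_contractive_poly gP g1 k0 k1 dk.
  exists (p \Po ((1 - dy k)%:C%C *: 'X)) => z z1.
  rewrite horner_comp hornerZ hornerX; apply: hp.
  by rewrite Normc.normcM normc_real (ger0_norm (ltW k0)) ler_piMr// ltW.
by exists q.
Qed.

Lemma fatou_disc_Re (d : nat) g : szego_contractive d g ->
  (forall z, normc z < 1 -> normc (g z) < 1) -> dyadic_continuous g ->
  {ae @lebesgue_measure R, forall x, 0 < x < 1 ->
    cvg (Re (g (r%:C%C * expi x)) @[r --> (1 : R)^'-])}.
Proof.
move=> gP g1 gc.
have [q gq] := dilated_poly_approx gP g1.
have [F [Flip Fq]] := boundary_primitive_exists g1 gq.
apply: filterS (lipschitz_ae_derivable Flip); first exact: (ae_filter_ringOfSetsType (@lebesgue_measure R)).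
move=> x dFx x01.
have [c hc] := slope_integral_limit Flip (dFx x01).
apply: (cvgP (c + Re (g 0))); apply/cvgrPdist_le => e e0.
near=> r.
have r0 : 0 < r by near: r; exact: nbhs_left_gt.
have r1 : r < 1 by near: r; exact: nbhs_left_lt.
rewrite distrC (_ : _ - _ = Re (g (r%:C%C * expi x) - g 0) - c); last by rewrite ReB; ring.
rewrite -(boundary_primitive_poisson x g1 gc gq Flip Fq r0 r1).
by near: r; exact: hc.
Unshelve. all: by end_near. Qed.

Lemma ReNi (z : R[i]) : Re (- 'i%C * z) = Im z.
Proof. by case: z => a b /=; ring. Qed.

Lemma fatou_disc_Im (d : nat) g : szego_contractive d g ->
  (forall z, normc z < 1 -> normc (g z) < 1) -> dyadic_continuous g ->
  {ae @lebesgue_measure R, forall x, 0 < x < 1 ->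
    cvg (Im (g (r%:C%C * expi x)) @[r --> (1 : R)^'-])}.
Proof.
move=> gP g1 gc.
have ni : normc (- 'i%C : R[i]) = 1 by rewrite /= oppr0 sqrrN expr1n expr0n add0r sqrtr1.
have := @fatou_disc_Re d (fun z => - 'i%C * g z).
move=> h; apply: filterS (h _ _ _); first exact: (ae_filter_ringOfSetsType (@lebesgue_measure R)).
- by move=> x hx /hx; under eq_fun do rewrite ReNi.
- move=> I c l l1; have := gP I c l l1; congr (_ <= Re _).
  apply: eq_bigr => i _; apply: eq_bigr => j _; congr (_ * ((1 - _) * _)).
  case: (g (l i)) => a1 a2; case: (g (l j)) => c1 c2.
  by apply/eqP; rewrite eq_complex/=; apply/andP; split; apply/eqP; ring.
- by move=> z z1; rewrite Normc.normcM ni mul1r; exact: g1.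
move=> z z1 e e0; have [K hK] := gc z z1 e e0; exists K => k Kk.
by rewrite -mulrBr Normc.normcM ni mul1r; exact: hK.
Qed.

End fatou_disc_theorem.

(* FILE B10 *)

Lemma nbhs_open (T : topologicalType) (U : set T) : (forall z, U z -> nbhs z U) -> open U.
Proof. by rewrite openE. Qed.

Section complex_topology.
Context (R : realType).

Lemma cvg_normcP (T : Type) (F : set_system T) (FF : Filter F) (f : T -> R[i]) (a : R[i]) :
  f @ F --> a <-> forall e : R, 0 < e -> \forall x \near F, normc (f x - a) <= e.
Proof.
split.
  move=> /(@cvgrPdist_le _ _ _ _ FF) h e e0.
  have := h (e%:C%C); rewrite ltcR => /(_ e0); apply: filterS => x.
  by rewrite normr_normc lecR normcB.
move=> h; apply/(@cvgrPdist_le _ _ _ _ FF) => e e0.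
have eE : e = (Re e)%:C%C by rewrite RRe_real// gtr0_real.
rewrite eE; move: e0; rewrite eE ltcR => /h; apply: filterS => x.
by rewrite normr_normc lecR normcB.
Qed.

Lemma cvg_ReImP (T : Type) (F : set_system T) (FF : ProperFilter F) (f : T -> R[i]) :
  cvg (f @ F) <-> cvg ((fun x => Re (f x)) @ F) /\ cvg ((fun x => Im (f x)) @ F).
Proof.
split.
  move=> /cvg_ex[a fa]; split.
    by apply: (cvgP (Re a)); apply: (continuous_cvg _ (@Re_continuous R a)).
  by apply: (cvgP (Im a)); apply: (continuous_cvg _ (@Im_continuous R a)).
move=> [/cvg_ex[/= u fu] /cvg_ex[/= v fv]]; apply: (cvgP (u +i* v)%C).
apply/cvg_normcP => e e0; have e20 : 0 < e / 2 by rewrite divr_gt0.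
near=> x; apply: le_trans (normc_leD _) _; rewrite ReB ImB/=.
rewrite [leRHS](splitr e); apply: lerD; rewrite distrC; near: x.
  by move/cvgrPdist_le : fu; apply.
by move/cvgrPdist_le : fv; apply.
Unshelve. all: by end_near. Qed.

Context (d : nat).
Local Notation Cd := 'rV[R[i]]_d.
Implicit Types (z w : Cd) (U K : set Cd) (b : Cd -> R[i]).

Lemma enormD z w : enorm (z + w) <= enorm z + enorm w.
Proof.
rewrite -(@ler_pXn2r _ 2) ?nnegrE ?addr_ge0 ?enorm_ge0//.
rewrite -[w]opprK sqr_enormB opprK.
rewrite (_ : (enorm z + enorm w) ^+ 2 = enorm z ^+ 2 + enorm w ^+ 2 + 2 * (enorm z * enorm w)); last by ring.
have -> : enorm (- w) = enorm w.
  by rewrite -scaleN1r enormZ normcN Normc.normc1 mul1r.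
have -> : hdot z (- w) = - hdot z w.
  by rewrite -scaleN1r hdotZr rmorphN1 mulN1r.
have := le_trans (Re_le_normc _) (hdot_le z w); rewrite ler_norml => /andP[_ h].
by have : Re (- hdot z w) = - Re (hdot z w); [case: (hdot z w)|move=> ->; lra].
Qed.

Lemma enormB z w : enorm (z - w) = enorm (w - z).
Proof. by rewrite -opprB -scaleN1r enormZ normcN Normc.normc1 mul1r. Qed.

Lemma enorm_coord_le z (e : R) : (forall i, normc (z ord0 i) <= e) -> enorm z <= d%:R * e.
Proof.
have [d0|d0] := posnP d => h.
  have -> : enorm z = 0; last by rewrite d0 mul0r.
  apply/eqP; rewrite -sqrf_eq0 sqr_enorm; apply/eqP; apply: big1 => -[m mm] _.
  by exfalso; move: mm; rewrite d0.
have e0 : 0 <= e := le_trans (normc_ge0 _) (h (Ordinal d0)).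
rewrite -(@ler_pXn2r _ 2) ?nnegrE ?enorm_ge0 ?mulr_ge0// sqr_enorm.
apply: (@le_trans _ _ (\sum_(i < d) e ^+ 2)).
  by apply: ler_sum => i _; rewrite ler_pXn2r ?nnegrE ?normc_ge0.
rewrite sumr_const card_ord -[leLHS]mulr_natl exprMn; apply: ler_wpM2r; first exact: sqr_ge0.
by rewrite expr2 ler_peMr// ler1n.
Qed.

Lemma nbhs_enormP z U : nbhs z U <->
  exists2 dl : R, 0 < dl & forall w, enorm (w - z) < dl -> U w.
Proof.
split.
  move=> /nbhs_ballP[e /= e0 eU].
  have eE : e = (Re e)%:C%C by rewrite RRe_real// gtr0_real.
  move: e0 eU; rewrite eE ltcR => e0 eU; exists (Re e) => // w hw; apply: eU.
  split; first by rewrite ltcR.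
  move=> j i; rewrite ord1 -ball_normE /ball_ /= normr_normc ltcR.
  by apply: le_lt_trans hw; rewrite normcB; have := normc_coord_le (w - z) i; rewrite !mxE.
move=> [e e0 eU]; apply/nbhs_ballP.
have d0 : 0 < d.+1%:R :> R by rewrite ltr0n.
exists ((e / d.+1%:R)%:C%C) => /=; first by rewrite ltcR divr_gt0.
move=> w [_ hw]; apply: eU.
apply: (@le_lt_trans _ _ (d%:R * (e / d.+1%:R))).
  apply: enorm_coord_le => i; have := hw ord0 i; rewrite -ball_normE /ball_ /=.
  by rewrite normr_normc ltcR normcB !mxE => /ltW.
by rewrite mulrA ltr_pdivrMr// mulrC ltr_pM2l// ltr_nat.
Qed.

Lemma continuous_enorm z (e : R) : 0 < e ->
  exists2 dl : R, 0 < dl & forall w, enorm (w - z) < dl -> `|enorm w - enorm z| < e.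
Proof.
move=> e0; exists e => // w h.
have h1 := enormD (w - z) z; rewrite subrK in h1.
have h2 := enormD (z - w) w; rewrite subrK [enorm (z - w)]enormB in h2.
by rewrite ltr_norml; apply/andP; split; lra.
Qed.

Lemma open_unit_ball : open (@unit_ball R d).
Proof.
rewrite openE => z /= z1; apply/nbhs_enormP; exists (1 - enorm z); first by rewrite subr_gt0.
move=> w h; rewrite /unit_ball/=; have := enormD (w - z) z; rewrite subrK; lra.
Qed.

Lemma closed_far K z : closed K -> ~ K z ->
  exists2 dl : R, 0 < dl & forall w, K w -> dl <= enorm (w - z).
Proof.
move=> cK Kz; have : nbhs z (~` K) by apply: open_nbhs_nbhs; split => //; exact: closed_openC.
move=> /nbhs_enormP[dl dl0 h]; exists dl => // w Kw.
by rewrite leNgt; apply/negP => /h.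
Qed.

Lemma continuous_at_enorm b z : {for z, continuous b} -> forall e : R, 0 < e ->
  exists2 dl : R, 0 < dl & forall w, enorm (w - z) < dl -> normc (b w - b z) <= e.
Proof. by move=> /cvg_normcP h e /h /nbhs_enormP. Qed.

Lemma cmeasurable_open U b : open U -> (forall z, U z -> {for z, continuous b}) ->
  cmeasurable U b.
Proof.
move=> oU cb.
have m (h : R[i] -> R) : continuous h -> measurable_fun U (fun z => h (b z)).
  move=> ch; apply: (measurability _ (RGenOpens.measurableE R)).
  move=> _ [_ [a [c ->]] <-]; apply: open_measurableC.
  apply: nbhs_open => z [Uz hz]; apply: filterI; first by apply: open_nbhs_nbhs.
  apply: (@continuous_comp _ _ _ b h z (cb z Uz) (ch _)).
  by apply: open_nbhs_nbhs; split => //; exact: interval_open.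
by split; [exact: m (@Re_continuous R)|exact: m (@Im_continuous R)].
Qed.

End complex_topology.

(* FILE B11 *)

Section radial_limits.
Context (R : realType) (d : nat).
Local Notation Cd := 'rV[R[i]]_d.
Local Notation B := (@unit_ball R d).
Local Notation S := (@unit_sphere R d).
Implicit Types (z w : Cd) (r s : R).

Variable b : Cd -> R[i].
Hypothesis cb : forall z, B z -> {for z, continuous b}.

Definition ball_part z : R[i] := if enorm z < 1 then b z else 0.

Lemma cmeasurable_ball_part : cmeasurable [set: Cd] ball_part.
Proof.
have [mR mI] := cmeasurable_open (@open_unit_ball R d) cb.
have mB : measurable_fun [set: Cd] (fun z : Cd => enorm z < 1).
  by apply: measurable_fun_ltr => //; exact: measurable_enorm.
have E : [set: Cd] `&` (fun z : Cd => enorm z < 1) @^-1` [set true] = B.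
  by rewrite setTI; apply/seteqP; split => z /=; rewrite /unit_ball/= => h; rewrite h.
have m (h : R[i] -> R) : measurable_fun B (fun z => h (b z)) ->
    measurable_fun [set: Cd] (fun z => h (ball_part z)).
  move=> mh; rewrite (_ : (fun _ => _) = fun z => if enorm z < 1 then h (b z) else h 0).
    by apply: measurable_fun_if => //; rewrite E.
  by apply/funext => z; rewrite /ball_part; case: ifP.
by split; exact: m.
Qed.

Lemma cmeasurable_dilate r : cmeasurable [set: Cd] (fun z => ball_part (r%:C%C *: z)).
Proof.
have [mR mI] := cmeasurable_ball_part; have ms := @measurable_scaleC R d r%:C%C.
by split; [exact: (measurableT_comp mR ms)|exact: (measurableT_comp mI ms)].
Qed.

Definition radial_oscillation z := exists n : nat, forall m : nat, exists p q : rat,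
  [/\ 1 - m.+1%:R^-1 < (ratr p : R) < 1, 1 - m.+1%:R^-1 < (ratr q : R) < 1 &
    n.+1%:R^-1 < normc (ball_part ((ratr p : R)%:C%C *: z) - ball_part ((ratr q : R)%:C%C *: z))].

Lemma measurable_radial_oscillation : measurable [set z | radial_oscillation z].
Proof.
have -> : [set z | radial_oscillation z] = \bigcup_n \bigcap_m \bigcup_(pq in [set: rat * rat])
   (if (1 - m.+1%:R^-1 < (ratr pq.1 : R) < 1) && (1 - m.+1%:R^-1 < (ratr pq.2 : R) < 1) then
     [set z | n.+1%:R^-1 < normc (ball_part ((ratr pq.1 : R)%:C%C *: z) -
        ball_part ((ratr pq.2 : R)%:C%C *: z))] else set0).
  apply/seteqP; split => z /=.
    move=> [n hn]; exists n => // m _; have [p [q [h1 h2 h3]]] := hn m.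
    by exists (p, q) => //=; rewrite h1 h2.
  move=> [n _ hn]; exists n => m; have [[p q] _ /=] := hn m I.
  by case: ifP => // /andP[h1 h2] h3; exists p, q.
apply: bigcupT_measurable => n; apply: bigcapT_measurable => m.
apply: countable_bigcupT_measurable => // -[p q] /=; case: ifP => // _.
pose f z := n.+1%:R^-1 < normc (ball_part ((ratr p : R)%:C%C *: z) - ball_part ((ratr q : R)%:C%C *: z)).
have mf : measurable_fun [set: Cd] f.
  apply: measurable_fun_ltr => //; apply: measurable_normc.
  by apply: cmeasurableB; exact: cmeasurable_dilate.
rewrite (_ : mkset _ = [set: Cd] `&` f @^-1` [set true]); first exact: mf.
by rewrite setTI; apply/seteqP; split.
Qed.

Lemma sphere_le1 z : S z -> enorm z <= 1.
Proof. by move=> ->. Qed.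

Lemma rat_lt_1 (e : R) : 0 < e -> exists p : rat, 1 - e < (ratr p : R) < 1.
Proof.
move=> e0; have /rat_in_itvoo[p] : 1 - e < 1 by rewrite gtrBl.
by rewrite in_itv/=; exists p.
Qed.

Lemma natSinv_lt (e : R) : 0 < e -> exists n : nat, n.+1%:R^-1 < e.
Proof. by move=> e0; have [n _ /(_ n (leqnn n))] := near_infty_natSinv_lt (PosNum e0); exists n. Qed.

Lemma ball_part_dilate r z : 0 <= r -> r < 1 -> enorm z <= 1 ->
  ball_part (r%:C%C *: z) = b (r%:C%C *: z) /\ B (r%:C%C *: z).
Proof.
move=> r0 r1 z1; have h : enorm (r%:C%C *: z) < 1.
  by rewrite enormZr//; apply: le_lt_trans r1; rewrite ler_piMr.
by rewrite /ball_part h.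
Qed.

Lemma radial_cvg_oscillation z : S z -> radial_cvg b z -> ~ radial_oscillation z.
Proof.
move=> Sz /cvg_ex[l /cvg_normcP hl] [n hn].
have n0 : 0 < n.+1%:R^-1 :> R by rewrite invr_gt0.
have /hl : 0 < (n.+1%:R^-1 / 2) :> R by rewrite divr_gt0.
rewrite near_withinE => /nbhs_ballP[e /= e0 he].
have e10 : 0 < Num.min e 1 by rewrite lt_min e0 ltr01.
have [m hm] := natSinv_lt e10.
have [p [q []]] := hn m.
have key s : 1 - m.+1%:R^-1 < s < 1 ->
    normc (ball_part (s%:C%C *: z) - l) <= n.+1%:R^-1 / 2.
  move=> /andP[ms s1]; move: hm; rewrite lt_min => /andP[me m1].
  have s0 : 0 <= s by apply: ltW; apply: lt_trans ms; rewrite subr_gt0.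
  have [-> _] := ball_part_dilate s0 s1 (sphere_le1 Sz).
  by apply: he => //; rewrite /ball/= ger0_norm ?subr_ge0 ?(ltW s1)// ltrBlDr -ltrBlDl (le_lt_trans _ ms)// lerB// ltW.
move=> /key hp /key hq; apply/negP; rewrite -leNgt.
rewrite (_ : _ - _ = (ball_part ((ratr p)%:C%C *: z) - l) - (ball_part ((ratr q)%:C%C *: z) - l)); last by ring.
by apply: le_trans (le_normcB _ _) _; apply: le_trans (lerD hp hq) _; rewrite -splitr.
Qed.

Lemma cvg_radial_of_oscillation z : S z -> ~ radial_oscillation z -> radial_cvg b z.
Proof.
move=> Sz /forallNP osc.
have key (e : R) : 0 < e -> exists a : R[i], \forall r \near (1 : R)^'-, normc (b (r%:C%C *: z) - a) < e.
  move=> e0; have e20 : 0 < e / 2 by rewrite divr_gt0.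
  have [n hn] := natSinv_lt e20; have := osc n => /existsNP[m hm].
  have m1 : m.+1%:R^-1 <= 1 :> R by rewrite invf_le1// ler1n.
  have m0 : 0 < m.+1%:R^-1 :> R by rewrite invr_gt0.
  move: hm m1 m0 hn; move: (m.+1%:R^-1 : R) (n.+1%:R^-1 : R) => c c' hm m1 m0 hn.
  have [p pm] := rat_lt_1 m0; exists (b ((ratr p)%:C%C *: z)).
  near=> r.
  have r1 : r < 1 by near: r; exact: nbhs_left_lt.
  have rm : 1 - c < r by near: r; apply: nbhs_left_gt; rewrite gtrBl.
  have r0 : 0 <= r by lra.
  have [_ Brz] := ball_part_dilate r0 r1 (sphere_le1 Sz).
  have [dl dl0 hdl] := continuous_at_enorm (cb Brz) e20.
  have : Num.max (1 - c) (r - dl) < r by rewrite gt_max rm gtrBl.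
  move=> /rat_in_itvoo[q]; rewrite in_itv/= gt_max -andbA => /and3P[qm qdl qr].
  have q1 := lt_trans qr r1; have q0 : 0 <= (ratr q : R) by lra.
  have := pm => /andP[pm1 p1]; have p0 : 0 <= (ratr p : R) by lra.
  have h1 : normc (b ((ratr q)%:C%C *: z) - b (r%:C%C *: z)) <= e / 2.
    apply: hdl; rewrite -scalerBl -rmorphB/= enormZ Sz mulr1 normc_real distrC ger0_norm; lra.
  have h2 : normc (b ((ratr p)%:C%C *: z) - b ((ratr q)%:C%C *: z)) <= c'.
    rewrite leNgt; apply/negP => h; apply: hm; exists p, q; split => //; first by rewrite qm.
    have [-> _] := ball_part_dilate p0 p1 (sphere_le1 Sz).
    by have [-> _] := ball_part_dilate q0 q1 (sphere_le1 Sz).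
  rewrite normcB (_ : _ - _ = (b ((ratr p)%:C%C *: z) - b ((ratr q)%:C%C *: z)) +
    (b ((ratr q)%:C%C *: z) - b (r%:C%C *: z))); last by ring.
  apply: le_lt_trans (le_normcD _ _) _; lra.
apply/cvg_ReImP; split; apply/cauchy_cvgP/cauchy_exP => e e0; have [a ha] := key e e0.
  exists (Re a); apply: filterS ha => r hr; rewrite /ball/= distrC -ReB.
  exact: le_lt_trans (Re_le_normc _) hr.
exists (Im a); apply: filterS ha => r hr; rewrite /ball/= distrC -ImB.
exact: le_lt_trans (Im_le_normc _) hr.
Unshelve. all: by end_near. Qed.

End radial_limits.

(* FILE B12 *)

Section fatou_sphere.
Context (R : realType) (d : nat) (hd : (0 < d)%N).
Local Notation Cd := 'rV[R[i]]_d.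
Local Notation B := (@unit_ball R d).
Local Notation S := (@unit_sphere R d).
Local Notation sigma := (@sphere_measure R d).
Local Notation leb := (@lebesgue_measure R).
Implicit Types (z w : Cd) (r s : R).

Lemma rotation_average_null (N : set Cd) : measurable N ->
  (forall z, {ae leb, forall x, 0 < x < 1 -> ~ N (expi x *: z)}) -> sigma N = 0%E.
Proof.
move=> mN hN.
pose P : set (measurableTypeR R * Cd) := [set xz | 0 < xz.1 < 1 /\ N (expi xz.1 *: xz.2)].
have mrot : measurable_fun [set: measurableTypeR R * Cd] (fun xz => expi xz.1 *: xz.2).
  have mc : cmeasurable [set: measurableTypeR R * Cd] (fun xz => expi xz.1).
    split.
      apply: (measurableT_comp (f := @cos R)); last exact: measurable_fst.
      by apply: continuous_measurable_fun; exact: continuous_cos.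
    apply: (measurableT_comp (f := @sin R)); last exact: measurable_fst.
    by apply: continuous_measurable_fun; exact: continuous_sin.
  have m i : cmeasurable [set: measurableTypeR R * Cd] (fun xz => expi xz.1 * xz.2 ord0 i).
    by apply: cmeasurableM => //; apply: cmeasurable_coord; exact: measurable_snd.
  apply: measurable_fun_rowC => i; have [m1 m2] := m i.
    by under eq_fun do rewrite mxE.
  by under eq_fun do rewrite mxE.
have mP : measurable P.
  have -> : P = (fst @^-1` `]0, 1[%classic) `&` ((fun xz => expi xz.1 *: xz.2) @^-1` N).
    by apply/seteqP; split => xz /=; rewrite in_itv/=.
  apply: measurableI.
    by rewrite -[X in measurable X]setTI; apply: measurable_fst => //; exact: measurable_itv.
  by rewrite -[X in measurable X]setTI; apply: mrot.
pose f (xz : measurableTypeR R * Cd) : \bar R := (\1_P xz)%:E.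
have mf : measurable_fun [set: measurableTypeR R * Cd] f.
  by apply/measurable_EFinP; exact: measurable_indic.
have f0 xz : (0 <= f xz)%E by rewrite lee_fin.
have := fubini_tonelli (m1 := leb) (m2 := sigma) f mf f0.
have -> : (\int[sigma]_z \int[leb]_x f (x, z) = 0)%E.
  apply: integral0_eq => z _.
  pose Q : set (measurableTypeR R) := (pair^~ z) @^-1` P.
  have mQ : measurable Q.
    rewrite -[X in measurable X]setTI; apply: (measurable_pair2 z) => //.
  have -> : (\int[leb]_x f (x, z) = \int[leb]_x (\1_Q x)%:E)%E by [].
  rewrite integral_indic// setIT; apply: measure_negligible => //.
  have [N' [mN' N'0 hN']] := hN z; exists N'; split => // x [/= x01 Nx].
  by apply: hN' => /= /(_ x01).
have E x : (\int[sigma]_z f (x, z) = sigma N * (\1_(`]0, 1[%classic : set (measurableTypeR R)) x)%:E)%E.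
  have -> : (\int[sigma]_z f (x, z) = \int[sigma]_z (\1_(pair x @^-1` P) z)%:E)%E by [].
  have mQ : measurable (pair x @^-1` P).
    by rewrite -[X in measurable X]setTI; apply: (measurable_pair1 x).
  rewrite integral_indic// setIT.
  rewrite indicE; have [x01|x01] := boolP (x \in _).
    rewrite inE/= in_itv/= in x01; rewrite mule1.
    rewrite -(@sphere_measure_rotate R d (expi x))//; last 2 first.
    - exact: normc_expi.
    - have /andP[x0 x1] := x01; rewrite gt_eqF//= (@lt_trans _ _ 0) ?ltrN10//.
      apply: cos_gt0_pihalf; apply/andP; split.
        by apply: lt_trans x0; rewrite oppr_lt0 divr_gt0// pi_gt0.
      by apply: lt_le_trans x1 _; rewrite ler_pdivlMr// mul1r pi_ge2.
    by congr (sigma _); apply/seteqP; split => z /=; [case|split].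
  rewrite mule0 (_ : _ @^-1` _ = set0) ?measure0//; apply/seteqP; split => z //= [].
  by move: x01; rewrite notin_setE/= in_itv/= => x01 /x01.
under eq_integral do rewrite E.
rewrite ge0_integralZl//; last by apply/measurable_EFinP; apply: measurable_indic; exact: measurable_itv.
rewrite integral_indic//.
have L : leb `]0, 1[%classic = 1%E by rewrite lebesgue_measure_itv/= lte_fin ltr01 -EFinB subr0.
by rewrite setIT => h; apply: etrans h; rewrite -[LHS]mule1; congr (_ * _)%E; exact: esym.
Qed.

Variables (b : Cd -> R[i]) (H : dbr_space b).
Hypothesis b_holomorphic : holomorphic_on B b.
Hypothesis b_disk : forall z, B z -> normc (b z) < 1.

Lemma holomorphic_continuous z : B z -> {for z, continuous b}.
Proof. by move=> /b_holomorphic /differentiable_continuous. Qed.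

Lemma slice_dyadic_continuous z : S z -> dyadic_continuous (fun l => b (l *: z)).
Proof.
move=> Sz l l1 e e0.
have Blz : B (l *: z) by rewrite /unit_ball/= enormZ Sz mulr1.
have [dl dl0 hdl] := continuous_at_enorm (holomorphic_continuous Blz) e0.
have dl20 : 0 < dl / 2 by rewrite divr_gt0.
have [K hK] := le_dyadic_eps (@ler01 R) dl20; exists K => k /hK; rewrite mulr1 => hk.
apply: hdl; rewrite -scalerBl (_ : _ - l = - ((dyadic R k)%:C%C * l)); last by rewrite rmorphB/=; ring.
rewrite enormZ Sz mulr1 normcN Normc.normcM normc_real ger0_norm ?(ltW (dyadic_gt0 _ _))//.
have := dyadic_gt0 R k; have := normc_ge0 l; nra.
Qed.

Theorem fatou_sphere : {ae sigma, forall z, S z -> radial_cvg b z}.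
Proof.
have cb := holomorphic_continuous.
pose N := [set z | radial_oscillation b z] `&` S.
have mN : measurable N.
  by apply: measurableI; [exact: measurable_radial_oscillation|exact: measurable_unit_sphere].
exists N; split => //; last first.
  move=> z /= /not_implyP[Sz nz]; split => //; apply: contrapT => h.
  by apply: nz; exact: cvg_radial_of_oscillation.
apply: rotation_average_null => // z; have [Sz|Sz] := pselect (S z); last first.
  apply: aeW => x _ [_]; rewrite /unit_sphere/= enormZ normc_expi mul1r.
  exact: Sz.
have gP := dbr_slice_contractive H Sz.
have g1 l : normc l < 1 -> normc (b (l *: z)) < 1.
  by move=> l1; apply: b_disk; rewrite /unit_ball/= enormZ Sz mulr1.
have gc := slice_dyadic_continuous Sz.
apply: filterS2 (fatou_disc_Re gP g1 gc) (fatou_disc_Im gP g1 gc).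
  exact: (ae_filter_ringOfSetsType leb).
move=> x hR hI x01 [osc _]; apply: radial_cvg_oscillation osc => //.
  by rewrite /unit_sphere/= enormZ normc_expi mul1r.
rewrite /radial_cvg; apply/cvg_ReImP; split.
  by under eq_fun do rewrite scalerA; exact: hR.
by under eq_fun do rewrite scalerA; exact: hI.
Qed.

End fatou_sphere.

(* FILE C1 *)

Section nonmeasurable_integrands.
Context dT (T : measurableType dT) (R : realType) (m : {measure set T -> \bar R}).
Import HBNNSimple.

Lemma le_integral_null (f g : T -> \bar R) (N : set T) :
  (forall x, (0 <= f x)%E) -> (forall x, (0 <= g x)%E) -> measurable_fun [set: T] g ->
  measurable N -> m N = 0%E -> (forall x, ~ N x -> (f x <= g x)%E) ->
  (\int[m]_x f x <= \int[m]_x g x)%E.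
Proof.
move=> f0 g0 mg mN N0 fg; rewrite ge0_integralTE//.
apply: ge_ereal_sup => _ [h /= hf <-]; rewrite -integralT_nnsfun.
apply: ae_ge0_le_integral => //.
- by move=> x _; rewrite lee_fin.
- by apply/measurable_EFinP; exact: measurable_funP.
exists N; split => // x /= /not_implyP[_ hx]; apply: contrapT => Nx.
by apply: hx; apply: le_trans (hf x) (fg x Nx).
Qed.

End nonmeasurable_integrands.

Section lebesgue_decomposition.
Context dT (T : measurableType dT) (R : realType).
Variables (nu : {measure set T -> \bar R}) (mu : {sigma_finite_measure set T -> \bar R}).
Hypothesis nufin : (nu [set: T] < +oo)%E.

Lemma singular_carrier : exists N, [/\ measurable N, mu N = 0%E &
  forall A, measurable A -> mu A = 0%E -> nu (A `\` N) = 0%E].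
Proof.
have nuT A : measurable A -> (nu A <= nu [set: T])%E by move=> mA; apply: le_measure; rewrite ?inE.
pose X : set (\bar R) := [set nu A | A in [set A | measurable A /\ mu A = 0%E]].
have X0 : X (nu set0) by exists set0.
have Xub x : X x -> (x <= nu [set: T])%E by move=> [A [mA _] <-]; exact: nuT.
have s0 : (0 <= ereal_sup X)%E by apply: le_trans (ereal_sup_ubound X0); exact: measure_ge0.
have sfin : ereal_sup X \is a fin_num.
  rewrite ge0_fin_numE//; apply: le_lt_trans nufin; apply: ge_ereal_sup => x; exact: Xub.
have /choice[A hA] n : exists A, [/\ measurable A, mu A = 0%E &
    (ereal_sup X - (n.+1%:R^-1)%:E < nu A)%E].
  have n0 : 0 < n.+1%:R^-1 :> R by rewrite invr_gt0.
  have [_ [A [mA A0] <-] h] := ub_ereal_sup_adherent n0 sfin.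
  by exists A.
have mA n : measurable (A n) by have [] := hA n.
pose N := \bigcup_n A n.
have mN : measurable N by exact: bigcup_measurable.
have N0 : mu N = 0%E.
  apply: measure_negligible => //; apply: negligible_bigcup => n.
  by apply/negligibleP => //; have [] := hA n.
have sN : nu N = ereal_sup X.
  apply/eqP; rewrite eq_le; apply/andP; split; first by apply: ereal_sup_ubound; exists N.
  apply/lee_addgt0Pr => e e0; have [n hn] := natSinv_lt e0.
  have [_ _ h] := hA n.
  have An : (nu (A n) <= nu N)%E by apply: le_measure; rewrite ?inE//; exact: bigcup_sup.
  rewrite -leeBlDr//; apply: le_trans An; apply: ltW; apply: le_lt_trans h.
  by rewrite leeB// lee_fin ltW.
exists N; split => // B mB B0.
have mD : measurable (B `\` N) by exact: measurableD.
have h : (nu (N `|` (B `\` N)) <= nu N)%E.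
  rewrite [leRHS]sN; apply: ereal_sup_ubound; exists (N `|` (B `\` N)) => //; split.
    exact: measurableU.
  have BN0 : mu (B `\` N) = 0%E.
    by apply: (@subset_measure0 _ _ _ mu _ B) => //; exact: subDsetl.
  apply: measure_negligible; first exact: measurableU.
  by apply: negligibleU; apply/negligibleP.
move: h; rewrite measureU//; last by rewrite setDE setICA setICr setI0.
have Nfin : nu N \is a fin_num by rewrite sN.
rewrite -[X in (_ <= X)%E]adde0 leeD2lE// => h.
by apply/eqP; rewrite eq_le h measure_ge0.
Qed.

Lemma ac_density_exists : exists h, is_ac_density nu mu h.
Proof.
have [N [mN N0 hN]] := singular_carrier.
have mC : measurable (~` N) by exact: measurableC.
have Cfin : (nu (~` N) < +oo)%E.
  by apply: le_lt_trans nufin; apply: le_measure; rewrite ?inE.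
pose nu' : {finite_measure set T -> \bar R} := mfrestr mC Cfin.
have dom : nu' `<< mu.
  apply/null_content_dominatesP => A mA A0; rewrite /nu'/= /mfrestr /mrestr.
  by rewrite -setDE; exact: hN.
have [f [f0 ffin fint nuE]] := radon_nikodym_sigma_finite dom.
have fE : EFin \o (fun x => fine (f x)) = f by apply/funext => x /=; rewrite fineK.
exists (fun x => fine (f x)); split.
- by apply/measurable_EFinP; rewrite fE; exact: measurable_int fint.
- by move=> x; exact: fine_ge0.
- by rewrite fE.
exists (mrestr nu mN).
  by exists N; split => //; rewrite /= /mrestr setIC setICr measure0.
move=> A mA; rewrite (_ : (\int[mu]_(x in A) (fine (f x))%:E)%E = nu' A).
  rewrite /nu'/= /mfrestr /mrestr addeC -measureU; first by rewrite -setIUr setUCr setIT.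
  - exact: measurableI.
  - exact: measurableI.
  by rewrite setIACA setICr setI0.
by rewrite nuE//; apply: eq_integral => x _; rewrite fineK.
Qed.

Lemma ac_densityP : is_ac_density nu mu (ac_density nu mu).
Proof.
rewrite /ac_density; case: pselect => [ex|]; last by case; exact: ac_density_exists.
exact: (svalP (cid ex)).
Qed.

End lebesgue_decomposition.

(* FILE C2 *)

Section boundary_values.
Context (R : realType) (d : nat).
Local Notation Cd := 'rV[R[i]]_d.
Local Notation B := (@unit_ball R d).
Local Notation CB := (@closed_unit_ball R d).
Local Notation S := (@unit_sphere R d).
Implicit Types (z w : Cd) (r s : R).

Variable b : Cd -> R[i].
Hypothesis cb : forall z, B z -> {for z, continuous b}.
Hypothesis b_disk : forall z, B z -> normc (b z) < 1.

Definition radius n : R := 1 - n.+2%:R^-1.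

Lemma radius_ge_half n : 2^-1 <= radius n.
Proof.
have : n.+2%:R^-1 <= 2^-1 :> R by rewrite lef_pV2 ?posrE// ler_nat.
by rewrite /radius; move: (n.+2%:R^-1 : R) => c; lra.
Qed.

Lemma radius_lt1 n : radius n < 1.
Proof. by rewrite gtrBl invr_gt0. Qed.

Lemma radius_ge0 n : 0 <= radius n.
Proof. by apply: le_trans (radius_ge_half n); rewrite invr_ge0. Qed.

Lemma radius_near1 (e : R) : 0 < e -> exists n0, forall n, (n0 <= n)%N -> 1 - radius n <= e.
Proof.
move=> e0; have [n0 h] := natSinv_lt e0; exists n0 => n hn.
rewrite /radius opprB addrCA subrr addr0; apply: le_trans (ltW h).
by rewrite lef_pV2 ?posrE// ler_nat ltnS ltnW.
Qed.

Definition exceptional := [set z | radial_oscillation b z] `&` S.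

Lemma measurable_exceptional : measurable exceptional.
Proof.
by apply: measurableI; [exact: measurable_radial_oscillation|exact: measurable_unit_sphere].
Qed.

Definition regular := CB `\` exceptional.

Lemma measurable_closed_unit_ball : measurable CB.
Proof.
have -> : CB = [set: Cd] `&` (fun z : Cd => enorm z <= 1) @^-1` [set true].
  by rewrite setTI; apply/seteqP; split => z /=.
have mf : measurable_fun [set: Cd] (fun z : Cd => enorm z <= 1).
  by apply: measurable_fun_ler => //; exact: measurable_enorm.
exact: mf.
Qed.

Lemma measurable_regular : measurable regular.
Proof. exact: measurableD measurable_closed_unit_ball measurable_exceptional. Qed.

Definition bvalue z : R[i] := if z \in regular then radial_ext b z else 0.

Definition dilate n z : R[i] := ball_part b ((radius n)%:C%C *: z).

Lemma dilateE n z : CB z -> dilate n z = b ((radius n)%:C%C *: z) /\ B ((radius n)%:C%C *: z).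
Proof. by move=> z1; apply: ball_part_dilate => //; [exact: radius_ge0|exact: radius_lt1]. Qed.

Lemma normc_dilate n z : normc (dilate n z) <= 1.
Proof.
rewrite /dilate /ball_part; case: ifPn => h; last by rewrite Normc.normc0.
by apply/ltW/b_disk.
Qed.

Lemma dilate_cvg z : regular z -> forall e : R, 0 < e ->
  exists n0, forall n, (n0 <= n)%N -> normc (dilate n z - bvalue z) <= e.
Proof.
move=> rz e e0; rewrite /bvalue mem_set// /radial_ext.
have [z1 Nz] := rz; case: ifPn => [z1'|z1'].
  have [dl dl0 hdl] := continuous_at_enorm (cb z1') e0.
  have dl20 : 0 < dl / 2 by rewrite divr_gt0.
  have [n0 h] := radius_near1 dl20; exists n0 => n /h hn.
  have [-> _] := dilateE n z1; apply: hdl.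
  rewrite -[X in _ - X]scale1r -scalerBl -(rmorph1 (real_complex R)) -rmorphB/= enormZ normc_real.
  rewrite distrC ger0_norm ?subr_ge0 ?(ltW (radius_lt1 n))//.
  have := enorm_ge0 z; have := radius_lt1 n; move: z1'; nra.
have Sz : S z.
  by apply/eqP; rewrite eq_le; apply/andP; split; [exact: z1|rewrite leNgt].
have /cvg_normcP/(_ _ e0) : radial_cvg b z.
  apply: cvg_radial_of_oscillation => // osc; apply: Nz; split => //.
rewrite near_withinE => /nbhs_ballP[dl /= dl0 hdl].
have dl20 : 0 < dl / 2 by rewrite divr_gt0.
have [n0 h] := radius_near1 dl20; exists n0 => n /h hn.
have [-> _] := dilateE n z1; apply: hdl; last exact: radius_lt1.
rewrite /ball/= ger0_norm ?subr_ge0 ?(ltW (radius_lt1 n))//.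
by apply: le_lt_trans hn _; rewrite ltr_pdivrMr// ltr_pMr// ltr1n.
Qed.

Lemma normc_bvalue z : normc (bvalue z) <= 1.
Proof.
have [rz|rz] := pselect (regular z); last by rewrite /bvalue memNset// Normc.normc0.
apply/ler_addgt0Pr => e e0; have [n0 /(_ n0 (leqnn _)) h] := dilate_cvg rz e0.
have := ler_normc_sub (bvalue z) (dilate n0 z); rewrite normcB.
have := normc_dilate n0 z; lra.
Qed.

Lemma cmeasurable_dilate_seq n : cmeasurable [set: Cd] (dilate n).
Proof. exact: cmeasurable_dilate. Qed.

Lemma cmeasurable_bvalue : cmeasurable [set: Cd] bvalue.
Proof.
have m (h : R[i] -> R) : (forall x y, `|h x - h y| <= normc (x - y)) ->
    (forall n, measurable_fun [set: Cd] (fun z => h (dilate n z))) ->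
    measurable_fun [set: Cd] (fun z => h (bvalue z)).
  move=> hh mh.
  apply: (measurable_fun_cvg (h := fun n z => if z \in regular then h (dilate n z) else h 0)).
    move=> n; apply: measurable_fun_ifT => //.
    apply: (@measurable_fun_bool _ _ _ _ true); rewrite setTI.
    rewrite (_ : _ @^-1` _ = regular); first exact: measurable_regular.
    by apply/seteqP; split => z /=; [exact: set_mem|exact: mem_set].
  move=> z _; have [rz|rz] := pselect (regular z); last first.
    rewrite /bvalue memNset//; exact: cvg_cst.
  rewrite mem_set//; apply/cvgrPdist_le => e e0.
  have [n0 hn] := dilate_cvg rz e0; exists n0 => // n /= /hn; rewrite normcB.
  exact: le_trans (hh _ _).
split; apply: m; try by move=> n; have [] := cmeasurable_dilate_seq n.
  by move=> x y; rewrite -ReB; exact: Re_le_normc.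
by move=> x y; rewrite -ImB; exact: Im_le_normc.
Qed.

End boundary_values.

(* FILE C3 *)

Section kernel_test.
Context (R : realType) (d : nat).
Local Notation Cd := 'rV[R[i]]_d.
Local Notation B := (@unit_ball R d).
Local Notation CB := (@closed_unit_ball R d).
Local Notation S := (@unit_sphere R d).
Implicit Types (z w : Cd) (r s : R).

Variables (b : Cd -> R[i]) (H : dbr_space b).
Hypothesis b_holomorphic : holomorphic_on B b.
Hypothesis b_disk : forall z, B z -> normc (b z) < 1.
Let cb := holomorphic_continuous b_holomorphic.

Lemma kernel_den_neq0 z w : CB z -> B w -> 1 - hdot z w != 0.
Proof.
move=> z1 w1; rewrite subr_eq0; apply/eqP => h.
have := hdot_le z w; rewrite -h Normc.normc1; apply/negP; rewrite -ltNge.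
apply: le_lt_trans w1; rewrite ler_piMl ?enorm_ge0//.
Qed.

Lemma radial_scale_cvg : (fun r : R => r%:C%C : R[i]) @ (1 : R)^'- --> (1 : R[i]).
Proof.
apply/cvg_normcP => e e0; near=> r.
rewrite (_ : r%:C%C - 1 = (r - 1)%:C%C); last by rewrite rmorphB.
rewrite normc_real distrC; near: r.
by have /cvgrPdist_le/(_ _ e0) : (fun r : R => r) @ (1 : R)^'- --> (1 : R) by exact: cvg_at_left_filter.
Unshelve. all: by end_near. Qed.

Lemma kernel_radial_cvg z w : S z -> B w -> radial_cvg b z ->
  (fun r : R => rkhs_kernel H w (r%:C%C *: z)) @ (1 : R)^'- -->
  ((1 - radial_ext b z * (b w)^*%C) / (1 - hdot z w) ^+ d : R[i]).
Proof.
move=> Sz Bw bz.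
have -> : radial_ext b z = lim (b (r%:C%C *: z) @[r --> (1 : R)^'-]).
  by rewrite /radial_ext Sz ltxx.
have z1 : CB z by rewrite /closed_unit_ball/= Sz.
apply: (@cvg_trans _ ((fun r : R => (1 - b (r%:C%C *: z) * (b w)^*%C) *
    (1 - r%:C%C * hdot z w)^-1 ^+ d) @ (1 : R)^'-)).
  apply: near_eq_cvg; near=> r.
  have r0 : 0 < r by near: r; exact: nbhs_left_gt.
  have r1 : r < 1 by near: r; exact: nbhs_left_lt.
  have Br : B (r%:C%C *: z) by rewrite /unit_ball/= enormZr ?(ltW r0)// Sz mulr1.
  by rewrite /rkhs_kernel asboolT// /dbr_kernel hdotZl exprVn.
rewrite -exprVn; apply: cvgM.
  by apply: cvgB; [exact: cvg_cst|apply: cvgM; [exact: bz|exact: cvg_cst]].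
have h : (fun r : R => (1 - r%:C%C * hdot z w)^-1) @ (1 : R)^'- --> (1 - hdot z w)^-1.
  apply: cvgV; first exact: kernel_den_neq0.
  apply: cvgB; first exact: cvg_cst.
  rewrite -[X in _ --> X]mul1r; apply: cvgM; last exact: cvg_cst.
  exact: radial_scale_cvg.
move: (hdot z w) h => c h; elim: (d) => [|n IH].
  by under eq_fun do rewrite expr0; exact: cvg_cst.
rewrite exprS (_ : (fun r : R => _ ^+ n.+1) = (fun r : R => (1 - r%:C%C * c)^-1 * (1 - r%:C%C * c)^-1 ^+ n)).
  by apply: cvgM; [exact: h|exact: IH].
by apply/funext => r; rewrite exprS.
Unshelve. all: by end_near. Qed.

Lemma radial_ext_kernel z w : CB z -> B w -> (S z -> radial_cvg b z) ->
  radial_ext (rkhs_kernel H w) z = (1 - radial_ext b z * (b w)^*%C) / (1 - hdot z w) ^+ d.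
Proof.
move=> z1 Bw hz; have [Bz|Bz] := ltP (enorm z) 1.
  by rewrite /radial_ext Bz /rkhs_kernel asboolT.
have Sz : S z by apply/eqP; rewrite eq_le Bz andbT; exact: z1.
rewrite {1}/radial_ext Sz ltxx; apply: cvg_lim; first exact: norm_hausdorff.
exact: kernel_radial_cvg (hz Sz).
Qed.

Lemma hdot_self z : hdot z z = (enorm z ^+ 2)%:C%C.
Proof.
rewrite sqr_enorm rmorph_sum/=; apply: eq_bigr => i _; exact: mulc_conj.
Qed.

Lemma kernel_norm w : B w -> rkhs_norm H (rkhs_kernel H w) =
  Num.sqrt ((1 - normc (b w) ^+ 2) / (1 - enorm w ^+ 2) ^+ d).
Proof.
move=> Bw; have Kw := rkhs_kernel_mem H Bw.
rewrite /rkhs_norm -(rkhs_reproducing Kw Bw) /rkhs_kernel asboolT// /dbr_kernel.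
rewrite mulc_conj hdot_self; congr Num.sqrt.
by rewrite -!(rmorph1 (real_complex R)) -!rmorphB -rmorphXn -fmorph_div/=.
Qed.

Definition kernel_ratio z w : R := ((1 - enorm w ^+ 2) / normc (1 - hdot z w) ^+ 2) ^+ d.

Lemma measurable_kernel_ratio : measurable_fun [set: Cd * Cd]
  (fun p => kernel_ratio p.1 p.2).
Proof.
apply: measurable_funX; apply: measurable_funM.
  apply: measurable_funB => //; apply: measurable_funX.
  by apply: (measurableT_comp (f := @enorm R d)); [exact: measurable_enorm|exact: measurable_snd].
have mn : measurable_fun [set: Cd * Cd] (fun p => normc (1 - hdot p.1 p.2) ^+ 2).
  apply: measurable_funX; apply: measurable_normc; apply: cmeasurableB.
    exact: cmeasurable_cst.
  by apply: cmeasurable_hdot; [exact: measurable_fst|exact: measurable_snd].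
rewrite (_ : (fun _ => _) = (fun r : R => r `^ (-1)) \o (fun p => normc (1 - hdot p.1 p.2) ^+ 2)).
  by apply: measurableT_comp => //; exact: measurable_powR.
by apply/funext => p /=; rewrite powR_inv1// sqr_ge0.
Qed.

Lemma kernel_ratio_ge0 z w : B w -> 0 <= kernel_ratio z w.
Proof.
move=> Bw; apply: exprn_ge0; apply: divr_ge0; last exact: sqr_ge0.
by rewrite subr_ge0 exprn_ile1// ?enorm_ge0// ltW.
Qed.


Variable mu : {finite_measure set Cd -> \bar R}.
Hypothesis hmu : mu (~` CB) = 0%E.
Hypothesis b_admissible : admissible mu b.

Lemma exceptional_null : mu (exceptional b) = 0%E.
Proof.
have [N [mN N0 hN]] := b_admissible.
apply: (@subset_measure0 _ _ _ mu _ N) => //; first exact: measurable_exceptional.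
move=> z [osc Sz]; apply: hN => /= h; exact: (radial_cvg_oscillation Sz (h Sz) osc).
Qed.

Lemma kernel_admissible w : B w -> admissible mu (rkhs_kernel H w).
Proof.
move=> Bw; apply: filterS b_admissible => z hz Sz.
exact: (cvgP _ (kernel_radial_cvg Sz Bw (hz Sz))).
Qed.

Definition test_integrand w z : R :=
  normc (1 - bvalue b z * (b w)^*%C) ^+ 2 * kernel_ratio z w.

Lemma measurable_test_integrand w : measurable_fun [set: Cd] (test_integrand w).
Proof.
apply: measurable_funM.
  apply: measurable_funX; apply: measurable_normc; apply: cmeasurableB.
    exact: cmeasurable_cst.
  apply: cmeasurableM; last exact: cmeasurable_cst.
  exact: cmeasurable_bvalue.
exact: (measurableT_comp measurable_kernel_ratio (pair2_measurable w)).
Qed.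

Lemma kernel_L2_le w (Bw : B w) :
  (\int[mu]_z ((normc (radial_ext (rkhs_kernel H w) z)) ^+ 2)%:E <=
   \int[mu]_(z in CB) (test_integrand w z * (1 - enorm w ^+ 2) ^- d)%:E)%E.
Proof.
have mCB := @measurable_closed_unit_ball R d.
have w2 : 0 < 1 - enorm w ^+ 2 by rewrite subr_gt0 exprn_ilt1// ?enorm_ge0.
have t0 z : 0 <= test_integrand w z by rewrite mulr_ge0 ?sqr_ge0// kernel_ratio_ge0.
rewrite [leRHS]integral_mkcond; apply: (@le_integral_null _ _ _ _ _ _ (~` CB `|` exceptional b)).
- by move=> z; rewrite lee_fin sqr_ge0.
- move=> z; rewrite patchE; case: ifP => // _.
  by rewrite lee_fin divr_ge0// exprn_ge0// ltW.
- apply/(measurable_restrictT _ mCB).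
  apply: measurable_funTS; apply/measurable_EFinP; apply: measurable_funM => //.
  exact: measurable_test_integrand.
- apply: measurableU; last exact: measurable_exceptional.
  exact: measurableC.
- apply: measure_negligible.
    apply: measurableU; last exact: measurable_exceptional.
    exact: measurableC.
  apply: negligibleU; apply/negligibleP => //.
  + exact: measurableC.
  + exact: measurable_exceptional.
  + exact: exceptional_null.
move=> z /not_orP[/contrapT z1 Nz]; have rz : regular b z by [].
rewrite patchE mem_set// lee_fin radial_ext_kernel//; last first.
  by move=> Sz; apply: cvg_radial_of_oscillation => // osc; exact: Nz.
have key (c x : R) : 0 < x -> (x / c ^+ 2) ^+ d / x ^+ d = (c ^+ d)^-1 ^+ 2.
  move=> x0; rewrite expr_div_n mulrAC divff ?mul1r ?expf_neq0 ?gt_eqF//.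
  by rewrite exprVn exprAC.
rewrite /test_integrand /kernel_ratio /bvalue mem_set// -[leRHS]mulrA key//.
by rewrite Normc.normcM Normc.normcV normcX exprMn.
Qed.

Lemma reverse_carleson_test (C : R) : 0 < C ->
  (forall f, rkhs_mem H f -> admissible mu f -> ((rkhs_norm H f)%:E <=
     C%:E * 'N[mu]_2%:E[(fun z => (normc (radial_ext f z))%:E)])%E) ->
  forall w, B w -> ((1 - normc (b w) ^+ 2)%:E <=
    (C ^+ 2)%:E * \int[mu]_(z in CB) (test_integrand w z)%:E)%E.
Proof.
move=> C0 hC w Bw; have := hC _ (rkhs_kernel_mem H Bw) (kernel_admissible Bw).
have w2 : 0 < 1 - enorm w ^+ 2 by rewrite subr_gt0 exprn_ilt1// ?enorm_ge0.
have w2d : 0 < (1 - enorm w ^+ 2) ^+ d by rewrite exprn_gt0.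
have bw2 : 0 <= 1 - normc (b w) ^+ 2.
  by rewrite subr_ge0 exprn_ile1// ?normc_ge0//; exact/ltW/b_disk.
have t0 z : 0 <= test_integrand w z by rewrite mulr_ge0 ?sqr_ge0// kernel_ratio_ge0.
rewrite kernel_norm// unlock /Lnorm.
under eq_integral => z _.
  rewrite gee0_abs; last by rewrite lee_fin normc_ge0.
  rewrite poweR_EFin powR_mulrn ?normc_ge0//.
  over.
have := kernel_L2_le Bw; set I := (\int[mu]_z _)%E.
have I0 : (0 <= I)%E by apply: integral_ge0 => z _; rewrite lee_fin sqr_ge0.
have -> : (\int[mu]_(z in CB) (test_integrand w z * (1 - enorm w ^+ 2) ^- d)%:E =
   ((1 - enorm w ^+ 2) ^- d)%:E * \int[mu]_(z in CB) (test_integrand w z)%:E)%E.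
  rewrite -ge0_integralZl//.
  - by apply: eq_integral => z _; rewrite -EFinM mulrC.
  - exact: measurable_closed_unit_ball.
  - by apply: measurable_funTS; apply/measurable_EFinP; exact: measurable_test_integrand.
  - by move=> z _; rewrite lee_fin.
  - by rewrite lee_fin invr_ge0 ltW.
set J := (\int[mu]_(z in CB) _)%E => IJ.
have J0 : (0 <= J)%E by apply: integral_ge0 => z _; rewrite lee_fin.
have [Joo _|Joo] := eqVneq J +oo%E.
  by rewrite Joo gt0_muley ?leey// lte_fin exprn_gt0.
have Jfin : J \is a fin_num by rewrite ge0_fin_numE// lt_neqAle Joo leey.
move: IJ; rewrite -(fineK Jfin) -EFinM => IJ.
have Ifin : I \is a fin_num by rewrite ge0_fin_numE//; apply: le_lt_trans IJ _; rewrite ltry.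
move: IJ I0; rewrite -(fineK Ifin) !lee_fin => IJ I0.
rewrite powR12_sqrt// => h.
have : (1 - normc (b w) ^+ 2) / (1 - enorm w ^+ 2) ^+ d <= C ^+ 2 * fine I.
  rewrite -[leLHS]sqr_sqrtr; last by rewrite divr_ge0// ltW.
  rewrite -[fine I]sqr_sqrtr// -exprMn ler_pXn2r// nnegrE ?sqrtr_ge0//.
  by rewrite mulr_ge0// ?sqrtr_ge0// ltW.
rewrite ler_pdivrMr// => h2; apply: le_trans h2 _.
rewrite -mulrA; apply: ler_wpM2l; first exact: sqr_ge0.
by rewrite -ler_pdivlMr// mulrC.
Qed.

End kernel_test.

(* FILE C4 *)

Section kernel_estimates.
Context (R : realType) (d : nat) (hd : (0 < d)%N).
Local Notation Cd := 'rV[R[i]]_d.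
Local Notation B := (@unit_ball R d).
Local Notation CB := (@closed_unit_ball R d).
Local Notation S := (@unit_sphere R d).
Local Notation sigma := (@sphere_measure R d).
Implicit Types (z w x : Cd) (r s : R).

Definition ratio_mass : R := 2 ^+ d * mass_const R d.

Lemma ratio_mass_gt0 : 0 < ratio_mass.
Proof. by rewrite mulr_gt0 ?exprn_gt0// mass_const_gt0. Qed.

Lemma hdot_dilate r z x : hdot z (r%:C%C *: x) = r%:C%C * hdot z x.
Proof. by rewrite hdotZr; congr (_ * _); apply/eqP; rewrite eq_complex/= oppr0 !eqxx. Qed.

Lemma kernel_ratio_far (dl : R) z x r : CB z -> S x -> 2^-1 <= r -> r < 1 -> 0 < dl ->
  dl <= enorm (x - z) -> kernel_ratio z (r%:C%C *: x) <= ((1 - r ^+ 2) * (16 / dl ^+ 4)) ^+ d.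
Proof.
move=> z1 Sx r2 r1 dl0 far.
have r0 : 0 <= r by apply: le_trans r2; rewrite invr_ge0.
rewrite /kernel_ratio hdot_dilate enormZr// Sx mulr1.
have rr : 0 <= 1 - r ^+ 2 by rewrite subr_ge0 exprn_ile1// ltW.
have h1 : dl ^+ 2 / 4 <= normc (1 - r%:C%C * hdot z x).
  apply: le_trans (le_trans (ler_norm _) (Re_le_normc _)).
  rewrite ReB ReZ/=; have := sqr_enormB x z; rewrite Sx => e1.
  have e2 : Re (hdot x z) = Re (hdot z x) by rewrite hdotC; case: (hdot z x).
  have e3 : dl ^+ 2 <= enorm (x - z) ^+ 2 by rewrite ler_pXn2r// nnegrE ?enorm_ge0// ltW.
  have e4 : enorm z ^+ 2 <= 1 by rewrite exprn_ile1// enorm_ge0.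
  have e5 := sqr_ge0 dl.
  rewrite e1 e2 expr1n in e3; move: e3 e4 e5.
  move: (Re _) (enorm z ^+ 2) (dl ^+ 2) => u v c e3 e4 e5.
  have e6 : c / 2 <= 1 - u by lra.
  by nra.
have d4 : 0 < dl ^+ 2 / 4 by rewrite divr_gt0// exprn_gt0.
have n0 := lt_le_trans d4 h1.
apply: lerXn2r.
- by rewrite nnegrE divr_ge0// sqr_ge0.
- by rewrite nnegrE mulr_ge0// divr_ge0// exprn_ge0// ltW.
apply: ler_wpM2l => //.
rewrite (_ : 16 / dl ^+ 4 = ((dl ^+ 2 / 4) ^+ 2)^-1); last by field; rewrite gt_eqF.
by rewrite lef_pV2 ?posrE ?exprn_gt0// ler_pXn2r// nnegrE ltW.
Qed.

Lemma measurable_ratio_dilate r z :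
  measurable_fun [set: Cd] (fun x => kernel_ratio z (r%:C%C *: x)).
Proof.
apply: (measurableT_comp (@measurable_kernel_ratio R d) (g := fun x => (z, r%:C%C *: x))).
by apply: measurable_fun_pair => //; exact: measurable_scaleC.
Qed.

Lemma kernel_mass z r : CB z -> 0 <= r -> r < 1 ->
  (\int[sigma]_(x in S) (kernel_ratio z (r%:C%C *: x))%:E <= ratio_mass%:E)%E.
Proof.
move=> z1 r0 r1.
have rz : enorm (r%:C%C *: z) <= r by rewrite enormZr// ler_piMr.
have rz1 : enorm (r%:C%C *: z) < 1 := le_lt_trans rz r1.
have h0 : 0 <= 1 - enorm (r%:C%C *: z) by rewrite subr_ge0 ltW.
rewrite /ratio_mass EFinM; apply: (@le_trans _ _ ((2 ^+ d)%:E * \int[sigma]_(x in S)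
   (((1 - enorm (r%:C%C *: z)) / normc (1 - hdot (r%:C%C *: z) x) ^+ 2) ^+ d)%:E)%E); last first.
  by apply: lee_wpmul2l; [rewrite lee_fin exprn_ge0|exact: szego_mass].
have mS := @measurable_unit_sphere R d.
have ms := measurable_szego (r%:C%C *: z).
have s0 x : 0 <= ((1 - enorm (r%:C%C *: z)) / normc (1 - hdot (r%:C%C *: z) x) ^+ 2) ^+ d.
  by rewrite exprn_ge0// divr_ge0// sqr_ge0.
rewrite -ge0_integralZl//; last 2 first.
- by apply: measurable_funTS; apply/measurable_EFinP.
- by move=> x _; rewrite lee_fin.
apply: ge0_le_integral.
- exact: measurable_unit_sphere.
- move=> x Sx; rewrite lee_fin kernel_ratio_ge0// /unit_ball/= enormZr// Sx mulr1//.
- by apply: measurable_funTS; apply/measurable_EFinP; exact: measurable_ratio_dilate.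
- apply: measurable_funTS; apply/measurable_EFinP; apply: measurable_funM => //.
move=> x Sx; rewrite -EFinM lee_fin -exprMn /kernel_ratio hdot_dilate hdotZl enormZr// Sx mulr1.
apply: lerXn2r.
- by rewrite nnegrE divr_ge0 ?sqr_ge0// subr_ge0 exprn_ile1// ltW.
- by rewrite nnegrE mulr_ge0// divr_ge0// sqr_ge0.
rewrite mulrA; apply: ler_wpM2r; first by rewrite invr_ge0 sqr_ge0.
nra.
Qed.

Lemma normc_1B_conj_le (a c : R[i]) : normc a <= 1 ->
  normc (1 - a * c^*%C) <= 2 * (1 - normc a) + normc (a - c).
Proof.
move=> a1; have -> : 1 - a * c^*%C = (1 - normc a ^+ 2)%:C%C + a * (a - c)^*%C.
  by rewrite rmorphB/= rmorphB/= rmorph1 mulrBr mulc_conj; ring.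
apply: le_trans (le_normcD _ _) _.
rewrite normc_real Normc.normcM normc_conj ger0_norm; last first.
  by rewrite subr_ge0 exprn_ile1// normc_ge0.
apply: lerD; last by rewrite ler_piMl// normc_ge0.
by have := normc_ge0 a; nra.
Qed.

End kernel_estimates.

(* FILE C5 *)

Section reverse_fatou.
Context dT (T : measurableType dT) (R : realType) (m : {finite_measure set T -> \bar R}).

Lemma integral_limsup_le (phi : nat -> T -> \bar R) (K : set T) (c M : R) :
  measurable K -> 0 <= c -> 0 <= M ->
  (forall n, measurable_fun [set: T] (phi n)) -> (forall n z, (0 <= phi n z <= M%:E)%E) ->
  (forall z (e : R), 0 < e -> exists N, forall n, (N <= n)%N -> (phi n z <= (c * \1_K z + e)%:E)%E) ->
  forall e : R, 0 < e -> exists N, forall n, (N <= n)%N ->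
    (\int[m]_z phi n z <= c%:E * m K + e%:E)%E.
Proof.
move=> mK c0 M0 mphi phiM hphi e e0.
have phifin n z : phi n z \is a fin_num.
  have /andP[h1 h2] := phiM n z.
  by rewrite ge0_fin_numE//; apply: le_lt_trans h2 _; rewrite ltry.
pose q n z : R := Num.max (fine (phi n z) - c * \1_K z) 0.
have mI : measurable_fun [set: T] (fun z => c * \1_K z : R).
  by apply: measurable_funM => //; exact: measurable_indic.
have mq n : measurable_fun [set: T] (q n).
  apply: measurable_maxr => //; apply: measurable_funB => //.
  apply/measurable_EFinP; rewrite (_ : EFin \o _ = phi n)//.
  by apply/funext => z /=; rewrite fineK.
have q0 n z : 0 <= q n z by rewrite le_max lexx orbT.
have qM n z : q n z <= M.
  have /andP[h1 h2] := phiM n z; rewrite ge_max M0 andbT lerBlDr.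
  rewrite -lee_fin fineK//; apply: le_trans h2 _; rewrite lee_fin lerDl.
  by rewrite mulr_ge0.
have ql z : (fun n => (q n z)%:E) @ \oo --> (cst 0%E : T -> \bar R) z.
  apply/fine_cvgP; split; first exact: nearW.
  apply/cvgrPdist_le => e' e'0; have [N hN] := hphi z e' e'0; exists N => // n /= Nn.
  rewrite sub0r normrN ger0_norm// ge_max (ltW e'0) andbT lerBlDr addrC.
  by have := hN n Nn; rewrite -(fineK (phifin n z)) lee_fin.
have iM : m.-integrable [set: T] (EFin \o cst M).
  exact: finite_measure_integrable_cst.
have mq' n : measurable_fun [set: T] (fun z => (q n z)%:E) by exact/measurable_EFinP.
have qdom : {ae m, forall z n, [set: T] z -> (`|(q n z)%:E| <= (EFin \o cst M) z)%E}.
  by apply: aeW => z n _; rewrite gee0_abs ?lee_fin.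
have qae : {ae m, forall z, [set: T] z -> (fun n => (q n z)%:E) @ \oo --> (cst 0%E : T -> \bar R) z}.
  by apply: aeW => z _; exact: ql.
have [_ _] := dominated_convergence measurableT mq' (measurable_cst _) qae iM qdom.
rewrite integral0 => /fine_cvgP[/= qfin /cvgrPdist_le/(_ _ e0) qe].
have [N _ hN] : \forall n \near \oo, (\int[m]_z (q n z)%:E <= e%:E)%E.
  near=> n.
  have f1 : (\int[m]_z (q n z)%:E)%E \is a fin_num by near: n; exact: qfin.
  have : `|0 - fine (\int[m]_z (q n z)%:E)%E| <= e by near: n; exact: qe.
  rewrite sub0r normrN => h; rewrite -(fineK f1) lee_fin.
  exact: le_trans (ler_norm _) h.
exists N => n /hN /= hn.
apply: (@le_trans _ _ (\int[m]_z ((c * \1_K z)%:E + (q n z)%:E))%E).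
  apply: ge0_le_integral => //.
  - by move=> z _; have /andP[] := phiM n z.
  - by apply: emeasurable_funD => //; exact/measurable_EFinP.
  move=> z _; rewrite -EFinD -(fineK (phifin n z)) lee_fin -lerBlDl.
  by rewrite le_max lexx.
rewrite ge0_integralD//; last 3 first.
- by move=> z _; rewrite lee_fin mulr_ge0.
- exact/measurable_EFinP.
- by move=> z _; rewrite lee_fin.
apply: leeD => //.
under eq_integral do rewrite EFinM.
rewrite ge0_integralZl//; last by apply/measurable_EFinP; exact: measurable_indic.
by rewrite integral_indic// setIT.
Unshelve. all: by end_near. Qed.

End reverse_fatou.

(* FILE C6 *)

Section core.
Context (R : realType) (d : nat) (hd : (0 < d)%N).
Local Notation Cd := 'rV[R[i]]_d.
Local Notation B := (@unit_ball R d).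
Local Notation CB := (@closed_unit_ball R d).
Local Notation S := (@unit_sphere R d).
Local Notation sigma := (@sphere_measure R d).
Local Notation rho := (@radius R).
Local Notation M := (ratio_mass R d).
Implicit Types (z w x : Cd) (r s : R).

Variable b : Cd -> R[i].
Hypothesis cb : forall z, B z -> {for z, continuous b}.
Hypothesis b_disk : forall z, B z -> normc (b z) < 1.
Variable mu : {finite_measure set Cd -> \bar R}.
Variable C : R.
Hypothesis test : forall w, B w -> ((1 - normc (b w) ^+ 2)%:E <=
    (C ^+ 2)%:E * \int[mu]_(z in CB) (test_integrand b w z)%:E)%E.

Local Notation bv := (bvalue b).
Local Notation dil := (dilate b).

Variables (K : set Cd) (tau : R) (n0 : nat).
Hypotheses (cK : closed K) (KS : K `<=` S) (tau0 : 0 < tau).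
Hypothesis Ktau : forall x, K x -> tau / 2 <= 1 - normc (bv x) <= tau.
Hypothesis Kunif : forall n x, (n0 <= n)%N -> K x -> normc (dil n x - bv x) <= tau / 4.

Let mK : measurable K. Proof. exact: closed_measurableC. Qed.

Definition slab n x z : R := \1_K x * (\1_CB z *
  (normc (1 - bv z * (dil n x)^*%C) ^+ 2 * kernel_ratio z ((rho n)%:C%C *: x))).

Let KCB x : K x -> CB x. Proof. by move=> /KS; rewrite /closed_unit_ball/= => ->. Qed.

Let ratio_ge0 n x z : K x -> 0 <= kernel_ratio z ((rho n)%:C%C *: x).
Proof.
by move=> /KCB Kx; apply: kernel_ratio_ge0; have [] := dilateE b n Kx.
Qed.

Lemma slab_ge0 n x z : 0 <= slab n x z.
Proof.
rewrite /slab indicE; have [|] := boolP (x \in K); last by rewrite mul0r.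
rewrite inE => Kx; rewrite mul1r indicE mulr_ge0//.
by rewrite mulr_ge0 ?sqr_ge0 ?ratio_ge0.
Qed.

Lemma measurable_slab n : measurable_fun [set: Cd * Cd] (fun p => slab n p.1 p.2).
Proof.
have mCB := @measurable_closed_unit_ball R d.
have [bR bI] := cmeasurable_bvalue cb.
have [dR dI] := cmeasurable_dilate_seq cb n.
have m1 := @measurable_fst _ _ Cd Cd; have m2 := @measurable_snd _ _ Cd Cd.
apply: measurable_funM.
  exact: (measurableT_comp (measurable_indic mK) m1).
apply: measurable_funM.
  exact: (measurableT_comp (measurable_indic mCB) m2).
apply: measurable_funM.
  apply: measurable_funX; apply: measurable_normc; apply: cmeasurableB.
    exact: cmeasurable_cst.
  apply: cmeasurableM.
    by split; [exact: (measurableT_comp bR m2)|exact: (measurableT_comp bI m2)].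
  apply: cmeasurable_conj.
  by split; [exact: (measurableT_comp dR m1)|exact: (measurableT_comp dI m1)].
apply: (measurableT_comp (@measurable_kernel_ratio R d) (g := fun p : Cd * Cd => (p.2, (rho n)%:C%C *: p.1))).
apply: measurable_fun_pair => //.
exact: (measurableT_comp (@measurable_scaleC R d _) m1).
Qed.

Lemma slab_test n x : (n0 <= n)%N -> K x ->
  ((tau / 4)%:E <= (C ^+ 2)%:E * \int[mu]_z (slab n x z)%:E)%E.
Proof.
move=> nn Kx; have [dE Bx] := dilateE b n (KCB Kx).
have -> : (\int[mu]_z (slab n x z)%:E = \int[mu]_(z in CB) (test_integrand b ((rho n)%:C%C *: x) z)%:E)%E.
  rewrite [RHS]integral_mkcond; apply: eq_integral => z _.
  rewrite /slab patchE indicE mem_set// mul1r indicE; case: (z \in CB); last by rewrite mul0r.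
  by rewrite mul1r dE.
apply: le_trans (test Bx); rewrite lee_fin -dE.
have /andP[t1 _] := Ktau Kx; have h1 := Kunif nn Kx.
have h2 := ler_normc_sub (dil n x) (bv x).
have h3 := normc_ge0 (dil n x).
have h4 : normc (dil n x) <= 1 - tau / 4 by lra.
have h5 : normc (dil n x) <= 1 by have := tau0; lra.
have h6 : normc (dil n x) ^+ 2 <= normc (dil n x) by rewrite expr2 ler_piMl.
by lra.
Qed.

Lemma slab_le n x z : slab n x z <= \1_K x * (4 * kernel_ratio z ((rho n)%:C%C *: x)).
Proof.
rewrite /slab indicE; have [|] := boolP (x \in K); last by rewrite !mul0r.
rewrite inE => Kx; rewrite !mul1r.
have k0 := ratio_ge0 n z Kx.
rewrite indicE; case: (z \in CB); last by rewrite mul0r mulr_ge0.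
rewrite mul1r; apply: ler_wpM2r => //.
rewrite (_ : 4 = 2 ^+ 2); last by rewrite expr2; lra.
rewrite ler_pXn2r ?nnegrE ?normc_ge0//.
apply: le_trans (le_normcB _ _) _; rewrite Normc.normc1 Normc.normcM normc_conj.
rewrite (_ : 2 = 1 + 1); last by lra.
rewrite lerD2l mulr_ile1 ?normc_ge0 ?normc_bvalue ?normc_dilate//.
Qed.

Lemma slab_local z : exists2 dl : R, 0 < dl & forall n x, (n0 <= n)%N ->
  slab n x z <= \1_K x * (9 * tau ^+ 2 * \1_K z * kernel_ratio z ((rho n)%:C%C *: x) +
    4 * ((1 - rho n ^+ 2) * (16 / dl ^+ 4)) ^+ d).
Proof.
have tail (dl : R) n : 0 < dl -> 0 <= 4 * ((1 - rho n ^+ 2) * (16 / dl ^+ 4)) ^+ d.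
  move=> dl0; rewrite mulr_ge0// exprn_ge0// mulr_ge0//.
    by rewrite subr_ge0 exprn_ile1 ?radius_ge0// ltW// radius_lt1.
  by rewrite divr_ge0// exprn_ge0// ltW.
have far (dl : R) n x : 0 < dl -> K x -> CB z -> dl <= enorm (x - z) ->
    slab n x z <= 4 * ((1 - rho n ^+ 2) * (16 / dl ^+ 4)) ^+ d.
  move=> dl0 Kx z1 h; apply: le_trans (slab_le n x z) _.
  rewrite indicE mem_set// mul1r ler_pM2l//.
  apply: kernel_ratio_far => //; [exact: KS|exact: radius_ge_half|exact: radius_lt1].
have [z1|z1] := pselect (CB z); last first.
  exists 1 => // n x nn; rewrite /slab [\1_CB z]indicE memNset// mul0r mulr0.
  rewrite indicE; have [|] := boolP (x \in K); last by rewrite mul0r.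
  rewrite inE => Kx; rewrite mul1r; have k0 := ratio_ge0 n z Kx.
  by apply: addr_ge0; [rewrite !mulr_ge0// ltW|exact: tail].
have [Kz|Kz] := pselect (K z); last first.
  have [dl dl0 hdl] := closed_far cK Kz; exists dl => // n x nn.
  rewrite [\1_K z]indicE memNset// mulr0 mul0r add0r.
  have [Kx|Kx] := pselect (K x); last by rewrite /slab indicE memNset// !mul0r.
  by rewrite indicE mem_set// mul1r; apply: far => //; exact: hdl.
have [_ Bz0] := dilateE b n0 z1.
have tau40 : 0 < tau / 4 by rewrite divr_gt0.
have [dl dl0 hdl] := continuous_at_enorm (cb Bz0) tau40.
exists dl => // n x nn.
have [Kx|Kx] := pselect (K x); last by rewrite /slab indicE memNset// !mul0r.
have k0 := ratio_ge0 n z Kx.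
rewrite [\1_K z]indicE mem_set// [\1_K x]indicE mem_set// mul1r mulr1.
have [near|fr] := ltP (enorm (x - z)) dl; last first.
  apply: le_trans (far dl n x dl0 Kx z1 fr) _; by rewrite lerDr !mulr_ge0// ltW.
rewrite /slab !indicE !mem_set// !mul1r.
apply: (@le_trans _ _ (9 * tau ^+ 2 * kernel_ratio z ((rho n)%:C%C *: x))); last by rewrite lerDl tail.
apply: ler_wpM2r => //.
rewrite (_ : 9 * tau ^+ 2 = (3 * tau) ^+ 2); last by ring.
rewrite ler_pXn2r ?nnegrE ?normc_ge0//; last by rewrite mulr_ge0// ltW.
have bz1 := normc_bvalue cb b_disk z.
apply: le_trans (normc_1B_conj_le _ bz1) _.
have /andP[_ tz] := Ktau Kz.
have u1 := Kunif (leqnn n0) Kz; have u2 := Kunif (leqnn n0) Kx; have u3 := Kunif nn Kx.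
have u4 : normc (dil n0 x - dil n0 z) <= tau / 4.
  have [-> _] := dilateE b n0 (KCB Kx); have [-> _] := dilateE b n0 z1.
  apply: hdl; rewrite -scalerBr enormZr ?radius_ge0//.
  apply: le_lt_trans near; rewrite ler_piMl ?enorm_ge0//; exact/ltW/radius_lt1.
have -> : bv z - dil n x = ((dil n0 x - bv x) - (dil n0 z - bv z)) -
  ((dil n x - bv x) + (dil n0 x - dil n0 z)) by ring.
have v1 := le_normcB ((dil n0 x - bv x) - (dil n0 z - bv z)) ((dil n x - bv x) + (dil n0 x - dil n0 z)).
have v2 := le_normcB (dil n0 x - bv x) (dil n0 z - bv z).
have v3 := le_normcD (dil n x - bv x) (dil n0 x - dil n0 z).
have v4 : 2 * (1 - normc (bv z)) <= 2 * tau by rewrite ler_pM2l.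
by lra.
Qed.


Lemma integral_ratio_le n z (alpha beta : R) : CB z -> 0 <= alpha -> 0 <= beta ->
  (\int[sigma]_x (\1_K x * (alpha * kernel_ratio z ((rho n)%:C%C *: x) + beta))%:E <=
   (alpha * M + beta)%:E)%E.
Proof.
move=> z1 al0 be0; have mS := @measurable_unit_sphere R d.
have mk := @measurable_ratio_dilate R d (rho n) z.
have k0 x : S x -> 0 <= kernel_ratio z ((rho n)%:C%C *: x).
  move=> Sx; apply: kernel_ratio_ge0; rewrite /unit_ball/= enormZr ?radius_ge0// Sx mulr1.
  exact: radius_lt1.
have mk' : measurable_fun [set: Cd] (fun x => alpha * kernel_ratio z ((rho n)%:C%C *: x) + beta).
  by apply: measurable_funD => //; apply: measurable_funM.
apply: (@le_trans _ _ (\int[sigma]_(x in S) (alpha * kernel_ratio z ((rho n)%:C%C *: x) + beta)%:E)%E).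
  rewrite [leRHS]integral_mkcond; apply: ge0_le_integral => //.
  - move=> x _; rewrite lee_fin indicE; have [|] := boolP (x \in K); last by rewrite mul0r.
    by rewrite inE mul1r => /KS Sx; rewrite addr_ge0// mulr_ge0// k0.
  - apply/measurable_EFinP; apply: measurable_funM => //; exact: measurable_indic.
  - apply/(measurable_restrictT _ mS); apply: measurable_funTS; exact/measurable_EFinP.
  move=> x _; rewrite patchE indicE; have [|Kx] := boolP (x \in K).
    by rewrite inE => Kx; rewrite mem_set ?mul1r//; exact: KS.
  rewrite mul0r; case: ifPn => //; rewrite inE => Sx.
  by rewrite lee_fin addr_ge0// mulr_ge0// k0.
under eq_integral do rewrite EFinD EFinM.
rewrite ge0_integralD//; last 2 first.
- by move=> x Sx; rewrite -EFinM lee_fin mulr_ge0// k0.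
- by apply: measurable_funTS; apply/measurable_EFinP; apply: measurable_funM.
rewrite ge0_integralZl//; last by apply: measurable_funTS; apply/measurable_EFinP.
rewrite EFinD EFinM; apply: leeD.
  by apply: lee_wpmul2l => //; apply: kernel_mass => //; [exact: radius_ge0|exact: radius_lt1].
rewrite integral_cst// -[leRHS]mule1; apply: lee_wpmul2l => //.
exact: probability_le1.
Qed.

Lemma ratio_tail_small (D e : R) : 0 <= D -> 0 < e -> exists N, forall n, (N <= n)%N ->
  4 * ((1 - rho n ^+ 2) * D) ^+ d <= e.
Proof.
move=> D0 e0; have D1 : 0 < D + 1 by rewrite ltr_wpDl.
pose e' := Num.min (1 / (2 * (D + 1))) (e / (8 * (D + 1))).
have e'0 : 0 < e' by rewrite lt_min !divr_gt0// mulr_gt0.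
have [N hN] := radius_near1 e'0; exists N => n /hN.
rewrite le_min !ler_pdivlMr ?mulr_gt0// => /andP[h1 h2].
have r0 := radius_ge0 R n; have r1 := radius_lt1 R n.
have h3 : 1 - rho n ^+ 2 <= 2 * (1 - rho n) by nra.
have h4 : 0 <= 1 - rho n ^+ 2 by rewrite subr_ge0 exprn_ile1// ltW.
move: h1 h2 h3 h4; move: (1 - rho n ^+ 2) (1 - rho n) => u v h1 h2 h3 h4.
have uD : u * D <= 1 by nra.
have uD0 : 0 <= u * D by rewrite mulr_ge0.
have h5 : (u * D) ^+ d <= u * D.
  by rewrite -[leRHS]expr1; apply: ler_wiXn2l.
have h6 : 4 * (u * D) <= e by nra.
by apply: le_trans h6; rewrite ler_pM2l.
Qed.

Theorem closed_level_set_bound : ((tau / 4)%:E * sigma K <=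
  (C ^+ 2)%:E * ((9 * tau ^+ 2 * M)%:E * mu K))%E.
Proof.
have M0 := ratio_mass_gt0 R d.
have mF n : measurable_fun [set: Cd * Cd] (fun p => (slab n p.1 p.2)%:E).
  by apply/measurable_EFinP; exact: measurable_slab.
have F0 n (p : Cd * Cd) : (0 <= (slab n p.1 p.2)%:E)%E by rewrite lee_fin slab_ge0.
pose phi n z := (\int[sigma]_x (slab n x z)%:E)%E.
have c00 : 0 <= 9 * tau ^+ 2 by apply: mulr_ge0 => //; exact: sqr_ge0.
have c0 : 0 <= 9 * tau ^+ 2 * M by apply: mulr_ge0 => //; exact: ltW.
have mphi n : measurable_fun [set: Cd] (phi n).
  exact: (measurable_fun_fubini_tonelli_G (m1 := sigma) (fun p => (slab n p.1 p.2)%:E) (mF n) (F0 n)).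
have zero n z : ~ CB z -> phi n z = 0%E.
  move=> z1; apply: integral0_eq => x _.
  by rewrite /slab [\1_CB z]indicE memNset// mul0r mulr0.
have mslab n z : measurable_fun [set: Cd] (fun x => (slab n x z)%:E).
  exact: (measurableT_comp (mF n) (pair2_measurable z)).
have msl' n z (alpha beta : R) : measurable_fun [set: Cd]
   (fun x => (\1_K x * (alpha * kernel_ratio z ((rho n)%:C%C *: x) + beta))%:E).
  apply/measurable_EFinP; apply: measurable_funM; first exact: measurable_indic.
  apply: measurable_funD => //; apply: measurable_funM => //.
  exact: measurable_ratio_dilate.
have bound n z (alpha beta : R) : CB z -> 0 <= alpha -> 0 <= beta ->
    (forall x, slab n x z <= \1_K x * (alpha * kernel_ratio z ((rho n)%:C%C *: x) + beta)) ->
    (phi n z <= (alpha * M + beta)%:E)%E.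
  move=> z1 al be h; apply: le_trans (integral_ratio_le n z1 al be).
  by apply: ge0_le_integral => // x _; rewrite lee_fin// slab_ge0.
have phiM n z : (0 <= phi n z <= (4 * M)%:E)%E.
  apply/andP; split; first by apply: integral_ge0 => x _; rewrite lee_fin slab_ge0.
  have [z1|z1] := pselect (CB z); last by rewrite zero// lee_fin mulr_ge0// ltW.
  rewrite -[4 * M]addr0; apply: bound => // x.
  by rewrite addr0; exact: slab_le.
have local z (e : R) : 0 < e -> exists N, forall n, (N <= n)%N ->
    (phi n z <= (9 * tau ^+ 2 * M * \1_K z + e)%:E)%E.
  move=> e0; have [z1|z1] := pselect (CB z); last first.
    exists 0%N => n _; rewrite zero// lee_fin.
    by apply: addr_ge0; [exact: mulr_ge0|exact: ltW].
  have [dl dl0 hdl] := slab_local z.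
  have D0 : 0 <= 16 / dl ^+ 4 by rewrite divr_ge0// exprn_ge0// ltW.
  have [N hN] := ratio_tail_small D0 e0; exists (maxn N n0) => n.
  rewrite geq_max => /andP[/hN hn nn].
  apply: le_trans (bound n z (9 * tau ^+ 2 * \1_K z) (4 * ((1 - rho n ^+ 2) * (16 / dl ^+ 4)) ^+ d) z1 _ _ _) _.
  - exact: mulr_ge0.
  - apply: mulr_ge0 => //; apply: exprn_ge0; apply: mulr_ge0 => //.
    by rewrite subr_ge0 exprn_ile1 ?radius_ge0// ltW// radius_lt1.
  - by move=> x; exact: hdl.
  by rewrite lee_fin lerD// mulrAC.
have main n : (n0 <= n)%N -> ((tau / 4)%:E * sigma K <= (C ^+ 2)%:E * \int[mu]_z phi n z)%E.
  move=> nn.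
  have <- := fubini_tonelli (m1 := sigma) (m2 := mu) (fun p => (slab n p.1 p.2)%:E) (mF n) (F0 n).
  have mG : measurable_fun [set: Cd] (fun x => \int[mu]_z (slab n x z)%:E)%E.
    exact: (measurable_fun_fubini_tonelli_F (m2 := mu) (fun p => (slab n p.1 p.2)%:E) (mF n) (F0 n)).
  rewrite -ge0_integralZl//; last 2 first.
  - by move=> x _; apply: integral_ge0 => z _; rewrite lee_fin slab_ge0.
  - by rewrite lee_fin sqr_ge0.
  rewrite -(setIT K) -integral_indic// -ge0_integralZl//; last 2 first.
  - by apply/measurable_EFinP; exact: measurable_indic.
  - by rewrite lee_fin divr_ge0// ltW.
  apply: ge0_le_integral => //.
  - by move=> x _; rewrite -EFinM lee_fin mulr_ge0// divr_ge0// ltW.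
  - apply/measurable_EFinP; apply: measurable_funM => //; exact: measurable_indic.
  - exact: measurable_funeM.
  move=> x _; rewrite indicE; have [|] := boolP (x \in K); last first.
    by rewrite mule0 => _; rewrite mule_ge0 ?lee_fin ?sqr_ge0//; apply: integral_ge0 => z _; rewrite lee_fin slab_ge0.
  by rewrite inE mule1 => Kx; exact: slab_test.
have mM : 0 <= 4 * M by rewrite mulr_ge0// ltW.
have lim := integral_limsup_le mu mK c0 mM mphi phiM local.
apply/lee_addgt0Pr => e e0.
have C1 : 0 < C ^+ 2 + 1 by rewrite ltr_wpDl// sqr_ge0.
have [N hN] := lim _ (divr_gt0 e0 C1).
apply: le_trans (main _ (leq_maxr N n0)) _.
apply: (@le_trans _ _ ((C ^+ 2)%:E * ((9 * tau ^+ 2 * M)%:E * mu K + (e / (C ^+ 2 + 1))%:E)))%E.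
  by apply: lee_wpmul2l; [rewrite lee_fin sqr_ge0|apply: hN; exact: leq_maxl].
rewrite ge0_muleDr; last 2 first.
- by rewrite mule_ge0// lee_fin.
- by rewrite lee_fin divr_ge0// ltW.
apply: leeD => //; rewrite -EFinM lee_fin mulrA ler_pdivrMr// mulrC ler_pM2l//.
by rewrite lerDl.
Qed.

End core.

(* FILE C7 *)

Lemma uniform_cvg_le (T : choiceType) (R : realType) (A : set T) (f : nat -> T -> R) (g : T -> R) :
  {uniform A, f @ \oo --> g} -> forall e : R, 0 < e ->
  exists N, forall n x, (N <= n)%N -> A x -> `|f n x - g x| <= e.
Proof.
move=> fg e e0.
have : nbhs (g : {uniform` A -> R}) [set h : T -> R | forall x, A x -> `|g x - h x| < e].
  apply/uniform_nbhs; exists [set xy | ball xy.1 e xy.2]; split.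
    exact: entourage_ball (PosNum e0).
  by move=> h /= hh x /hh.
move=> /fg [N _ hN]; exists N => n x Nn Ax.
by rewrite distrC; apply: ltW; exact: (hN n Nn x Ax).
Qed.

Section level_sets.
Context (R : realType) (d : nat) (hd : (0 < d)%N).
Local Notation Cd := 'rV[R[i]]_d.
Local Notation B := (@unit_ball R d).
Local Notation CB := (@closed_unit_ball R d).
Local Notation S := (@unit_sphere R d).
Local Notation sigma := (@sphere_measure R d).
Local Notation M := (ratio_mass R d).
Implicit Types (z w x : Cd) (A : set Cd).

Variable b : Cd -> R[i].
Hypothesis cb : forall z, B z -> {for z, continuous b}.
Hypothesis b_disk : forall z, B z -> normc (b z) < 1.
Variable mu : {finite_measure set Cd -> \bar R}.
Variable C : R.
Hypothesis test : forall w, B w -> ((1 - normc (b w) ^+ 2)%:E <=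
    (C ^+ 2)%:E * \int[mu]_(z in CB) (test_integrand b w z)%:E)%E.

Local Notation bv := (bvalue b).
Local Notation dil := (dilate b).

Definition level_const : R := 36 * C ^+ 2 * M.

Lemma level_const_ge0 : 0 <= level_const.
Proof.
apply: mulr_ge0; last exact/ltW/ratio_mass_gt0.
by apply: mulr_ge0 => //; exact: sqr_ge0.
Qed.

Lemma level_set_bound A (tau : R) : measurable A -> A `<=` S `&` regular b -> 0 < tau ->
  (forall x, A x -> tau / 2 <= 1 - normc (bv x) <= tau) ->
  (sigma A <= (level_const * tau)%:E * mu A)%E.
Proof.
move=> mA AS tau0 Atau; apply/lee_addgt0Pr => e e0.
have e20 : 0 < e / 2 by rewrite divr_gt0.
pose f n x : R := normc (dil n x - bv x).
have mf n : measurable_fun A (f n).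
  apply: measurable_funTS; apply: measurable_normc; apply: cmeasurableB.
    exact: cmeasurable_dilate_seq.
  exact: cmeasurable_bvalue.
have fc x : A x -> f ^~ x @ \oo --> (cst 0 : Cd -> R) x.
  move=> /AS[_ rx]; apply/cvgrPdist_le => e' e'0; have [N hN] := dilate_cvg cb rx e'0.
  by exists N => // n /= /hN; rewrite sub0r normrN ger0_norm ?normc_ge0.
have Afin : (sigma A < +oo)%E by apply: le_lt_trans (probability_le1 _ mA) _; rewrite ltry.
have [E [mE Ee /uniform_cvg_le Eu]] := pointwise_almost_uniform mf mA Afin fc e20.
have tau40 : 0 < tau / 4 by rewrite divr_gt0.
have [n0 hn0] := Eu _ tau40.
have mAE : measurable (A `\` E) by exact: measurableD.
have [K [cK KA Ke]] := @measurable_inner_regular R d sigma _ mAE _ e20.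
have mK := closed_measurableC cK.
have KS : K `<=` S by move=> x /KA [/AS[]].
have Ktau x : K x -> tau / 2 <= 1 - normc (bv x) <= tau by move=> /KA[/Atau].
have Kunif n x : (n0 <= n)%N -> K x -> normc (dil n x - bv x) <= tau / 4.
  move=> nn /KA Kx; have := hn0 n x nn Kx.
  by rewrite /f subr0 ger0_norm ?normc_ge0.
have KAA : K `<=` A by move=> x /KA[].
have core := closed_level_set_bound hd cb b_disk test cK KS tau0 Ktau Kunif.
have muKA : (mu K <= mu A)%E by apply: le_measure; rewrite ?inE.
have Kfin : sigma K \is a fin_num.
  by rewrite ge0_fin_numE//; apply: le_lt_trans (probability_le1 _ mK) _; rewrite ltry.
have mAfin : mu A \is a fin_num by exact: fin_num_measure.
have mKfin : mu K \is a fin_num by exact: fin_num_measure.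
have hK : (sigma K <= (level_const * tau)%:E * mu A)%E.
  move: core muKA; rewrite -(fineK Kfin) -(fineK mAfin) -(fineK mKfin) -!EFinM !lee_fin.
  have mK0 : 0 <= fine (mu K) by exact: fine_ge0.
  rewrite /level_const => h1 h2.
  have M0 := ratio_mass_gt0 R d; have C0 := sqr_ge0 C.
  rewrite -(ler_pM2l tau40); apply: le_trans h1 _.
  rewrite (_ : tau / 4 * _ = (C ^+ 2 * (9 * tau ^+ 2 * M)) * fine (mu A)); last by field.
  rewrite mulrA; apply: ler_wpM2l => //.
  by apply: mulr_ge0 => //; apply: mulr_ge0; [apply: mulr_ge0 => //; exact: sqr_ge0|exact: ltW].
have hA : (sigma A <= sigma K + ((e / 2)%:E + (e / 2)%:E))%E.
  have sub : A `<=` K `|` ((A `\` E `\` K) `|` E).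
    move=> x Ax; have [Kx|Kx] := pselect (K x); first by left.
    by right; have [Ex|Ex] := pselect (E x); [right|left].
  have m1 : measurable (A `\` E `\` K) by exact: measurableD.
  apply: (@le_trans _ _ (sigma (K `|` ((A `\` E `\` K) `|` E)))).
    by apply: le_measure; rewrite ?inE//; apply: measurableU => //; exact: measurableU.
  apply: le_trans (measureU2 _ _ _) _ => //; first exact: measurableU.
  apply: leeD => //; apply: le_trans (measureU2 _ _ _) _ => //.
  by apply: leeD; exact: ltW.
apply: le_trans hA _; rewrite -EFinD -splitr; exact: leeD.
Qed.

Definition level i : set Cd := [set x | [/\ S x, regular b x &
  2^-1 ^+ i.+1 < 1 - normc (bv x) <= 2^-1 ^+ i]].

Lemma measurable_modulus : measurable_fun [set: Cd] (fun x => 1 - normc (bv x)).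
Proof.
by apply: measurable_funB => //; apply: measurable_normc; exact: cmeasurable_bvalue.
Qed.

Lemma measurable_level i : measurable (level i).
Proof.
have -> : level i = (S `&` regular b) `&`
    (fun x => 1 - normc (bv x)) @^-1` `]2^-1 ^+ i.+1, 2^-1 ^+ i].
  apply/seteqP; split => x /=; first by rewrite in_itv/= => -[].
  by move=> [[Sx rx]]; rewrite in_itv.
apply: measurableI.
  by apply: measurableI; [exact: measurable_unit_sphere|exact: measurable_regular].
rewrite -[X in measurable X]setTI; apply: measurable_modulus => //.
Qed.

Lemma level_bound i : (sigma (level i) <= (level_const * 2^-1 ^+ i)%:E * mu (level i))%E.
Proof.
apply: level_set_bound.
- exact: measurable_level.
- by move=> x [].
- by rewrite exprn_gt0// invr_gt0.
by move=> x [_ _ /andP[h1 h2]]; rewrite h2 andbT ltW//; rewrite exprSr in h1.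
Qed.

Lemma trivIset_level : trivIset [set: nat] level.
Proof.
apply/trivIsetP => i j _ _; wlog ij : i j / (i < j)%N => [wl ij|_].
  by have [/wl|/wl h|/eqP] := ltngtP i j; [exact|rewrite setIC; apply: h; rewrite eq_sym|rewrite (negbTE ij)].
apply/seteqP; split => x //= [[_ _ /andP[h1 _]] [_ _ /andP[_ h2]]].
have : 2^-1 ^+ j <= 2^-1 ^+ i.+1 :> R.
  by apply: ler_wiXn2l => //; rewrite invf_le1// ler1n.
by move=> h; have := lt_le_trans h1 (le_trans h2 h); rewrite ltxx.
Qed.

Lemma bigcup_level : \bigcup_i level i = [set x | [/\ S x, regular b x & normc (bv x) < 1]].
Proof.
apply/seteqP; split => x /=.
  move=> [i _ [Sx rx /andP[h _]]]; split => //.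
  by rewrite -subr_gt0; apply: lt_trans h; rewrite exprn_gt0// invr_gt0.
move=> [Sx rx bx].
have t0 : 0 < 1 - normc (bv x) by rewrite subr_gt0.
have t1 : 1 - normc (bv x) <= 1 by rewrite gerBl normc_ge0.
have ex : exists n, 2^-1 ^+ n < 1 - normc (bv x).
  have [n /(_ n (leqnn _)) h] := le_dyadic_eps (@ler01 R) (divr_gt0 t0 (ltr0Sn R 1)).
  exists n.+1; move: h; rewrite mulr1 => h; apply: le_lt_trans h _.
  by rewrite ltr_pdivrMr// ltr_pMr// ltr1n.
case: (ex_minnP ex) => -[|i] hi imin.
  by move: hi; rewrite expr0 ltNge t1.
exists i => //; split => //; rewrite hi/= leNgt; apply/negP => /imin.
by rewrite ltnn.
Qed.

End level_sets.

(* FILE C8 *)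

Section conclusion.
Context (R : realType) (d : nat) (hd : (0 < d)%N).
Local Notation Cd := 'rV[R[i]]_d.
Local Notation B := (@unit_ball R d).
Local Notation CB := (@closed_unit_ball R d).
Local Notation S := (@unit_sphere R d).
Local Notation sigma := (@sphere_measure R d).
Implicit Types (z w x : Cd).

Variable b : Cd -> R[i].
Hypothesis cb : forall z, B z -> {for z, continuous b}.
Hypothesis b_disk : forall z, B z -> normc (b z) < 1.
Hypothesis sigma_exceptional : sigma (exceptional b) = 0%E.
Variable mu : {finite_measure set Cd -> \bar R}.
Variable C : R.
Hypothesis test : forall w, B w -> ((1 - normc (b w) ^+ 2)%:E <=
    (C ^+ 2)%:E * \int[mu]_(z in CB) (test_integrand b w z)%:E)%E.

Local Notation bv := (bvalue b).

Lemma regular_sphere z : S z -> ~ exceptional b z -> regular b z.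
Proof. by move=> Sz Nz; split => //; rewrite /closed_unit_ball/= Sz. Qed.

Lemma bvalueE z : regular b z -> bv z = radial_ext b z.
Proof. by move=> rz; rewrite /bvalue mem_set. Qed.

Lemma integral_level_le i :
  (\int[sigma]_(z in level b i) ((1 - normc (bv z))^-1)%:E <=
   (2 * level_const d C)%:E * mu (level b i))%E.
Proof.
have mA := measurable_level cb i.
have t0 : 0 < 2^-1 ^+ i.+1 :> R by rewrite exprn_gt0// invr_gt0.
have pos z : level b i z -> 2^-1 ^+ i.+1 < 1 - normc (bv z) by move=> [_ _ /andP[]].
have minv : measurable_fun [set: Cd] (fun z => (1 - normc (bv z))^-1).
  rewrite (_ : (fun _ => _) = (fun r : R => r `^ (-1)) \o (fun z => 1 - normc (bv z))).
    by apply: measurableT_comp; [exact: measurable_powR|exact: measurable_modulus].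
  by apply/funext => z /=; rewrite powR_inv1// subr_ge0 normc_bvalue.
apply: (@le_trans _ _ (\int[sigma]_(z in level b i) (2 ^+ i.+1)%:E)%E).
  apply: ge0_le_integral => //.
  - by move=> z /pos h; rewrite lee_fin invr_ge0; apply: ltW; exact: lt_trans h.
  - by apply: measurable_funTS; exact/measurable_EFinP.
  move=> z /pos h; rewrite lee_fin -[leRHS]invrK -exprVn.
  by rewrite lef_pV2 ?posrE ?ltW//; exact: lt_trans h.
rewrite integral_cst//.
apply: (@le_trans _ _ ((2 ^+ i.+1)%:E * ((level_const d C * 2^-1 ^+ i)%:E * mu (level b i)))%E).
  by apply: lee_wpmul2l; [rewrite lee_fin exprn_ge0|exact: level_bound].
rewrite muleA -EFinM (_ : 2 ^+ i.+1 * _ = 2 * level_const d C)//.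
have : 2 ^+ i != 0 :> R by rewrite expf_neq0.
by rewrite exprS exprVn; move: (2 ^+ i) (level_const d C) => c l c0; field.
Qed.

Lemma integral_inv_modulus_finite :
  (\int[sigma]_(z in [set z | S z /\ (normc (radial_ext b z) < 1)%R])
     ((1 - normc (radial_ext b z))^-1)%:E < +oo)%E.
Proof.
have mA i := measurable_level cb i.
pose U := \bigcup_i level b i.
have mU : measurable U by exact: bigcup_measurable.
have minv : measurable_fun [set: Cd] (fun z => ((1 - normc (bv z))^-1)%:E).
  apply/measurable_EFinP.
  rewrite (_ : (fun _ => _) = (fun r : R => r `^ (-1)) \o (fun z => 1 - normc (bv z))).
    by apply: measurableT_comp; [exact: measurable_powR|exact: measurable_modulus].
  by apply/funext => z /=; rewrite powR_inv1// subr_ge0 normc_bvalue.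
have inv0 z : (0 <= ((1 - normc (bv z))^-1)%:E)%E.
  by rewrite lee_fin invr_ge0 subr_ge0 normc_bvalue.
apply: (@le_lt_trans _ _ (\int[sigma]_(z in U) ((1 - normc (bv z))^-1)%:E)%E).
  rewrite integral_mkcond [leRHS]integral_mkcond.
  apply: (@le_integral_null _ _ _ _ _ _ (exceptional b)) => //.
  - move=> z; rewrite patchE; case: ifPn => //; rewrite inE/= => -[_ h].
    by rewrite lee_fin invr_ge0 subr_ge0 ltW.
  - by move=> z; rewrite patchE; case: ifPn.
  - by apply/(measurable_restrictT _ mU); exact: measurable_funTS.
  - exact: measurable_exceptional.
  move=> z Nz; rewrite !patchE; case: ifPn; last by case: ifPn.
  rewrite inE/= => -[Sz bz]; have rz := regular_sphere Sz Nz.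
  rewrite mem_set ?bvalueE// /U bigcup_level// /=; split => //.
  by rewrite bvalueE.
rewrite ge0_integral_bigcup//; last 2 first.
- exact: measurable_funTS.
- exact: trivIset_level.
apply: (@le_lt_trans _ _ (\sum_(i <oo) (2 * level_const d C)%:E * mu (level b i))%E).
  apply: lee_nneseries => [i _ _|i _]; first by apply: integral_ge0.
  exact: integral_level_le.
rewrite nneseriesZl// -measure_semi_bigcup//; last exact: trivIset_level.
have Uoo : (mu U < +oo)%E by rewrite ltey_eq fin_num_measure.
apply: lte_mul_pinfty => //.
by rewrite lee_fin mulr_ge0// level_const_ge0.
Qed.

Lemma singular_inner (N : set Cd) : measurable N -> sigma N = 0%E ->
  mu ((~` N) `&` S) = 0%E -> inner_function b.
Proof.
move=> mN N0 muN.
have mS := @measurable_unit_sphere R d; have mA i := measurable_level cb i.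
pose U := \bigcup_i level b i.
have mU : measurable U by exact: bigcup_measurable.
have A0 i : sigma (level b i `\` N) = 0%E.
  have mAN : measurable (level b i `\` N) by exact: measurableD.
  have muA : mu (level b i `\` N) = 0%E.
    apply: (@subset_measure0 _ _ _ mu _ ((~` N) `&` S)) => //.
      by apply: measurableI => //; exact: measurableC.
    by move=> x [[Sx _ _] Nx].
  apply/eqP; rewrite eq_le measure_ge0 andbT.
  have t0 : 0 < 2^-1 ^+ i :> R by rewrite exprn_gt0// invr_gt0.
  have := @level_set_bound R d hd b cb b_disk mu C test _ (2^-1 ^+ i) mAN.
  rewrite muA mule0; apply => //; first by move=> x [[]].
  by move=> x [[_ _ /andP[h1 h2]] _]; rewrite h2 andbT ltW//; rewrite exprSr in h1.
have mAN i : measurable (level b i `\` N) by exact: measurableD.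
have U0 : sigma (\bigcup_i (level b i `\` N)) = 0%E.
  apply: measure_negligible.
    exact: bigcup_measurable.
  by apply: negligible_bigcup => i; apply/negligibleP => //; exact: A0.
exists (\bigcup_i (level b i `\` N) `|` (N `|` exceptional b)); split.
- apply: measurableU; first exact: bigcup_measurable.
  by apply: measurableU => //; exact: measurable_exceptional.
- apply: measure_negligible.
    apply: measurableU; first exact: bigcup_measurable.
    by apply: measurableU => //; exact: measurable_exceptional.
  apply: negligibleU.
    by apply/negligibleP => //; exact: bigcup_measurable.
  by apply: negligibleU; apply/negligibleP => //; exact: measurable_exceptional.
move=> z /= /not_implyP[Sz bz].
have [Nz|Nz] := pselect (N z); first by right; left.
have [Ez|Ez] := pselect (exceptional b z); first by right; right.
have rz := regular_sphere Sz Ez; left.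
have : U z.
  rewrite /U bigcup_level//; split => //; rewrite bvalueE// lt_neqAle -bvalueE//.
  by rewrite normc_bvalue// andbT bvalueE//; apply/eqP.
by move=> [i _ Ai]; exists i.
Qed.

End conclusion.

Theorem corollary1 (R : realType) (d : nat) (hd : (0 < d)%N)
    (mu : {finite_measure set 'rV[R[i]]_d -> \bar R})
    (hmu : mu (~` @closed_unit_ball R d) = 0%E)
    (b : 'rV[R[i]]_d -> R[i])
    (b_holomorphic : holomorphic_on (@unit_ball R d) b)
    (b_disk : forall z, @unit_ball R d z -> Normc.normc (b z) < 1)
    (b_admissible : admissible mu b)
    (b_noninner : ~ inner_function b)
    (H : dbr_space b)
    (mu_reverse : reverse_carleson mu H) :
  ~ {ae @sphere_measure R d, forall z,
       ac_density (mrestr mu (@measurable_unit_sphere R d))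
                  (@sphere_measure R d) z = 0} /\
  (\int[@sphere_measure R d]_(z in
      [set z | unit_sphere z /\ (Normc.normc (radial_ext b z) < 1)%R])
     ((1 - Normc.normc (radial_ext b z))^-1)%:E < +oo)%E.
Proof.
have cb := holomorphic_continuous b_holomorphic.
have [C C0 hC] := mu_reverse.
have test := reverse_carleson_test b_holomorphic b_disk hmu b_admissible C0 hC.
have sE : sphere_measure (exceptional b) = 0%E.
  have [N [mN N0 hN]] := fatou_sphere H b_holomorphic b_disk.
  apply: (@subset_measure0 _ _ _ (@sphere_measure R d) _ N) => //.
    exact: measurable_exceptional.
  by move=> z [osc Sz]; apply: hN => /= h; exact: (radial_cvg_oscillation Sz (h Sz) osc).
split; last exact: integral_inv_modulus_finite test.
move=> ac0; apply: b_noninner.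
have mS := @measurable_unit_sphere R d.
have nufin : (mrestr mu mS [set: 'rV[R[i]]_d] < +oo)%E.
  by rewrite /mrestr setTI ltey_eq fin_num_measure.
have [mh h0 hint [nus [N [mN N0 nusN]] nuE]] := ac_densityP (@sphere_measure R d) nufin.
apply: (singular_inner hd cb b_disk sE test mN N0).
have mNC : measurable (~` N) by exact: measurableC.
have := nuE _ mNC; rewrite nusN adde0 /= /mrestr => ->.
apply: (etrans (y := (\int[sphere_measure (d:=d)]_(x in ~` N) 0)%E)); last exact: integral0.
apply: ae_eq_integral => //.
- by apply: measurable_funTS; apply/measurable_EFinP.
- by apply: filterS ac0 => z hz _; congr (_%:E); exact: hz.
Qed.
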